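(* Let $\lambda\supset\mu$ and $\tilde\lambda\supset\tilde\mu$ be two pairs of partitions (of length at most $M$) whose skew diagrams coincide, i.e. $\lambda/\mu=\tilde\lambda/\tilde\mu$ as sets of boxes $(i,j)$. Then the leaves agree: $L^{\lambda}_{\mu}=L^{\tilde\lambda}_{\tilde\mu}$. In other words, the leaf $L^\lambda_\mu$ depends only on the skew diagram $\lambda/\mu$.
   Context: Fix a positive integer $M$, let $\alpha$ be an indeterminate, $r=1/\alpha$ and $\mathbb{F}=\mathbb{Q}(\alpha)$. A partition $\lambda=(\lambda_1\ge\cdots\ge\lambda_M\ge0)$ is identified with its Young diagram, the set of boxes $(i,j)$ with $1\le j\le\lambda_i$ (row $i$, column $j$, rows numbered from the top); $\lambda'_j=\#\{i:\lambda_i\ge j\}$. For a box $s=(i,j)\in\lambda$, $\mathrm{arm}_\lambda(s)=\lambda_i-j$ and $\mathrm{leg}_\lambda(s)=\lambda'_j-i$; the $r$-hooks are $c_\lambda(s)=\mathrm{arm}_\lambda(s)+r\,\mathrm{leg}_\lambda(s)+r$ and $c'_\lambda(s)=\mathrm{arm}_\lambda(s)+r\,\mathrm{leg}_\lambda(s)+1$. Dominance order: $\mu\le\lambda$ iff $|\mu|=|\lambda|$ and $\mu_1+\cdots+\mu_i\le\lambda_1+\cdots+\lambda_i$ for all $i$; containment: $\mu\subset\lambda$ iff $\mu_i\le\lambda_i$ for all $i$. The Jack polynomial $P_\lambda=P^{(\alpha)}_\lambda(x_1,\dots,x_M)$ is the unique eigenfunction of $D(\alpha)=\frac{\alpha}{2}\sum_i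 x_i^2\partial^2/\partial x_i^2+\sum_{i\ne j}\frac{x_i^2}{x_i-x_j}\partial/\partial x_i$ of the form $m_\lambda+\sum_{\mu<\lambda}v_{\lambda\mu}m_\mu$ ($m_\mu$ the monomial symmetric polynomials, $\mu<\lambda$ in dominance order). The Jack binomial coefficients $b^\lambda_\mu\in\mathbb{F}$ are defined by $\frac{P_\lambda(1+x_1,\dots,1+x_M)}{P_\lambda(1,\dots,1)}=\sum_\mu b^\lambda_\mu\frac{P_\mu(x_1,\dots,x_M)}{P_\mu(1,\dots,1)}$. For $\mu\subset\lambda$ the boxes of $\lambda$ are decomposed as: $S=\lambda/\mu$ (boxes of $\lambda$ not in $\mu$); $R=\{(i,j)\in\mu:\mu_i<\lambda_i,\ \mu'_j=\lambda'_j\}$; $C=\{(i,j)\in\mu:\mu_i=\lambda_i,\ \mu'_j<\lambda'_j\}$; $J=\{(i,j)\in\mu:\mu_i<\lambda_i,\ \mu'_j<\lambda'_j\}$; $N=\{(i,j)\in\mu:\mu_i=\lambda_i,\ \mu'_j=\lambda'_j\}$. The stem is $K^\lambda_\mu=\Big(\prod_{b\in C}\frac{c_\lambda(b)}{c_\mu(b)}\Big)\Big(\prod_{b\in R}\frac{c'_\lambda(b)}{c'_\mu(b)}\Big)\Big(\prod_{b\in J}\frac{1}{c_\mu(b)c'_\mu(b)}\Big)$ and the leaf is $L^\lambda_\mu=b^\lambda_\mu/K^\lambda_\mu$. *)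

(* Defs.v *)
From mathcomp Require Import all_boot all_order all_algebra.
From mathcomp.multinomials Require Import mpoly.
From Stdlib Require Import ClassicalEpsilon.

Set Implicit Arguments.
Unset Strict Implicit.
Unset Printing Implicit Defensive.

Import GRing.Theory.
Local Open Scope ring_scope.

Notation FF := {fraction {poly rat}}.

Definition alpha : FF := tofrac 'X.
Definition rr : FF := alpha^-1.

(** A partition of length at most M is a non-increasing exponent vector
    ['X_{1..M}], so that |lam| is [mdeg lam] and containment is the pointwise
    order [(mu <= lam)%MM].  Rows and columns are numbered from 0: the box
    [(i, j)], with [i : 'I_M] and [j : nat], stands for row i+1 and column j+1,
    and belongs to the diagram of lam iff [j < lam i]. *)
Section Partitions.

Variable M : nat.
Implicit Types lam mu : 'X_{1..M}.

Definition is_part lam : bool :=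
  [forall i : 'I_M, forall j : 'I_M, (i <= j)%N ==> (lam j <= lam i)%N].

Definition conj_part lam (j : nat) : nat := #|[set i : 'I_M | (j < lam i)%N]|.

Definition dominated mu lam : bool :=
  (mdeg mu == mdeg lam) &&
  [forall k : 'I_M, (\sum_(i < M | (i <= k)%N) mu i
                       <= \sum_(i < M | (i <= k)%N) lam i)%N].

Definition in_skew lam mu (i : 'I_M) (j : nat) : bool :=
  (j < lam i)%N && ~~ (j < mu i)%N.

(** The subtractions do not truncate on the boxes of lam. *)
Definition arm lam (i : 'I_M) (j : nat) : nat := (lam i - j.+1)%N.
Definition leg lam (i : 'I_M) (j : nat) : nat := (conj_part lam j - i.+1)%N.

Definition hook lam (i : 'I_M) (j : nat) : FF :=
  (arm lam i j)%:R + rr * (leg lam i j)%:R + rr.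
Definition hook' lam (i : 'I_M) (j : nat) : FF :=
  (arm lam i j)%:R + rr * (leg lam i j)%:R + 1.

Definition in_R lam mu (i : 'I_M) (j : nat) : bool :=
  [&& (j < mu i)%N, (mu i < lam i)%N & conj_part mu j == conj_part lam j].
Definition in_C lam mu (i : 'I_M) (j : nat) : bool :=
  [&& (j < mu i)%N, mu i == lam i & (conj_part mu j < conj_part lam j)%N].
Definition in_J lam mu (i : 'I_M) (j : nat) : bool :=
  [&& (j < mu i)%N, (mu i < lam i)%N & (conj_part mu j < conj_part lam j)%N].

Definition stem lam mu : FF :=
  (\prod_(i < M) \prod_(j < mu i | in_C lam mu i j)
      (hook lam i j / hook mu i j)) *
  (\prod_(i < M) \prod_(j < mu i | in_R lam mu i j)
      (hook' lam i j / hook' mu i j)) *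
  (\prod_(i < M) \prod_(j < mu i | in_J lam mu i j)
      (hook mu i j * hook' mu i j)^-1).

End Partitions.

Section Jack.

Variable M : nat.
Implicit Types (lam mu : 'X_{1..M}) (p : {mpoly FF[M]}).

(** m_mu: the sum of all distinct monomials obtained by permuting exponents. *)
Definition msymm mu : {mpoly FF[M]} :=
  \sum_(m : 'X_{1..M < (mdeg mu).+1} | perm_eq (val m) mu) 'X_[val m].

(** The operator takes values in rational functions in x_1, ..., x_M, because
    of the denominators x_i - x_j. *)
Definition D_op p : {fraction {mpoly FF[M]}} :=
  \sum_(i < M) tofrac ((alpha / 2%:R) *: ('X_i ^+ 2 * p^`M(i)^`M(i))) +
  \sum_(i < M) \sum_(j < M | i != j)
    tofrac ('X_i ^+ 2) / tofrac ('X_i - 'X_j) * tofrac p^`M(i).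

Definition is_jack lam p : Prop :=
  (exists e : FF, D_op p = tofrac (e *: p)) /\
  (exists v : 'X_{1..M} -> FF,
     p = msymm lam +
         \sum_(mu : 'X_{1..M < (mdeg lam).+1}
               | [&& is_part mu, dominated mu lam & val mu != lam])
            v mu *: msymm mu).

(** [is_jack lam] has exactly one solution when lam is a partition (the
    eigenvalues attached to comparable partitions are distinct over Q(alpha)),
    so that [epsilon] selects it. *)
Definition jack lam : {mpoly FF[M]} := epsilon (inhabits 0) (is_jack lam).

Definition at_ones p : FF := p.@[fun=> 1].

Definition shift1 p : {mpoly FF[M]} := p \mPo [tuple 1 + 'X_i | i < M].

(** The expansion is a finite linear combination of Jack polynomials, indexed
    by partitions of size less than some d, the other coefficients being 0. *)
Definition is_jack_binomial lam (b : 'X_{1..M} -> FF) : Prop :=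
  exists d : nat,
    (forall mu, is_part mu -> (d <= mdeg mu)%N -> b mu = 0) /\
    (at_ones (jack lam))^-1 *: shift1 (jack lam) =
      \sum_(mu : 'X_{1..M < d} | is_part mu)
         b mu *: ((at_ones (jack mu))^-1 *: jack mu).

(** The coefficients of [is_jack_binomial lam] at partitions are unique, the
    Jack polynomials being linearly independent and nonzero at (1,...,1). *)
Definition jack_binomial lam : 'X_{1..M} -> FF :=
  epsilon (inhabits (fun=> 0)) (is_jack_binomial lam).

Definition leaf lam mu : FF := jack_binomial lam mu / stem lam mu.

End Jack.

(* Main.v *)
Require Import Defs.
From HB Require Import structures.
From mathcomp Require Import all_boot all_order all_algebra all_fingroup.
From mathcomp.multinomials Require Import mpoly.
From mathcomp Require Import zify ring.
From Stdlib Require Import ClassicalEpsilon.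

Set Implicit Arguments.
Unset Strict Implicit.
Unset Printing Implicit Defensive.

Import GRing.Theory.
Local Open Scope ring_scope.

(** The joint spectrum of the Cherednik operators [Y_i = x_i d_i + r sum_(k > i) s_ik],
    where the [d_i] are the Dunkl operators, separates partitions: up to a scalar the
    Jack polynomial of [lam] is the only symmetric polynomial on which every
    [prod_j (u - Y_j)] acts by [prod_j (u - y_j)], with [y_j = lam_j + r (M - j)] for
    [1 <= j <= M].  Writing a symmetric eigenvector as a sum of eigenvectors of [Y_M] by
    Lagrange interpolation, and using that [c d_M] ([c] the cyclic permutation of the
    variables) shifts the spectrum, one finds how [E = sum_i d/dx_i] acts on the Jack
    polynomials [p_lam] normalised by [p_lam (1, ..., 1) = 1]:
<<
      E p_lam = sum_i a_i p_(lam - e_i),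
      a_i = y_i prod_(j != i) (y_i - y_j - r) / (y_i - y_j).
>>
    The factor [prod_(j != i) (y_i - y_j - r)] comes from evaluating at [(1, ..., 1)],
    which is invariant under permutations and makes the difference
    [prod_j (u + r - Y_j) - prod_j (u - Y_j)] telescope into [M] terms of equal value.
    As translation by [(1, ..., 1)] commutes with [E], comparing degrees gives
    [(|lam| - |mu|) b^lam_mu = sum_i a_i b^(lam - e_i)_mu].  Finally
    [a_i] is the stem of [(lam, lam - e_i)], and in
    [stem lam nu * stem nu mu / stem lam mu] only the boxes whose row and column both
    meet [lam / mu] contribute; the arms and legs of these are determined by the skew
    diagrams, so the leaf is too, by induction on the size of [lam / mu]. *)

(** * Divided differences *)

(** [jack] and [jack_binomial] are chosen by [epsilon], so nothing is known of them before existence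
    and uniqueness are proved. Uniqueness comes from [sum_i Y_i^2], which on symmetric polynomials
    is [D(alpha)] up to a scaling, the degree operator and a constant; its eigenvalues separate
    comparable partitions. Existence comes from the affine raising operator [x_M c^-1], the
    counterpart of [c d_M]: boxes are added one at a time, and the value at [(1, ..., 1)], known as
    a product, certifies that the result is not 0. A symmetric polynomial is in general no
    eigenvector of a single [Y_j], hence the product [prod_j (u - Y_j)], which commutes with
    permutations; no basis of nonsymmetric Jack polynomials is built. What the spectral arguments
    use of [r] is that 1 and [r] are linearly independent over the integers. Lowering a row that is
    not removable yields a spectrum that belongs to no partition, and a symmetric joint eigenvector
    with such a spectrum is 0; this cuts the sum over [i] in [E p_lam] down to the removable
    rows. *)

Section Mperm.
Variables (n : nat) (R : comNzRingType).
Implicit Types (p : {mpoly R[n]}) (s : 'S_n).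

Lemma msymXU s (k : 'I_n) : msym s ('X_k : {mpoly R[n]}) = 'X_(s k).
Proof.
rewrite msymX; congr 'X_[_]; apply/mnmP => i.
by rewrite !mnmE -[in RHS](permKV s i) (inj_eq perm_inj).
Qed.

Lemma msym_mderiv s i p : msym s p^`M(i) = (msym s p)^`M(s i).
Proof.
apply/mpolyP => m; rewrite mcoeff_sym !mcoeff_deriv mcoeff_sym mnmE.
congr (p@_ _ *+ _); apply/mnmP => k.
by rewrite !mnmE (inj_eq perm_inj).
Qed.

Lemma tperm_mnm (i j : 'I_n) (m : 'X_{1..n}) :
  [multinom m (tperm i j k) | k < n]
    = (m - U_(i) *+ (m i - m j) + U_(j) *+ (m i - m j)
         - U_(j) *+ (m j - m i) + U_(i) *+ (m j - m i))%MM.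
Proof.
apply/mnmP => k; rewrite !(mnmE, mnmDE, mnmBE, mulmnE, mnm1E).
case: tpermP => [->|->|/eqP ki /eqP kj].
- by rewrite eqxx; case: eqVneq => [->|_] /=; lia.
- by rewrite eqxx; case: eqVneq => [->|_] /=; lia.
by rewrite eq_sym (negPf ki) eq_sym (negPf kj); lia.
Qed.

Lemma mderivXU (i j : 'I_n) : ('X_j : {mpoly R[n]})^`M(i) = (i == j)%:R.
Proof.
rewrite mderivX mnm1E eq_sym; case: eqP => [->|_]; last by rewrite scale0r.
by rewrite -[X in (X - _)%MM]add0m addmK mpolyX0 scale1r.
Qed.

End Mperm.

Lemma mnm_neq0P n (m : 'X_{1..n}) : m != 0%MM -> exists i, m i != 0%N.
Proof.
move=> nz; apply/existsP; apply: contraNT nz => /existsPn m0.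
by apply/eqP/mnmP => i; rewrite mnm0E; apply/eqP; rewrite -[_ == _]negbK.
Qed.

(** Suited to identities between linear operators whose commutation rule with multiplication by each
    variable is known. *)
Lemma mpoly_ind_vars n (R : comNzRingType) (P : {mpoly R[n]} -> Prop) :
  P 1 -> (forall c p q, P p -> P q -> P (c *: p + q)) ->
  (forall k p, P p -> P ('X_k * p)) -> forall p, P p.
Proof.
move=> P1 PD PX.
have P0 : P 0 by have := PD (-1) _ _ P1 P1; rewrite scaleN1r addNr.
have PXm m : P 'X_[m].
  have [d] := ubnP (mdeg m); elim: d m => // d IH m /ltnSE md.
  have [->|nz] := eqVneq m 0%MM; first by rewrite mpolyX0.
  have [i mi] := mnm_neq0P nz.
  have le : (U_(i) <= m)%MM by rewrite lep1mP.
  rewrite -(submK le) addmC mpolyXD; apply/PX/IH.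
  by move: md; rewrite -{1}(submK le) mdegD mdeg1 addn1.
move=> p; elim/mpolyind: p => [//|c m p _ _ Pp]; exact: PD.
Qed.

Section DividedDifference.
Variables (n : nat) (F : fieldType).
Implicit Types (i j k : 'I_n) (m : 'X_{1..n}) (p q : {mpoly F[n]}).

Local Notation tr i j := (msym (tperm i j)).

(** The quotient of [X^m - s_ij X^m] by [x_i - x_j], written out as a geometric sum. Subtraction
    truncates, so at most one of the two sums is nonempty. *)
Definition ddX i j m : {mpoly F[n]} :=
  \sum_(t < m i - m j) 'X_[m - U_(i) *+ t.+1 + U_(j) *+ t] -
  \sum_(t < m j - m i) 'X_[m - U_(j) *+ t.+1 + U_(i) *+ t].

Lemma telescopeX i j m (k : nat) : (k <= m i)%N ->
  ('X_i - 'X_j) * (\sum_(t < k) 'X_[m - U_(i) *+ t.+1 + U_(j) *+ t])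
    = 'X_[m] - 'X_[m - U_(i) *+ k + U_(j) *+ k] :> {mpoly F[n]}.
Proof.
elim: k => [|k IH] km.
  rewrite big_ord0 mulr0 [in RHS](_ : _ + _ = m)%MM ?subrr //.
  by apply/mnmP => l; rewrite !(mnmE, mnmDE, mnmBE, mulmnE) !muln0; lia.
rewrite big_ord_recr /= mulrDr IH; last exact: ltnW.
rewrite mulrBl -!mpolyXD.
have -> : (U_(i) + (m - U_(i) *+ k.+1 + U_(j) *+ k) = m - U_(i) *+ k + U_(j) *+ k)%MM.
  apply/mnmP => l; rewrite !(mnmE, mnmDE, mnmBE, mulmnE, mnm1E).
  by case: (eqVneq i l) => [<-|_] /=; lia.
have -> : (U_(j) + (m - U_(i) *+ k.+1 + U_(j) *+ k) = m - U_(i) *+ k.+1 + U_(j) *+ k.+1)%MM.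
  by apply/mnmP => l; rewrite !(mnmE, mnmDE, mnmBE, mulmnE, mnm1E); lia.
by rewrite addrA subrK.
Qed.

Lemma ddXP i j m : ('X_i - 'X_j) * ddX i j m = 'X_[m] - tr i j 'X_[m].
Proof.
rewrite /ddX mulrBr telescopeX ?leq_subr // -['X_i - 'X_j]opprB mulNr.
rewrite telescopeX ?leq_subr // msymX tpermV tperm_mnm.
case: (leqP (m i) (m j)) => [le|/ltnW le]; rewrite (eqP le) !mulm0n !addm0 !subm0.
  by rewrite subrr; ring.
by rewrite subrr oppr0 subr0.
Qed.

Definition dd i j p : {mpoly F[n]} := \sum_(m <- msupp p) p@_m *: ddX i j m.

Lemma dd_eq i j p : ('X_i - 'X_j) * dd i j p = p - tr i j p.
Proof.
have -> : p - tr i j p = \sum_(m <- msupp p) (p@_m *: 'X_[m] - tr i j (p@_m *: 'X_[m])).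
  by rewrite sumrB -raddf_sum -mpolyE.
rewrite mulr_sumr; apply: eq_bigr => m _ /=.
by rewrite linearZ /= -scalerAr ddXP scalerBr.
Qed.

Lemma ddX_id i m : ddX i i m = 0.
Proof. by rewrite /ddX subrr. Qed.

Lemma dd_id i p : dd i i p = 0.
Proof. by rewrite /dd big1 // => m _; rewrite ddX_id scaler0. Qed.

Lemma subX_neq0 i j : i != j -> 'X_i - 'X_j != 0 :> {mpoly F[n]}.
Proof.
move=> ij; apply/negP => /eqP /(congr1 (mcoeff U_(i))).
rewrite mcoeffB !mcoeffXU eqxx eq_sym (negPf ij) mcoeff0 subr0 => /eqP.
by rewrite oner_eq0.
Qed.

(** Cancellation in an integral domain; the rules for [dd] are then checked after multiplication by
    [x_i - x_j]. *)
Lemma dd_unique i j p q : i != j -> ('X_i - 'X_j) * q = p - tr i j p -> q = dd i j p.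
Proof. by move=> /subX_neq0 /mulfI inj; rewrite -dd_eq => /inj. Qed.

Lemma dd_is_linear i j : linear (dd i j).
Proof.
move=> c p q; have [->|ij] := eqVneq i j; first by rewrite !dd_id scaler0 addr0.
apply/esym/dd_unique => //.
by rewrite mulrDr -scalerAr !dd_eq linearP /= scalerBr opprD addrACA.
Qed.

HB.instance Definition _ i j :=
  GRing.isLinear.Build F {mpoly F[n]} {mpoly F[n]} _ (dd i j) (dd_is_linear i j).

Lemma msym_dd (s : 'S_n) i j p : msym s (dd i j p) = dd (s i) (s j) (msym s p).
Proof.
have [->|ij] := eqVneq i j; first by rewrite !dd_id raddf0.
apply: dd_unique; first by rewrite (inj_eq perm_inj).
have /(congr1 (msym s)) := dd_eq i j p.
rewrite rmorphM !rmorphB /= !msymXU => ->; congr (_ - _).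
by rewrite -!msymMm -tpermJ mulgA mulgV mul1g.
Qed.

Lemma ddC i j p : dd i j p = - dd j i p.
Proof.
have [->|ij] := eqVneq i j; first by rewrite !dd_id oppr0.
by apply/esym/dd_unique => //; rewrite mulrN -mulNr opprB dd_eq tpermC.
Qed.

Lemma ddM i j p q : dd i j (p * q) = dd i j p * q + tr i j p * dd i j q.
Proof.
have [->|ij] := eqVneq i j; first by rewrite !dd_id mul0r mulr0 addr0.
apply/esym/dd_unique => //.
rewrite mulrDr mulrA dd_eq mulrCA dd_eq rmorphM /=; ring.
Qed.

Lemma dd1 i j : dd i j 1 = 0.
Proof.
have [->|ij] := eqVneq i j; first by rewrite dd_id.
by apply/esym/dd_unique; rewrite // rmorph1 subrr mulr0.
Qed.

Lemma ddXU_l i j : i != j -> dd i j 'X_i = 1.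
Proof.
by move=> ij; apply/esym/dd_unique; rewrite // msymXU tpermL mulr1.
Qed.

Lemma ddXU_r i j : i != j -> dd i j 'X_j = - 1.
Proof. by move=> ij; rewrite ddC ddXU_l // eq_sym. Qed.

Lemma ddXU_other i j k : k != i -> k != j -> dd i j 'X_k = 0.
Proof.
move=> ki kj; have [->|ij] := eqVneq i j; first by rewrite dd_id.
apply/esym/dd_unique; rewrite // msymXU tpermD 1?eq_sym //.
by rewrite subrr mulr0.
Qed.

Lemma dd_mulXl i j p : i != j -> dd i j ('X_i * p) = 'X_i * dd i j p + tr i j p.
Proof.
move=> ij; rewrite ddM ddXU_l // msymXU tpermL mul1r.
have /eqP := dd_eq i j p; rewrite mulrBl subr_eq => /eqP ->; ring.
Qed.

Lemma dd_mulXr i j p : i != j -> dd i j ('X_j * p) = 'X_j * dd i j p - tr i j p.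
Proof.
move=> ij; rewrite ddM ddXU_r // msymXU tpermR mulN1r.
have /eqP := dd_eq i j p; rewrite mulrBl subr_eq => /eqP ->; ring.
Qed.

Lemma dd_mulX i j k p : k != i -> k != j -> dd i j ('X_k * p) = 'X_k * dd i j p.
Proof.
by move=> ki kj; rewrite ddM ddXU_other // msymXU mul0r add0r tpermD 1?eq_sym.
Qed.

Lemma dd_sym0 i j p : p \is symmetric -> dd i j p = 0.
Proof.
move=> /issymP sp; have [->|ij] := eqVneq i j; first by rewrite dd_id.
by apply/esym/dd_unique; rewrite // sp subrr mulr0.
Qed.

End DividedDifference.

(** * Dunkl and Cherednik operators *)

(** The summand [j = i] vanishes by [dd_id]; keeping it lets every permutation reindex the sum. *)
HB.lock Definition dunkl (n : nat) (F : fieldType) (r : F) (i : 'I_n) (p : {mpoly F[n]}) :=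
  p^`M(i) + r *: \sum_j dd i j p.

Section Dunkl.
Variables (n : nat) (F : fieldType) (r : F).
Implicit Types (i j k : 'I_n) (p q : {mpoly F[n]}).

Local Notation tr i j := (msym (tperm i j)).

Lemma dunklE i p : dunkl r i p = p^`M(i) + r *: \sum_j dd i j p.
Proof. by rewrite unlock. Qed.

Local Notation dunkl := (dunkl r).

Lemma dunkl_is_linear i : linear (dunkl i).
Proof.
move=> c p q; rewrite !dunklE linearP /= scalerDr addrACA; congr (_ + _).
rewrite scalerA mulrC -scalerA -scalerDr; congr (_ *: _).
by rewrite scaler_sumr -big_split; apply: eq_bigr => j _; rewrite linearP.
Qed.

HB.instance Definition _ i :=
  GRing.isLinear.Build F {mpoly F[n]} {mpoly F[n]} _ (dunkl i) (dunkl_is_linear i).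

Lemma dunklD i : {morph dunkl i : p q / p + q}.
Proof. exact: linearD. Qed.

Lemma dunklB i : {morph dunkl i : p q / p - q}.
Proof. exact: linearB. Qed.

Lemma dunklZ i c p : dunkl i (c *: p) = c *: dunkl i p.
Proof. exact: linearZ. Qed.

Lemma dunkl_sum i (I : Type) (s : seq I) (P : pred I) (f : I -> {mpoly F[n]}) :
  dunkl i (\sum_(a <- s | P a) f a) = \sum_(a <- s | P a) dunkl i (f a).
Proof. exact: raddf_sum. Qed.

Lemma msym_dunkl (s : 'S_n) i p : msym s (dunkl i p) = dunkl (s i) (msym s p).
Proof.
rewrite !dunklE linearD linearZ /= msym_mderiv; congr (_ + _ *: _).
rewrite raddf_sum [RHS](reindex_perm s) /=.
by apply: eq_bigr => j _; rewrite msym_dd.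
Qed.

Lemma dunkl1 i : dunkl i 1 = 0.
Proof.
rewrite !dunklE -mpolyC1 mderivC add0r big1 ?scaler0 // => j _.
by rewrite mpolyC1 dd1.
Qed.

Lemma dunkl_sym i p : p \is symmetric -> dunkl i p = p^`M(i).
Proof.
by move=> sp; rewrite !dunklE big1 ?scaler0 ?addr0 // => j _; rewrite dd_sym0.
Qed.

Lemma dunkl_mulX i k p : i != k ->
  dunkl i ('X_k * p) = 'X_k * dunkl i p - r *: tr i k p.
Proof.
move=> ik; rewrite !dunklE mderivM mderivXU (negPf ik) mul0r add0r.
rewrite mulrDr -addrA; congr (_ + _).
rewrite -scalerAr -scalerBr; congr (_ *: _).
rewrite (bigD1 k) //= [in RHS](bigD1 k) //= dd_mulXr // mulrDr addrAC.
congr (_ + _ - _); rewrite mulr_sumr; apply: eq_bigr => j jk.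
by rewrite dd_mulX // eq_sym.
Qed.

Lemma dunkl_mulX_id i p :
  dunkl i ('X_i * p) = 'X_i * dunkl i p + p + r *: \sum_(j | j != i) tr i j p.
Proof.
rewrite !dunklE mderivM mderivXU eqxx mul1r.
have -> : \sum_j dd i j ('X_i * p)
    = 'X_i * (\sum_j dd i j p) + \sum_(j | j != i) tr i j p.
  rewrite (bigD1 i) //= [in RHS](bigD1 i) //= !dd_id !add0r mulr_sumr -big_split.
  by apply: eq_bigr => j ji; rewrite dd_mulXl // eq_sym.
by rewrite -!mul_mpolyC; ring.
Qed.

Lemma dunkl_tr i j k p : k != i -> k != j -> dunkl k (tr i j p) = tr i j (dunkl k p).
Proof. by move=> ki kj; rewrite msym_dunkl tpermD 1?eq_sym. Qed.

(** The delicate case of the induction, where the variable is one of the two directions. The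
    reflection terms of the two sides match because [s_ij] exchanges the operators [d_i] and
    [d_j]. *)
Lemma dunkl_comm_mulX i j p : i != j ->
  dunkl i (dunkl j p) = dunkl j (dunkl i p) ->
  dunkl i (dunkl j ('X_i * p)) = dunkl j (dunkl i ('X_i * p)).
Proof.
move=> ij com; have ji : j != i by rewrite eq_sym.
rewrite dunkl_mulX // dunkl_mulX_id dunklB !dunklD !dunklZ dunkl_mulX_id.
rewrite dunkl_mulX // com dunkl_sum (bigD1 j) //= [in RHS](bigD1 j) //=.
rewrite [\sum_(k | _) dunkl j _](eq_bigr (fun l => tr i l (dunkl j p))); last first.
  by move=> l /andP[li lj]; rewrite dunkl_tr // eq_sym.
have := msym_dunkl (tperm i j) i p; have := msym_dunkl (tperm i j) j p.
rewrite tpermL tpermR (tpermC j i) => -> ->.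
by rewrite -!mul_mpolyC; ring.
Qed.

(** Induction on multiplication by one variable [x_k]: if [k] is neither [i] nor [j], the
    corrections [r s_ik] and [r s_jk] commute with [d_j] and [d_i] respectively. *)
Lemma dunkl_comm i j p : dunkl i (dunkl j p) = dunkl j (dunkl i p).
Proof.
have [->//|ij] := eqVneq i j; elim/mpoly_ind_vars: p => [|c p q IHp IHq|k p IH].
- by rewrite !dunkl1 !linear0.
- by rewrite !linearP /= IHp IHq.
have [->|ki] := eqVneq k i; first exact: dunkl_comm_mulX.
have [->|kj] := eqVneq k j; first by apply/esym/dunkl_comm_mulX; rewrite 1?eq_sym.
have ik : i != k by rewrite eq_sym.
have jk : j != k by rewrite eq_sym.
have ji : j != i by rewrite eq_sym.
rewrite (dunkl_mulX p ik) (dunkl_mulX p jk) !dunklB !dunklZ (dunkl_mulX (dunkl j p) ik).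
rewrite (dunkl_mulX (dunkl i p) jk) (dunkl_tr p ij ik).
rewrite (dunkl_tr p ji jk).
rewrite IH.
by rewrite -!mul_mpolyC; ring.
Qed.

End Dunkl.

(** * Cherednik operators: Hecke relations, commutation, raising and lowering *)

HB.lock Definition cher (n : nat) (F : fieldType) (r : F) (i : 'I_n.+1)
    (p : {mpoly F[n.+1]}) :=
  'X_i * dunkl r i p + r *: \sum_(k < n.+1 | (i < k)%N) msym (tperm i k) p.

Section Cherednik.
Variables (n : nat) (F : fieldType) (r : F).
Implicit Types (i j k : 'I_n.+1) (p q : {mpoly F[n.+1]}).

Local Notation tr i j := (msym (tperm i j)).
Local Notation dunkl := (dunkl r).

Lemma msym_tr (s : 'S_n.+1) i j p : msym s (tr i j p) = tr (s i) (s j) (msym s p).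
Proof. by rewrite -!msymMm -tpermJ mulgA mulgV mul1g. Qed.

Lemma trK i j p : tr i j (tr i j p) = p.
Proof. by rewrite -msymMm tperm2 msym1m. Qed.

Lemma cherE i p : cher r i p = 'X_i * dunkl i p + r *: \sum_(k < n.+1 | (i < k)%N) tr i k p.
Proof. by rewrite unlock. Qed.

Local Notation cher := (cher r).

Lemma cher_is_linear i : linear (cher i).
Proof.
move=> c p q; rewrite !cherE linearP /= mulrDr -scalerAr scalerDr addrACA.
congr (_ + _); rewrite scalerA mulrC -scalerA -scalerDr; congr (_ *: _).
by rewrite scaler_sumr -big_split; apply: eq_bigr => j _; rewrite linearP.
Qed.

HB.instance Definition _ i :=
  GRing.isLinear.Build F {mpoly F[n.+1]} {mpoly F[n.+1]} _ (cher i) (cher_is_linear i).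

Lemma cherD i : {morph cher i : p q / p + q}.
Proof. exact: linearD. Qed.

Lemma cherB i : {morph cher i : p q / p - q}.
Proof. exact: linearB. Qed.

Lemma cherZ i c p : cher i (c *: p) = c *: cher i p.
Proof. exact: linearZ. Qed.

Lemma cher_sum i (I : Type) (s : seq I) (P : pred I) (f : I -> {mpoly F[n.+1]}) :
  cher i (\sum_(a <- s | P a) f a) = \sum_(a <- s | P a) cher i (f a).
Proof. exact: raddf_sum. Qed.

Lemma msym_cher (s : 'S_n.+1) i p :
  msym s (cher i p) = 'X_(s i) * dunkl (s i) (msym s p)
    + r *: \sum_(k < n.+1 | (i < (s^-1)%g k)%N) tr (s i) k (msym s p).
Proof.
rewrite !cherE linearD linearZ /= rmorphM /= msymXU msym_dunkl; congr (_ + _ *: _).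
rewrite raddf_sum [RHS](reindex_perm s) /=.
by apply: eq_big => [k|k _]; rewrite ?permK // msym_tr.
Qed.

(** The relation of the degenerate affine Hecke algebra: conjugation by [s_i] turns [Y_i] into
    [Y_(i+1)], except that the transposition [k = j] of [Y_i] is left over, and it cancels [s_i]. *)
Lemma cher_trl i j p : j = i.+1 :> nat ->
  tr i j (cher i p) = cher j (tr i j p) + r *: p.
Proof.
move=> ij; rewrite msym_cher tpermL tpermV !cherE -addrA -scalerDr.
congr (_ + _ *: _); rewrite (bigD1 i) /=; last by rewrite tpermL ij.
rewrite addrC; congr (_ + _); last first.
  by rewrite tpermC trK.
apply: eq_bigl => k; case: tpermP => [->|->|/eqP ki /eqP kj].
- by rewrite eqxx andbF ij; lia.
- by rewrite ij; lia.
by move: ki kj; rewrite -!(inj_eq val_inj) /= ij; lia.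
Qed.

Lemma cher_trr i j p : j = i.+1 :> nat ->
  tr i j (cher j p) = cher i (tr i j p) - r *: p.
Proof.
move=> ij; have := cher_trl (tr i j p) ij; rewrite trK.
by move/(congr1 (tr i j)); rewrite trK linearD linearZ /= trK => ->; rewrite addrK.
Qed.

Lemma cher_tr i j k p : j = i.+1 :> nat -> k != i -> k != j ->
  tr i j (cher k p) = cher k (tr i j p).
Proof.
move=> ij ki kj; rewrite msym_cher tpermD 1?eq_sym // tpermV !cherE.
congr (_ + _ *: _); apply: eq_bigl => l.
move: ki kj; rewrite -!(inj_eq val_inj) /= ij.
by case: tpermP => [->|->|]; rewrite ?ij; lia.
Qed.

(** What remains of [Y_i] after it is moved past [d_max] or [x_max]. The cyclic permutation
    conjugates it to the Cherednik operator of the next index. *)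
Definition cher_init i p : {mpoly F[n.+1]} :=
  'X_i * dunkl i p + r *: \sum_(k < n.+1 | (i < k < n)%N) tr i k p.

Lemma cher_initE i p : i != ord_max -> cher i p = cher_init i p + r *: tr i ord_max p.
Proof.
rewrite -(inj_eq val_inj) /= => im; rewrite cherE /cher_init -addrA -scalerDr.
congr (_ + _ *: _); rewrite (bigD1 ord_max) /=; last by have := ltn_ord i; lia.
rewrite addrC; congr (_ + _); apply: eq_bigl => k.
by rewrite -(inj_eq val_inj) /=; have := ltn_ord k; lia.
Qed.

Lemma cher_max p : cher ord_max p = 'X_ord_max * dunkl ord_max p.
Proof.
rewrite !cherE big1 ?scaler0 ?addr0 // => k /=.
by rewrite ltnNge -ltnS ltn_ord.
Qed.

Lemma dunkl_max_cher i p : i != ord_max ->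
  dunkl ord_max (cher i p) = cher_init i (dunkl ord_max p).
Proof.
move=> im; rewrite cher_initE // /cher_init !dunklD !dunklZ dunkl_mulX; last by rewrite eq_sym.
rewrite -(dunkl_comm r i ord_max).
have -> : dunkl ord_max (\sum_(k < n.+1 | (i < k < n)%N) tr i k p)
    = \sum_(k < n.+1 | (i < k < n)%N) tr i k (dunkl ord_max p).
  rewrite dunkl_sum; apply: eq_bigr.
  move=> k /andP[_ kn]; rewrite dunkl_tr // 1?eq_sym //.
  by rewrite -(inj_eq val_inj) /= neq_ltn kn.
have := msym_dunkl r (tperm i ord_max) i p; rewrite tpermL => <-.
by rewrite tpermC -!mul_mpolyC; ring.
Qed.

Lemma cher_mulX_max i p : i != ord_max ->
  cher i ('X_ord_max * p) = 'X_ord_max * cher_init i p.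
Proof.
move=> im; rewrite cher_initE // /cher_init dunkl_mulX //.
rewrite (eq_bigr (fun k => 'X_ord_max * tr i k p)); last first.
  move=> k /andP[_ kn]; rewrite rmorphM /= msymXU tpermD //.
  by rewrite -(inj_eq val_inj) /= neq_ltn kn.
rewrite -mulr_sumr rmorphM /= msymXU tpermR.
by rewrite -!mul_mpolyC; ring.
Qed.

Lemma cher_max_comm i p :
  cher ord_max (cher i p) = cher i (cher ord_max p).
Proof.
have [->//|im] := eqVneq i ord_max.
by rewrite [LHS]cher_max dunkl_max_cher // cher_max cher_mulX_max.
Qed.

(** Descending induction on [i]. The last operator is [x_max d_max], where commutation comes from
    the Dunkl operators; below it, [Y_i = s_i Y_(i+1) s_i + r s_i], and [s_i] commutes with every
    [Y_j] of index other than [i] and [i + 1]. *)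
Lemma cher_comm i j p : cher i (cher j p) = cher j (cher i p).
Proof.
have [d] := ubnP (n - i); elim: d i j p => // d IH i j p id.
have [->|im] := eqVneq i ord_max; first exact: cher_max_comm.
have hi : (i.+1 < n.+1)%N.
  by move: im; rewrite -(inj_eq val_inj) /=; have := ltn_ord i; lia.
pose i' := Ordinal hi; have ii' : i' = i.+1 :> nat by [].
have {}IH k q : cher i' (cher k q) = cher k (cher i' q).
  by apply: IH; move: id; rewrite /= !ltnS; lia.
have [->//|ji] := eqVneq j i.
have [->|ji'] := eqVneq j i'; first by rewrite IH.
have E q : cher i q = tr i i' (cher i' (tr i i' q)) + r *: tr i i' q.
  by rewrite cher_trr // trK subrK.
by rewrite !E !(cher_tr _ ii' ji ji') IH (cher_tr _ ii' ji ji') -cherZ -cherD.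
Qed.

Definition cyc : 'S_n.+1 := perm (@ordS_inj n.+1).

Lemma cyc_max : cyc ord_max = ord0.
Proof. by apply/val_inj; rewrite permE /= modnn. Qed.

Lemma cycE i : i != ord_max -> cyc i = i.+1 :> nat.
Proof.
rewrite -(inj_eq val_inj) /= => im; rewrite permE /= modn_small //.
by have := ltn_ord i; lia.
Qed.

Lemma msym_cyc_init i p : i != ord_max ->
  msym cyc (cher_init i p) = cher (cyc i) (msym cyc p).
Proof.
move=> im; rewrite /cher_init !cherE linearD linearZ /= rmorphM /= msymXU msym_dunkl.
congr (_ + _ *: _); rewrite raddf_sum [RHS](reindex_perm cyc) /=.
apply: eq_big => [k|k _]; last by rewrite msym_tr.
have [->|km] := eqVneq k ord_max; first by rewrite cyc_max cycE //= ltnn andbF.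
by rewrite !cycE //; move: km; rewrite -(inj_eq val_inj) /=; have := ltn_ord k; lia.
Qed.

Lemma cher0_cyc p : cher ord0 (msym cyc p) =
  msym cyc ('X_ord_max * dunkl ord_max p + r *: \sum_(k | k != ord_max) tr ord_max k p).
Proof.
rewrite !cherE linearD linearZ /= rmorphM /= msymXU msym_dunkl cyc_max.
congr (_ + _ *: _); rewrite raddf_sum [LHS](reindex_perm cyc) /=.
apply: eq_big => [k|k _]; last by rewrite msym_tr cyc_max.
by rewrite -(inj_eq (@perm_inj _ cyc) k) cyc_max -(inj_eq val_inj) lt0n.
Qed.

Lemma cycK p : msym cyc (msym cyc^-1%g p) = p.
Proof. by rewrite -msymMm mulVg msym1m. Qed.

(** On a common eigenvector with eigenvalues [(y_0, ..., y_n)], [lower] gives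
    [(y_n - 1, y_0, ..., y_(n-1))] and [raise] gives [(y_1, ..., y_n, y_0 + 1)]. The latter is the
    affine raising operator of Knop and Sahi. *)
Definition lower p := msym cyc (dunkl ord_max p).
Definition raise p := 'X_ord_max * msym cyc^-1%g p.

Lemma cher_lower i p : i != ord_max -> cher (cyc i) (lower p) = lower (cher i p).
Proof. by move=> im; rewrite /lower dunkl_max_cher // msym_cyc_init. Qed.

Lemma cher_lower0 p : cher ord0 (lower p) = lower (cher ord_max p) - lower p.
Proof.
rewrite /lower cher0_cyc -linearB /=; congr (msym _ _).
by rewrite cher_max dunkl_mulX_id addrAC addrK.
Qed.

Lemma cher_raise i p : i != ord_max -> cher i (raise p) = raise (cher (cyc i) p).
Proof.
move=> im; rewrite /raise cher_mulX_max //; congr (_ * _).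
apply: (@inj_msym _ _ cyc); rewrite msym_cyc_init // !cycK.
by [].
Qed.

Lemma cher_raise_max p : cher ord_max (raise p) = raise (cher ord0 p) + raise p.
Proof.
rewrite /raise cher_max dunkl_mulX_id -mulrDr; congr (_ * _).
apply: (@inj_msym _ _ cyc); rewrite addrAC linearD /= -cher0_cyc.
by rewrite linearD /= !cycK.
Qed.

End Cherednik.

(** Compares the coefficients of degree [n] in Lagrange's interpolation formula. Applied to a
    product of [n] factors [v - Y_j] acting on [f], which is monic in [v], it recovers [f]. *)
Lemma lagrange_lead_coef (n : nat) (F : fieldType) (y : 'I_n.+1 -> F) (q : {poly F}) :
  injective y -> (size q <= n.+1)%N ->
  \sum_i q.[y i] / \prod_(j | j != i) (y i - y j) = q`_n.
Proof.
move=> inj sq.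
have nz i : \prod_(j | j != i) (y i - y j) != 0.
  by apply/prodf_neq0 => j ji; rewrite subr_eq0 (inj_eq inj) eq_sym.
pose N i := \prod_(j | j != i) ('X - (y j)%:P).
have sN i : size (N i) = n.+1.
  rewrite /N -big_filter size_prod_XsubC -sum1_size big_filter sum1_card.
  by rewrite cardC1 card_ord.
have NE i k : (N i).[y k] = \prod_(j | j != i) (y k - y j).
  by rewrite horner_prod; apply: eq_bigr => j _; rewrite hornerXsubC.
have N0 i k : i != k -> (N i).[y k] = 0.
  by move=> ik; rewrite NE (bigD1 k) 1?eq_sym //= subrr mul0r.
have E : q = \sum_i (q.[y i] / \prod_(j | j != i) (y i - y j)) *: N i.
  apply/eqP; rewrite -subr_eq0; apply/eqP.
  set d := _ - _.
  apply: (@roots_geq_poly_eq0 _ _ [seq y i | i <- enum 'I_n.+1]).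
  - apply/allP => _ /mapP[k _ ->]; rewrite /root /d hornerD hornerN horner_sum.
    rewrite [X in _ - X](bigD1 k) // [X in _ - (_ + X)]big1 => [|i ik].
      by rewrite addr0 hornerZ NE divfK ?subrr.
    by rewrite hornerZ N0 ?mulr0.
  - by rewrite map_inj_uniq ?enum_uniq.
  rewrite size_map size_enum_ord (leq_trans (size_polyD _ _)) // geq_max sq.
  rewrite size_polyN (leq_trans (size_sum _ _ _)) //; apply/bigmax_leqP => i _.
  by rewrite (leq_trans (size_scale_leq _ _)) ?sN.
rewrite [in RHS]E coef_sum; apply: eq_bigr => k _; rewrite coefZ.
have /monicP : N k \is monic by apply: monic_prod_XsubC.
by rewrite lead_coefE sN /= => ->; rewrite mulr1.
Qed.

(** * Products of factors [g j - Y_j] *)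

Section CherednikProducts.
Variables (n : nat) (F : fieldType) (r : F).
Implicit Types (i j k a : 'I_n.+1) (p q : {mpoly F[n.+1]}) (P : pred 'I_n.+1).
Implicit Types (g : 'I_n.+1 -> F) (u : F) (s : seq 'I_n.+1).

Local Notation cher := (cher r).

Definition cfactor g j q := g j *: q - cher j q.

(** The order imposed by the enumeration is immaterial because the [Y_j] commute; [cprodD1] brings
    any chosen factor to the front. *)
Definition cprod P g p := foldr (cfactor g) p [seq j <- enum 'I_n.+1 | P j].

Lemma cfactorC g j k q : cfactor g k (cfactor g j q) = cfactor g j (cfactor g k q).
Proof.
by rewrite /cfactor !cherB !cherZ (cher_comm r k) -!mul_mpolyC; ring.
Qed.

Lemma cprodD1 P a g p : P a -> cprod P g p = cfactor g a (cprod (predD1 P a) g p).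
Proof.
move=> Pa; rewrite /cprod; set s := filter _ _.
have us : uniq s by rewrite filter_uniq ?enum_uniq.
have as_ : a \in s by rewrite mem_filter Pa mem_enum.
have -> : [seq j <- enum 'I_n.+1 | predD1 P a j] = rem a s.
  rewrite rem_filter // /s -[RHS]filter_predI; exact: eq_filter.
elim: s as_ us => // j s IH; rewrite inE /= => as_ /andP[js us].
have [->|ja] := eqVneq j a => //=; rewrite cfactorC -IH //.
by move: as_; rewrite eq_sym (negPf ja).
Qed.

Lemma eq_cprod P P' g g' p : P =1 P' -> {in P, g =1 g'} -> cprod P g p = cprod P' g' p.
Proof.
move=> eP eg; rewrite /cprod -(eq_filter eP).
have : all P [seq j <- enum 'I_n.+1 | P j] by rewrite filter_all.
by elim: (filter _ _) => //= j s IH /andP[Pj Ps]; rewrite IH // /cfactor eg.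
Qed.

Lemma cprod_pred0 P g p : P =1 pred0 -> cprod P g p = p.
Proof. by move=> P0; rewrite /cprod (eq_filter P0) filter_pred0. Qed.

(** Meant for [lower] and [raise], which intertwine all the [Y_j] but one, up to a cyclic
    renumbering [t]. *)
Lemma cprod_intertwine (f : {linear {mpoly F[n.+1]} -> {mpoly F[n.+1]}})
    (t : 'S_n.+1) P g g' p :
  (forall j q, P j -> f (cher j q) = cher (t j) (f q)) ->
  (forall j, P j -> g' (t j) = g j) ->
  f (cprod P g p) = cprod (fun j => P (t^-1 j)%g) g' (f p).
Proof.
move=> fP gP; have [d] := ubnP #|P|; elim: d P fP gP => // d IH P fP gP cP.
have [a Pa|P0] := pickP P; last first.
  by rewrite !cprod_pred0 // => j /=; apply: P0.
rewrite (cprodD1 g p Pa) [RHS](@cprodD1 _ (t a)) ?permK // /cfactor linearB linearZ /=.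
rewrite fP // gP // IH.
- rewrite (@eq_cprod _ (predD1 (fun j => P (t^-1 j)%g) (t a)) _ g') // => j /=.
  by rewrite -(inj_eq (@perm_inj _ t)) permKV.
- by move=> j q /andP[_ Pj]; apply: fP.
- by move=> j /andP[_ Pj]; apply: gP.
by move: cP; rewrite (cardD1x Pa) add1n ltnS
  -(eq_card (A := predD1 P a)) // => j; rewrite !inE andbC.
Qed.

Lemma cprod_comm (f : {linear {mpoly F[n.+1]} -> {mpoly F[n.+1]}}) P g p :
  (forall j q, P j -> f (cher j q) = cher j (f q)) ->
  f (cprod P g p) = cprod P g (f p).
Proof.
move=> fP; rewrite (@cprod_intertwine f 1%g _ _ g); last by move=> j _; rewrite perm1.
  by apply: eq_cprod => // j; rewrite invg1 perm1.
by move=> j q /fP ->; rewrite perm1.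
Qed.

Lemma cprod_cher P g k p : cher k (cprod P g p) = cprod P g (cher k p).
Proof. by apply: (cprod_comm (f := cher k)) => j q _; apply: cher_comm. Qed.

Lemma cprod_is_linear P g : linear (cprod P g).
Proof.
move=> c p q; rewrite /cprod; elim: (filter _ _) => //= j s IH.
by rewrite IH /cfactor cherD cherZ -!mul_mpolyC; ring.
Qed.

HB.instance Definition _ P g :=
  GRing.isLinear.Build F {mpoly F[n.+1]} {mpoly F[n.+1]} _ (cprod P g)
    (cprod_is_linear P g).

Lemma cprodZ P g c p : cprod P g (c *: p) = c *: cprod P g p.
Proof. exact: linearZ. Qed.

(** Makes the parameter [u] a polynomial variable, so that interpolation and cancellation in [u]
    become available; the top coefficient is [p] itself. *)
Lemma cprod_poly P p : exists c : nat -> {mpoly F[n.+1]},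
  c #|P| = p /\
  forall u, cprod P (fun=> u) p = \sum_(k < #|P|.+1) u ^+ k *: c k.
Proof.
have -> : #|P| = size [seq j <- enum 'I_n.+1 | P j].
  by rewrite size_filter -sum1_count big_enum_cond -sum1_card.
rewrite /cprod; elim: (filter _ _) => [|j s [c [cs cE]]] /=.
  by exists (fun=> p); split=> // u; rewrite big_ord1 expr0 scale1r.
(* The coefficient of [u^k] in [(u - Y_j) (sum_k u^k c_k)]; the conditionals cut off [c (k - 1)] at
   [k = 0] and [c k] above the old degree. *)
exists (fun k : nat => (if k is k'.+1 then c k' else 0) -
                 (if (k <= size s)%N then cher j (c k) else 0)).
split=> [|u]; first by rewrite ltnn subr0.
rewrite /cfactor cE; under [RHS]eq_bigr do rewrite scalerBr.
rewrite sumrB; congr (_ - _).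
  rewrite [RHS]big_ord_recl scaler0 add0r scaler_sumr.
  by apply: eq_bigr => k _; rewrite scalerA exprS.
rewrite [RHS]big_ord_recr /= ltnn scaler0 addr0 cher_sum.
by apply: eq_bigr => k _; rewrite cherZ -ltnS ltn_ord.
Qed.

End CherednikProducts.

(** The operators [Y_j] obey simple rules only with respect to adjacent transpositions. *)
Lemma adjacent_tperm_ind (n : nat) (P : 'S_n.+1 -> Prop) :
  P 1%g -> (forall s t, P s -> P t -> P (s * t)%g) ->
  (forall i j : 'I_n.+1, j = i.+1 :> nat -> P (tperm i j)) -> forall s, P s.
Proof.
move=> P1 PM Pa.
have Plt (d : nat) (i j : 'I_n.+1) : j = (i + d)%N :> nat -> P (tperm i j).
  elim: d j => [|d IH] j ij.
    by rewrite (_ : j = i) ?tperm1 //; apply/val_inj; rewrite /= ij addn0.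
  have hk : (i + d < n.+1)%N by have := ltn_ord j; lia.
  pose k := Ordinal hk; have kj : j = k.+1 :> nat by rewrite ij /= addnS.
  case: (posnP d) => [d0|dpos]; first by apply: Pa; rewrite ij d0 addn1.
  (* With [k = j - 1], conjugating [(i k)] by the adjacent transposition [(k j)] gives [(i j)], so
     the distance drops by one. *)
  have -> : tperm i j = (tperm k j * (tperm i k * tperm k j))%g.
    have ki : k != i by rewrite -(inj_eq val_inj) /=; lia.
    have ji : j != i by apply/eqP => e; move: ij; rewrite e; lia.
    rewrite -{1}[tperm k j]tpermV -[RHS]/(tperm i k ^ tperm k j)%g tpermJ tpermL.
    by rewrite tpermD.
  by apply: (PM); [exact: Pa | apply: (PM); [exact: IH | exact: Pa]].
move=> s; case: (prod_tpermP s) => ts -> _; elim: ts => [|[i j] ts IH].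
  by rewrite big_nil.
rewrite big_cons /=; apply: PM => //.
case: (leqP i j) => ij; first by apply: (Plt (j - i)%N); rewrite subnKC.
by rewrite tpermC; apply: (Plt (i - j)%N); rewrite subnKC // ltnW.
Qed.

(** * Symmetrisation and evaluation at [(1, ..., 1)] *)

Section Symmetrization.
Variables (n : nat) (F : fieldType).
Implicit Types (s t : 'S_n.+1) (p q : {mpoly F[n.+1]}).

Definition symz p : {mpoly F[n.+1]} := \sum_s msym s p.

Lemma symz_msym s p : symz (msym s p) = symz p.
Proof.
rewrite /symz [RHS](reindex_inj (mulgI s)) /=.
by apply: eq_bigr => t _; rewrite msymMm.
Qed.

Lemma symz_symmetric p : symz p \is symmetric.
Proof.
apply/issymP => s; rewrite /symz raddf_sum [RHS](reindex_inj (mulIg s)) /=.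
by apply: eq_bigr => t _; rewrite msymMm.
Qed.

Lemma symz_linear : linear symz.
Proof.
move=> c p q; rewrite /symz scaler_sumr -big_split /=.
by apply: eq_bigr => s _; rewrite linearP.
Qed.

HB.instance Definition _ :=
  GRing.isLinear.Build F {mpoly F[n.+1]} {mpoly F[n.+1]} _ symz symz_linear.

Lemma symz_id p : p \is symmetric -> symz p = (n.+1)`!%:R *: p.
Proof.
move=> /issymP sp; rewrite /symz (eq_bigr (fun=> p)) => [|s _]; last exact: sp.
by rewrite sumr_const -(card_Sn n.+1) scaler_nat.
Qed.

Definition ev1 p : F := p.@[fun=> 1].

Lemma ev1_linear : scalar ev1.
Proof. by move=> c p q; rewrite /ev1 mevalD mevalZ. Qed.

HB.instance Definition _ :=
  GRing.isLinear.Build F {mpoly F[n.+1]} F _ ev1 ev1_linear.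

Lemma ev1B : {morph ev1 : p q / p - q}.
Proof. exact: linearB. Qed.

Lemma ev1Z c p : ev1 (c *: p) = c * ev1 p.
Proof. exact: mevalZ. Qed.

Lemma ev1_mulX i p : ev1 ('X_i * p) = ev1 p.
Proof. by rewrite /ev1 mevalM mevalXU mul1r. Qed.

Lemma ev1_msym s p : ev1 (msym s p) = ev1 p.
Proof.
elim/mpolyind: p => [|c m p _ _ IH]; first by rewrite raddf0.
rewrite linearP /= !linearP /= IH msymX /ev1 !mevalX.
by congr (_ * _ + _); rewrite !big1 // => i _; rewrite expr1n.
Qed.

Lemma ev1_symz p : ev1 (symz p) = (n.+1)`!%:R * ev1 p.
Proof.
rewrite /symz raddf_sum (eq_bigr (fun=> ev1 p)) => [|s _]; last exact: ev1_msym.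
by rewrite sumr_const -(card_Sn n.+1) mulr_natl.
Qed.

End Symmetrization.

(** * Joint eigenvectors and the shift of their spectrum *)

Section JointEigenvectors.
Variables (n : nat) (F : fieldType) (r : F).
Hypothesis char0 : forall k : nat, k.+1%:R != 0 :> F.
Implicit Types (i j k : 'I_n.+1) (p q f w : {mpoly F[n.+1]}) (u v : F) (y : 'I_n.+1 -> F).
Implicit Types (Q : {poly F}).

Local Notation tr i j := (msym (tperm i j)).
Local Notation cher := (cher r).
Local Notation cprod := (cprod r).
Local Notation cfactor := (cfactor r).

(** Up to sign, its coefficients in [u] are the elementary symmetric functions of the Cherednik
    operators, which are central in the degenerate affine Hecke algebra. *)
Definition cdelta u p := cprod predT (fun=> u) p.

(** When the two constants agree, the two corrections [r] from the Hecke relations cancel. *)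
Lemma cfactor2_tr (g : 'I_n.+1 -> F) i j q : j = i.+1 :> nat -> g i = g j ->
  tr i j (cfactor g i (cfactor g j q)) = cfactor g i (cfactor g j (tr i j q)).
Proof.
move=> ij gij; rewrite /cfactor gij !cherB !cherZ !(msymB, msymZ).
rewrite !(cher_trl _ _ ij) !(cher_trr _ _ ij) !cherB !cherZ.
rewrite (cher_comm r i j).
by rewrite -!mul_mpolyC; ring.
Qed.

Lemma cdelta_msym u (s : 'S_n.+1) p : msym s (cdelta u p) = cdelta u (msym s p).
Proof.
elim/adjacent_tperm_ind: s p => [|s t IHs IHt|i j ij] p; first by rewrite !msym1m.
  by rewrite !msymMm IHs IHt.
have ji : j != i by apply/eqP => e; move: ij; rewrite e; lia.
rewrite /cdelta !(@cprodD1 _ _ _ predT i) // !(@cprodD1 _ _ _ (predD1 predT i) j) /= ?ji //.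
rewrite cfactor2_tr // (@cprod_comm _ _ _ (msym (tperm i j))) // => k q.
by case/and3P=> kj ki _; apply: cher_tr.
Qed.

Lemma cdelta_symz u p : symz (cdelta u p) = cdelta u (symz p).
Proof.
rewrite /symz /cdelta raddf_sum /=; apply: eq_bigr => s _; exact: cdelta_msym.
Qed.

(** Only the multiset of eigenvalues is recorded, as the roots of [Q], so that symmetric polynomials
    can qualify. The zero polynomial qualifies for every [Q]; nonvanishing has to be tracked
    separately. *)
Definition joint Q f := forall u, cdelta u f = Q.[u] *: f.

Lemma horner_inj (p q : {poly F}) : (forall u, p.[u] = q.[u]) -> p = q.
Proof.
have nat_inj : injective (fun k : nat => k%:R : F).
  have lt_neq (a b : nat) : (a < b)%N -> a%:R != b%:R :> F.
    move=> ab; rewrite eq_sym -subr_eq0 -natrB; last exact: ltnW.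
    by move: ab; rewrite -subn_gt0; case: (b - a)%N.
  move=> a b /eqP ab; case: (ltngtP a b) => // lt; last rewrite eq_sym in ab.
    by have := lt_neq _ _ lt; rewrite ab.
  by have := lt_neq _ _ lt; rewrite ab.
move=> pq; apply/eqP; rewrite -subr_eq0; apply/eqP.
apply: (@roots_geq_poly_eq0 _ _ [seq k%:R | k : nat <- iota 0 (size (p - q))]).
- by apply/allP => _ /mapP[k _ ->]; rewrite /root hornerD hornerN pq subrr.
- by rewrite map_inj_uniq ?iota_uniq.
by rewrite size_map size_iota.
Qed.

(** At [u = y] the hypothesis is void, but every coefficient of both sides is a polynomial in [u],
    so the factor [u - y] can be cancelled. *)
Lemma joint_cancel Q (y : F) f :
  (forall u, (u - y) *: cdelta u f = (u - y) *: (Q.[u] *: f)) -> joint Q f.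
Proof.
move=> H u; apply/mpolyP => m; rewrite mcoeffZ.
have [c [_ cE]] := cprod_poly r predT f.
pose q := \poly_(k < #|(predT : pred 'I_n.+1)|.+1) (c k)@_m.
have qE v : (cdelta v f)@_m = q.[v].
  rewrite /cdelta cE raddf_sum horner_poly; apply: eq_bigr => k _ /=.
  by rewrite mcoeffZ mulrC.
have : ('X - y%:P) * q = ('X - y%:P) * (Q * (f@_m)%:P).
  apply: horner_inj => v; rewrite !hornerM hornerXsubC hornerC -qE.
  by have /(congr1 (mcoeff m)) := H v; rewrite !mcoeffZ.
move/(mulfI (negbT (polyXsubC_eq0 y))) => qQ.
by rewrite qE qQ hornerM hornerC.
Qed.

Lemma joint_symz Q f : joint Q f -> joint Q (symz f).
Proof. by move=> jf u; rewrite -cdelta_symz jf linearZ. Qed.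

Lemma cdelta_linear u : linear (cdelta u).
Proof. exact: cprod_is_linear. Qed.

HB.instance Definition _ u :=
  GRing.isLinear.Build F {mpoly F[n.+1]} {mpoly F[n.+1]} _ (cdelta u) (cdelta_linear u).

Lemma jointD Q c f w : joint Q f -> joint Q w -> joint Q (c *: f + w).
Proof.
by move=> jf jw u; rewrite linearP /= jf jw scalerDr !scalerA mulrC.
Qed.

Lemma jointZ Q c f : joint Q f -> joint Q (c *: f).
Proof. by move=> jf u; rewrite linearZ /= jf !scalerA mulrC. Qed.

Lemma cdelta_factor u j p :
  cdelta u p = u *: cprod (predC1 j) (fun=> u) p - cher j (cprod (predC1 j) (fun=> u) p).
Proof.
rewrite /cdelta (@cprodD1 _ _ _ _ j) // /cfactor.
by rewrite (@eq_cprod _ _ _ _ (predC1 j) _ (fun=> u)) // => k; rewrite /= andbT.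
Qed.

Lemma cdelta_eigen u j (y : F) w : cher j w = y *: w ->
  cdelta u w = (u - y) *: cprod (predC1 j) (fun=> u) w.
Proof. by move=> ew; rewrite (cdelta_factor u j) cprod_cher ew cprodZ scalerBl. Qed.

Lemma lower_linear : linear (@lower n F r).
Proof.
by move=> c p q; rewrite /lower linearP /= linearP.
Qed.

HB.instance Definition _ :=
  GRing.isLinear.Build F {mpoly F[n.+1]} {mpoly F[n.+1]} _ (@lower n F r) lower_linear.

Lemma raise_linear : linear (@raise n F).
Proof. by move=> c p q; rewrite /raise linearP /= mulrDr -scalerAr. Qed.

HB.instance Definition _ :=
  GRing.isLinear.Build F {mpoly F[n.+1]} {mpoly F[n.+1]} _ (@raise n F) raise_linear.

(** [lower] carries the product over all indices but the last to the product over all indices but 0,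
    and [Y_0] acts on [lower w] by [y - 1]. The old factor [u - y] is exchanged for [u - (y - 1)],
    at the price of an identity known only after multiplication by [u - y]. *)
Lemma joint_lower Q (y : F) w : joint (('X - y%:P) * Q) w -> cher ord_max w = y *: w ->
  joint (('X - (y - 1)%:P) * Q) (lower r w).
Proof.
move=> jw ew; apply: (@joint_cancel _ y) => u.
have E : cprod (predC1 ord0) (fun=> u) (lower r w)
       = lower r (cprod (predC1 ord_max) (fun=> u) w).
  rewrite [RHS](cprod_intertwine (r := r) (t := cyc n) (g' := fun=> u)) //.
    apply: eq_cprod => // j /=.
    by rewrite -[in RHS](inj_eq (@perm_inj _ (cyc n))) permKV cyc_max.
  by move=> j q jm; rewrite /= cher_lower.
rewrite (cdelta_factor u ord0) E cher_lower0 cprod_cher ew cprodZ linearZ /=.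
have := jw u; rewrite (cdelta_eigen _ ew) hornerM hornerXsubC -scalerA => e.
have {}e := congr1 (lower r) e; rewrite !linearZ /= in e.
rewrite hornerM hornerXsubC.
transitivity ((u - (y - 1)) *: ((u - y) *: lower r (cprod (predC1 ord_max) (fun=> u) w))).
  by rewrite -!mul_mpolyC; ring.
by rewrite e -!mul_mpolyC; ring.
Qed.

Lemma joint_raise Q (y : F) w : joint (('X - y%:P) * Q) w -> cher ord0 w = y *: w ->
  joint (('X - (y + 1)%:P) * Q) (raise w).
Proof.
move=> jw ew; apply: (@joint_cancel _ y) => u.
have E : cprod (predC1 ord_max) (fun=> u) (raise w)
       = raise (cprod (predC1 ord0) (fun=> u) w).
  have raiseK (q : {mpoly F[n.+1]}) j : j != ord0 ->
      raise (cher j q) = cher ((cyc n)^-1%g j) (raise q).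
    move=> j0; rewrite cher_raise ?permKV //.
    by rewrite -[in X in ~~ X](inj_eq (@perm_inj _ (cyc n))) permKV cyc_max.
  rewrite [RHS](cprod_intertwine (r := r) (t := (cyc n)^-1%g) (g' := fun=> u)) //.
    apply: eq_cprod => // j /=.
    by rewrite invgK -[in LHS](inj_eq (@perm_inj _ (cyc n))) cyc_max.
  by move=> j q j0; rewrite /= raiseK.
rewrite (cdelta_factor u ord_max) E cher_raise_max cprod_cher ew cprodZ linearZ /=.
have := jw u; rewrite (cdelta_eigen _ ew) hornerM hornerXsubC -scalerA => e.
have {}e := congr1 (@raise _ _) e; rewrite !linearZ /= in e.
rewrite hornerM hornerXsubC.
transitivity ((u - (y + 1)) *: ((u - y) *: raise (cprod (predC1 ord0) (fun=> u) w))).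
  by rewrite -!mul_mpolyC; ring.
by rewrite e -!mul_mpolyC; ring.
Qed.

End JointEigenvectors.

(** * The action of the sum of the partial derivatives *)

Section Evaluation.
Variables (n : nat) (F : fieldType) (r : F).
Hypothesis char0 : forall k : nat, k.+1%:R != 0 :> F.
Hypothesis r_neq0 : r != 0.
Implicit Types (i j k : 'I_n.+1) (p q f w : {mpoly F[n.+1]}) (u v : F) (y : 'I_n.+1 -> F).
Implicit Types (Q : {poly F}).

Local Notation tr i j := (msym (tperm i j)).
Local Notation cher := (cher r).
Local Notation cprod := (cprod r).
Local Notation cfactor := (cfactor r).
Local Notation cdelta := (cdelta r).
Local Notation joint := (joint r).

(** The term of index [k] in the telescoping of [cdelta (u + r) - cdelta u], without its factor
    [r]. *)
Definition cmixed u k p := cprod (predC1 k) (fun j => if (j < k)%N then u + r else u) p.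

(** Let [R] be the product without the factors [i] and [j = i + 1]; it is fixed by [s_i]. The two
    sides are the values of [(u - Y_j) R] and [(u + r - Y_i) R], and [s_i] maps the second
    polynomial to the first: the Hecke relation absorbs exactly the shift [r]. *)
Lemma ev1_cmixed_adj u i j f : f \is symmetric -> j = i.+1 :> nat ->
  ev1 (cmixed u i f) = ev1 (cmixed u j f).
Proof.
move=> /issymP sf ij.
have ji : j != i by apply/eqP => e; move: ij; rewrite e; lia.
pose R := cprod (predD1 (predC1 i) j) (fun k => if (k < i)%N then u + r else u) f.
have -> : cmixed u i f = u *: R - cher j R.
  by rewrite /cmixed (@cprodD1 _ _ _ _ j) //= /cfactor ij ltnNge leqnSn.
have -> : cmixed u j f = (u + r) *: R - cher i R.
  rewrite /cmixed (@cprodD1 _ _ _ _ i) /=; last by rewrite eq_sym.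
  rewrite /cfactor ij leqnn.
  suff -> : cprod (predD1 (predC1 j) i) (fun k => if (k < i.+1)%N then u + r else u) f = R by [].
  apply: eq_cprod => [k|k /andP[/= ki kj]] /=; first by rewrite andbC.
  by rewrite ltnS leq_eqVlt (inj_eq val_inj) (negPf ki).
rewrite -[RHS](ev1_msym (tperm i j)) msymB msymZ (cher_trl _ _ ij).
suff -> : tr i j R = R.
  by congr ev1; rewrite -!mul_mpolyC; ring.
rewrite /R (cprod_comm (r := r)) /= ?sf // => k q /andP[/= kj ki].
by rewrite (cher_tr r _ ij).
Qed.

Lemma ev1_cmixed u j k f : f \is symmetric -> ev1 (cmixed u j f) = ev1 (cmixed u k f).
Proof.
move=> sf; suff E i : ev1 (cmixed u i f) = ev1 (cmixed u ord0 f) by rewrite !E.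
have [m] := ubnP (i : nat); elim: m i => // m IH i im.
case: (posnP i) => [i0|ipos]; first by congr (ev1 (cmixed _ _ _)); apply/val_inj.
have hi : (i.-1 < n.+1)%N by have := ltn_ord i; lia.
rewrite -(IH (Ordinal hi)) /=; last by lia.
by apply/esym/ev1_cmixed_adj => //=; lia.
Qed.

Lemma cdelta_shift u f : cdelta (u + r) f - cdelta u f = r *: \sum_k cmixed u k f.
Proof.
(* [T m] has its first [m] factors shifted; passing from [T k] to [T k.+1] changes only factor [k],
   by the scalar [r]. *)
pose T (m : nat) := cprod predT (fun j => if (j < m)%N then u + r else u) f.
have -> : cdelta (u + r) f = T n.+1.
  by apply: eq_cprod => // j _; rewrite ltn_ord.
have -> : cdelta u f = T 0%N by apply: eq_cprod.
rewrite -telescope_sumr // big_mkord scaler_sumr; apply: eq_bigr => k _.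
have R m : (cprod (predD1 predT k) (fun j => if (j < k + m)%N then u + r else u) f
   = cprod (predC1 k) (fun j => if (j < k + m)%N then u + r else u) f).
  by apply: eq_cprod => // j; rewrite /= andbT.
rewrite /T !(@cprodD1 _ _ _ predT k) // /cfactor ltnn ltnS leqnn.
have -> : cprod (predD1 predT k) (fun j => if (j < k.+1)%N then u + r else u) f = cmixed u k f.
  apply: eq_cprod => j //=; rewrite ?andbT // => /andP[jk _].
  by rewrite ltnS leq_eqVlt (inj_eq val_inj) (negPf jk).
have -> : cprod (predD1 predT k) (fun j => if (j < k)%N then u + r else u) f = cmixed u k f.
  by apply: eq_cprod => j //=; rewrite andbT.
by rewrite -!mul_mpolyC; ring.
Qed.

Lemma ev1_cmixed_joint Q u k f : f \is symmetric -> joint Q f ->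
  r * n.+1%:R * ev1 (cmixed u k f) = (Q.[u + r] - Q.[u]) * ev1 f.
Proof.
move=> sf jf; rewrite mulrBl -![in RHS]ev1Z -!jf -ev1B cdelta_shift.
rewrite -mulrA [RHS]ev1Z; congr (_ * _).
rewrite raddf_sum (eq_bigr (fun=> ev1 (cmixed u k f))) => [|j _].
  by rewrite sumr_const card_ord mulr_natl.
exact: ev1_cmixed.
Qed.

Definition charpoly y : {poly F} := \prod_j ('X - (y j)%:P).

Lemma horner_charpoly y u : (charpoly y).[u] = \prod_j (u - y j).
Proof. by rewrite horner_prod; apply: eq_bigr => j _; rewrite hornerXsubC. Qed.

Lemma horner_charpoly_root y i : (charpoly y).[y i] = 0.
Proof. by rewrite horner_charpoly (bigD1 i) //= subrr mul0r. Qed.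

Lemma horner_charpoly_shift y i c :
  (charpoly y).[y i + c] = c * \prod_(j | j != i) (y i - y j + c).
Proof.
rewrite horner_charpoly (bigD1 i) //= addrAC subrr add0r; congr (_ * _).
by apply: eq_bigr => j _; rewrite addrAC.
Qed.

Lemma charpolyD1 y i c : charpoly (fun j => y j + c *+ (j == i))
  = ('X - (y i + c)%:P) * \prod_(j | j != i) ('X - (y j)%:P).
Proof.
rewrite /charpoly (bigD1 i) //= eqxx mulr1n; congr (_ * _).
by apply: eq_bigr => j ji; rewrite (negPf ji) mulr0n addr0.
Qed.

(* The projection of [f] onto the eigenvalue [v] of [cher k], up to a factor. *)
Definition cproj k v f := cprod (predC1 k) (fun=> v) f.

(** As in Cayley-Hamilton: at [u = y i] the full product kills [f], and its remaining factor is
    [y i - Y_k]. *)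
Lemma cher_cproj y k i f : joint (charpoly y) f ->
  cher k (cproj k (y i) f) = y i *: cproj k (y i) f.
Proof.
move=> /(_ (y i)); rewrite horner_charpoly_root scale0r (cdelta_factor _ _ k).
by move/eqP; rewrite subr_eq0 eq_sym => /eqP.
Qed.

Lemma joint_cproj Q k v f : joint Q f -> joint Q (cproj k v f).
Proof.
move=> jf u; rewrite /cproj -cprodZ -jf /cdelta.
by rewrite (cprod_comm (r := r) (f := cdelta u)) // => j q _ /=; rewrite /cdelta cprod_cher.
Qed.

(** Every other index lies below [ord_max], so all factors of [cmixed (y i - r) ord_max] have the
    parameter [y i]; and [charpoly y] vanishes at [y i], one of the two points of the difference. *)
Lemma ev1_cproj_max y i f : f \is symmetric -> joint (charpoly y) f ->
  n.+1%:R * ev1 (cproj ord_max (y i) f) = \prod_(j | j != i) (y i - y j - r) * ev1 f.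
Proof.
move=> sf jf; apply: (mulfI r_neq0).
have := ev1_cmixed_joint (y i - r) ord_max sf jf.
rewrite subrK horner_charpoly_root horner_charpoly_shift sub0r !mulNr opprK -!mulrA.
move=> <-; congr (_ * (_ * ev1 _)); apply: eq_cprod => // j jm /=.
rewrite subrK ifT //; move: jm; rewrite inE -(inj_eq val_inj) /=.
by have := ltn_ord j; lia.
Qed.

(** Here no index lies below [ord0], so [cmixed (y i) ord0] has no shifted factor. *)
Lemma ev1_cproj0 y i f : f \is symmetric -> joint (charpoly y) f ->
  n.+1%:R * ev1 (cproj ord0 (y i) f) = \prod_(j | j != i) (y i - y j + r) * ev1 f.
Proof.
move=> sf jf; apply: (mulfI r_neq0).
have := ev1_cmixed_joint (y i) ord0 sf jf.
rewrite horner_charpoly_root horner_charpoly_shift subr0 -!mulrA.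
by move=> <-; congr (_ * (_ * ev1 _)); apply: eq_cprod.
Qed.

Lemma joint_shift y i c f k (T : {mpoly F[n.+1]} -> {mpoly F[n.+1]}) :
  (forall Q, joint (('X - (y i)%:P) * Q) (cproj k (y i) f) ->
      cher k (cproj k (y i) f) = y i *: cproj k (y i) f ->
      joint (('X - (y i + c)%:P) * Q) (T (cproj k (y i) f))) ->
  joint (charpoly y) f ->
  joint (charpoly (fun j => y j + c *+ (j == i))) (T (cproj k (y i) f)).
Proof.
move=> H jf; rewrite charpolyD1; apply: H; last exact: cher_cproj.
have := joint_cproj k (y i) jf; by rewrite /charpoly (bigD1 i).
Qed.

(** Project to the eigenvalue [y i] of [Y_0], raise, symmetrise. The value at [(1, ..., 1)] is
    recorded because it is what later shows that the result is nonzero. *)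
Lemma exists_raised y i f : f \is symmetric -> joint (charpoly y) f ->
  exists g : {mpoly F[n.+1]}, [/\ g \is symmetric, joint (charpoly (fun j => y j + 1 *+ (j == i))) g
    & n.+1%:R * ev1 g = (n.+1)`!%:R * (\prod_(j | j != i) (y i - y j + r) * ev1 f)].
Proof.
move=> sf jf; exists (symz (raise (cproj ord0 (y i) f))); split.
- exact: symz_symmetric.
- apply: joint_symz; apply: (joint_shift (T := @raise n F) (k := ord0)) => // Q.
  exact: joint_raise.
by rewrite ev1_symz /raise ev1_mulX ev1_msym mulrCA ev1_cproj0.
Qed.

(** Each coefficient of [cproj ord_max v f] is a polynomial in [v] of degree at most [n], whose
    coefficient of degree [n] is that of [f]. *)
Lemma cproj_lagrange y f : injective y ->
  f = \sum_i (\prod_(j | j != i) (y i - y j))^-1 *: cproj ord_max (y i) f.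
Proof.
move=> inj; apply/mpolyP => m.
have [c [cf cE]] := cprod_poly r (predC1 (ord_max : 'I_n.+1)) f.
have cn : #|predC1 (ord_max : 'I_n.+1)| = n by rewrite cardC1 card_ord.
rewrite cn in cf cE.
pose q := \poly_(k < n.+1) (c k)@_m.
have qE v : (cproj ord_max v f)@_m = q.[v].
  rewrite /cproj cE raddf_sum horner_poly; apply: eq_bigr => k _ /=.
  by rewrite mcoeffZ mulrC.
rewrite raddf_sum /=; under eq_bigr do rewrite mcoeffZ qE mulrC.
by rewrite lagrange_lead_coef ?size_poly // coef_poly ltnSn cf.
Qed.

Lemma symz_dunkl i f : f \is symmetric ->
  symz (dunkl r i f) = symz (dunkl r ord_max f).
Proof.
by move=> /issymP sf; rewrite -(symz_msym (tperm i ord_max)) msym_dunkl tpermL sf.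
Qed.

Lemma symz_lower w : symz (lower r w) = symz (dunkl r ord_max w).
Proof. by rewrite symz_msym. Qed.

Lemma sum_dunkl_symmetric f : f \is symmetric -> \sum_i dunkl r i f \is symmetric.
Proof.
move=> /issymP sf; apply/issymP => s; rewrite raddf_sum /= [RHS](reindex_perm s) /=.
by apply: eq_bigr => i _; rewrite msym_dunkl sf.
Qed.

Lemma fact_neq0 (k : nat) : k`!%:R != 0 :> F.
Proof. by have := fact_gt0 k; case: (k`!) => // d _. Qed.

Lemma sum_mderiv_joint y f : injective y -> f \is symmetric -> joint (charpoly y) f ->
  exists g : 'I_n.+1 -> {mpoly F[n.+1]},
    \sum_i f^`M(i) = \sum_i g i /\
    forall i, [/\ g i \is symmetric, joint (charpoly (fun j => y j + (-1) *+ (j == i))) (g i)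
      & ev1 (g i) = y i * \prod_(j | j != i) ((y i - y j - r) / (y i - y j)) * ev1 f].
Proof.
(* Symmetrising [sum_i d_i f] multiplies it by [(n + 1)!], and its [n + 1] terms have the same
   symmetrisation, whence this ratio. *)
move=> inj sf jf; pose N : F := n.+1%:R / (n.+1)`!%:R.
have N0 : (n.+1)`!%:R != 0 :> F := fact_neq0 _.
pose c i := N / \prod_(j | j != i) (y i - y j).
exists (fun i => c i *: symz (lower r (cproj ord_max (y i) f))); split.
  transitivity (\sum_i dunkl r i f).
    by apply: eq_bigr => i _; rewrite dunkl_sym.
  apply: (scalerI N0); rewrite -symz_id ?sum_dunkl_symmetric // raddf_sum /=.
  rewrite (eq_bigr (fun=> symz (dunkl r ord_max f))); last by move=> i _; rewrite symz_dunkl.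
  rewrite sumr_const card_ord {1}(cproj_lagrange f inj) dunkl_sum raddf_sum /=.
  rewrite -scaler_nat !scaler_sumr; apply: eq_bigr => i _.
  rewrite dunklZ linearZ /= symz_lower !scalerA /c /N; congr (_ *: _).
  by rewrite !mulrA [X in _ = X * _]mulrAC divff // mul1r.
move=> i; split.
- by rewrite rpredZ // symz_symmetric.
- apply: jointZ.
  apply: joint_symz; apply: (joint_shift (T := lower r) (k := ord_max)) => // Q.
  exact: joint_lower.
(* At [(1, ..., 1)], [d_max w] takes the same value as [x_max d_max w = Y_max w = y i w]: this is
   the origin of the isolated factor [y i]. *)
rewrite ev1Z ev1_symz /c /N ev1_msym -(ev1_mulX ord_max) -cher_max.
rewrite (cher_cproj _ _ jf) ev1Z big_split /= prodfV.
have n0 : n.+1%:R != 0 :> F := char0 n.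
have P0 : \prod_(j | j != i) (y i - y j) != 0.
  by apply/prodf_neq0 => j ji; rewrite subr_eq0 (inj_eq inj) eq_sym.
have := ev1_cproj_max i sf jf; rewrite mulrC => /(canRL (mulfK n0)) ->.
move: n0 N0; move: (n.+1%:R) ((n.+1)`!%:R) => a b n0 N0.
by field; rewrite P0 N0 n0.
Qed.

End Evaluation.

(** * Triangularity with respect to the dominance order *)

Section Dominance.
Variable n : nat.
Implicit Types (i j : 'I_n.+1) (m eta nu mu : 'X_{1..n.+1}) (c : nat).

(** On a partition, the number of boxes beyond column [c]. Being invariant under permutations, these
    numbers compare unsorted exponents as well. *)
Definition excess c m := (\sum_l (m l - c))%N.

(* On partitions this is the dominance order; on all compositions it is only a preorder,
   whose equivalence classes are the orbits of the symmetric group. *)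
Definition dom_le nu eta := mdeg nu = mdeg eta /\ forall c, (excess c nu <= excess c eta)%N.

Lemma dom_refl m : dom_le m m.
Proof. by []. Qed.

Lemma dom_trans eta nu mu : dom_le nu eta -> dom_le eta mu -> dom_le nu mu.
Proof.
by move=> [d1 h1] [d2 h2]; split=> [|c]; [rewrite d1 | apply: leq_trans (h1 c) (h2 c)].
Qed.

Lemma excess_perm c (s : 'S_n.+1) m : excess c [multinom m (s k) | k < n.+1] = excess c m.
Proof. by rewrite /excess [RHS](reindex_perm s); apply: eq_bigr => l _; rewrite mnmE. Qed.

Lemma dom_perm (s : 'S_n.+1) m :
  dom_le [multinom m (s k) | k < n.+1] m /\ dom_le m [multinom m (s k) | k < n.+1].
Proof.
by split; (split; [rewrite mdeg_mperm | move=> c; rewrite excess_perm]).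
Qed.

Lemma excessD2 c i j m : i != j ->
  excess c m = ((m i - c) + (m j - c) + \sum_(l | (l != i) && (l != j)) (m l - c))%N.
Proof.
by move=> ij; rewrite /excess (bigD1 i) //= (bigD1 j) 1?eq_sym //= addnA.
Qed.

Definition transfer i j d eta nu :=
  [/\ (d <= eta i - eta j)%N, nu i = (eta i - d)%N, nu j = (eta j + d)%N
    & forall l, l != i -> l != j -> nu l = eta l].

Lemma transfer_dom i j d eta nu : i != j -> transfer i j d eta nu -> dom_le nu eta.
Proof.
move=> ij [dle ni nj nl].
have E c : (\sum_(l | (l != i) && (l != j)) (nu l - c)
            = \sum_(l | (l != i) && (l != j)) (eta l - c))%N.
  by apply: eq_bigr => l /andP[li lj]; rewrite nl.
have H c : (excess c nu <= excess c eta)%N.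
  by rewrite !(excessD2 c _ ij) E ni nj leq_add2r; lia.
split=> //; rewrite !mdegE.
have X m : (\sum_l m l = excess 0 m)%N by apply: eq_bigr => l _; rewrite subn0.
by rewrite !X !(excessD2 0 _ ij) E ni nj; congr addn; lia.
Qed.

(** The threshold [c] is the larger of the two new parts: neither of them exceeds it, whereas
    [eta i] does. *)
Lemma transfer_strict i j d eta nu : i != j -> transfer i j d eta nu ->
  (0 < d < eta i - eta j)%N -> ~ dom_le eta nu.
Proof.
move=> ij [dle ni nj nl] dlt [_ /(_ (maxn (eta i - d) (eta j + d)))].
rewrite !(excessD2 _ _ ij) ni nj.
have -> : (\sum_(l | (l != i) && (l != j)) (nu l - maxn (eta i - d) (eta j + d))
  = \sum_(l | (l != i) && (l != j)) (eta l - maxn (eta i - d) (eta j + d)))%N.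
  by apply: eq_bigr => l /andP[li lj]; rewrite nl.
by rewrite leq_add2r; lia.
Qed.

End Dominance.

Section LeadingTerm.
Variables (n : nat) (F : fieldType) (r : F).
Implicit Types (i j : 'I_n.+1) (p q : {mpoly F[n.+1]}) (m eta nu mu : 'X_{1..n.+1}).

Local Notation cher := (cher r).

Definition supp_below eta p := forall nu, p@_nu != 0 -> dom_le nu eta.

Lemma supp_belowX eta nu : dom_le nu eta -> supp_below eta 'X_[nu].
Proof. by move=> le m; rewrite mcoeffX; case: (nu =P m) => [<- //|_]; rewrite eqxx. Qed.

Lemma supp_belowD eta p q : supp_below eta p -> supp_below eta q -> supp_below eta (p + q).
Proof.
move=> bp bq nu; rewrite mcoeffD.
by case: (eqVneq p@_nu 0) => [->|/bp //]; rewrite add0r => /bq.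
Qed.

Lemma supp_belowZ eta c p : supp_below eta p -> supp_below eta (c *: p).
Proof. by move=> bp nu; rewrite mcoeffZ mulf_eq0 negb_or => /andP[_ /bp]. Qed.

Lemma supp_belowB eta p q : supp_below eta p -> supp_below eta q -> supp_below eta (p - q).
Proof. by move=> bp bq; rewrite -scaleN1r; apply/supp_belowD/supp_belowZ. Qed.

Lemma supp_below_sum eta (I : Type) (s : seq I) (P : pred I) (f : I -> {mpoly F[n.+1]}) :
  (forall a, P a -> supp_below eta (f a)) -> supp_below eta (\sum_(a <- s | P a) f a).
Proof.
move=> H; elim/big_ind: _ => //; last exact: supp_belowD.
by move=> nu; rewrite mcoeff0 eqxx.
Qed.

Lemma dd_mulXl_mnm i j eta : i != j ->
  dd i j ('X_i * 'X_[eta]) = \sum_(t < (eta i).+1 - eta j) 'X_[eta - U_(i) *+ t + U_(j) *+ t]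
    - \sum_(t < eta j - (eta i).+1) 'X_[eta - U_(j) *+ t.+1 + U_(i) *+ t.+1] :> {mpoly F[n.+1]}.
Proof.
move=> ij; rewrite -mpolyXD /dd msuppX big_seq1 mcoeffX eqxx scale1r /ddX.
rewrite !mnmDE !mnm1E eqxx (negPf ij) add0n add1n.
by congr (_ - _); apply: eq_bigr => t _; congr 'X_[_]; apply/mnmP => l;
  rewrite !(mnmDE, mnmBE, mulmnE, mnm1E); case: (eqVneq i l) => [<-|_];
  rewrite 1?eq_sym ?(negPf ij) /=; have := ltn_ord t; lia.
Qed.

Lemma mulX_dd_mnm i j eta : i != j ->
  'X_i * dd i j 'X_[eta] = \sum_(t < eta i - eta j) 'X_[eta - U_(i) *+ t + U_(j) *+ t]
    - \sum_(t < eta j - eta i) 'X_[eta - U_(j) *+ t.+1 + U_(i) *+ t.+1] :> {mpoly F[n.+1]}.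
Proof.
move=> ij; rewrite /dd msuppX big_seq1 mcoeffX eqxx scale1r /ddX mulrBr !mulr_sumr.
by congr (_ - _); apply: eq_bigr => t _; rewrite -mpolyXD; congr 'X_[_]; apply/mnmP => l;
  rewrite !(mnmDE, mnmBE, mulmnE, mnm1E); case: (eqVneq i l) => [<-|_];
  rewrite 1?eq_sym ?(negPf ij) /=; have := ltn_ord t; lia.
Qed.

Lemma transfer_mnm i j d eta : i != j -> (d <= eta i - eta j)%N ->
  transfer i j d eta (eta - U_(i) *+ d + U_(j) *+ d)%MM.
Proof.
move=> ij dle; split=> // [||l li lj]; rewrite !(mnmDE, mnmBE, mulmnE, mnm1E) ?eqxx.
- by rewrite eq_sym (negPf ij) /=; lia.
- by rewrite (negPf ij) /=; lia.
by rewrite eq_sym (negPf li) eq_sym (negPf lj); lia.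
Qed.

(** For [j > i] the term [r s_ij] merges with [r x_i dd_ij] into [r dd_ij x_i]. In this form every
    monomial of [Y_i X^eta] is a transfer of [eta], which gives triangularity. *)
Lemma cherE_sum i p : cher i p = 'X_i * p^`M(i)
  + r *: (\sum_(j < n.+1 | (j < i)%N) 'X_i * dd i j p
          + \sum_(j < n.+1 | (i < j)%N) dd i j ('X_i * p)).
Proof.
rewrite cherE dunklE mulrDr -scalerAr -addrA -scalerDr; congr (_ + _ *: _).
rewrite mulr_sumr (bigID (fun j => (j < i)%N)) /= -addrA; congr (_ + _).
rewrite (bigD1 i) ?ltnn //= dd_id mulr0 add0r.
rewrite (eq_bigl (fun j : 'I_n.+1 => (i < j)%N)) => [|j]; last first.
  by rewrite -leqNgt [RHS]ltn_neqAle andbC eq_sym.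
rewrite -big_split; apply: eq_bigr => j ij /=; rewrite dd_mulXl //.
by rewrite -(inj_eq val_inj) neq_ltn ij.
Qed.

Lemma supp_below_transfers i j eta a b : i != j ->
  (a <= (eta i - eta j).+1)%N -> (b <= eta j - eta i)%N ->
  supp_below eta (\sum_(t < a) 'X_[eta - U_(i) *+ t + U_(j) *+ t]
    - \sum_(t < b) 'X_[eta - U_(j) *+ t.+1 + U_(i) *+ t.+1]).
Proof.
move=> ij ale ble; have ji : j != i by rewrite eq_sym.
apply: supp_belowB; apply: supp_below_sum => t _; apply: supp_belowX.
  by apply: (transfer_dom ij); apply: transfer_mnm => //; have := ltn_ord t; lia.
by apply: (transfer_dom ji); apply: transfer_mnm => //; have := ltn_ord t; lia.
Qed.

Lemma mulX_mderivX i eta : 'X_i * 'X_[eta]^`M(i) = (eta i)%:R *: 'X_[eta] :> {mpoly F[n.+1]}.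
Proof.
rewrite mderivX -scalerAr -mpolyXD; have [->|nz] := eqVneq (eta i) 0%N.
  by rewrite !scale0r.
by rewrite addmC submK // lep1mP.
Qed.

Lemma cher_supp_below i eta : supp_below eta (cher i 'X_[eta]).
Proof.
rewrite cherE_sum mulX_mderivX; apply: supp_belowD.
  exact/supp_belowZ/supp_belowX/dom_refl.
apply/supp_belowZ/supp_belowD; apply: supp_below_sum => j ij.
  have {}ij : i != j by rewrite -(inj_eq val_inj) neq_ltn ij orbT.
  by rewrite mulX_dd_mnm //; apply: supp_below_transfers.
have {}ij : i != j by rewrite -(inj_eq val_inj) neq_ltn ij.
by rewrite dd_mulXl_mnm //; apply: supp_below_transfers => //; lia.
Qed.

(** The entries are integers because lowering a zero row produces [-1]. *)
Definition rho_wt (z : 'I_n.+1 -> int) i : F := (z i)%:~R + r * (n - i)%:R.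

(* The eigenvalue of [cher i] on the Jack polynomial of [mu]; as rows are numbered from 0,
   [n - i] is the number of rows below row [i]. *)
Definition wt mu := rho_wt (fun i => (mu i)%:Z).

Lemma mcoeff_transfer0 i j d eta mu : i != j -> dom_le eta mu ->
  (0 < d < eta i - eta j)%N -> ('X_[eta - U_(i) *+ d + U_(j) *+ d] : {mpoly F[n.+1]})@_mu = 0.
Proof.
move=> ij le dlt; rewrite mcoeffX; case: eqP => // e; case: notF.
have T := transfer_mnm ij (d := d) (eta := eta).
by case: (transfer_strict ij (T _) dlt); rewrite ?e //; lia.
Qed.

(** A proper transfer of [eta] lies strictly below [eta], so it is not [mu]. What could remain is
    [eta] itself or its full exchange of parts, and each occurs only with a larger part in row [i]
    than in row [j]. *)
Lemma mcoeff_mulX_dd i j eta mu : i != j -> (mu i <= mu j)%N -> dom_le eta mu ->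
  ('X_i * dd i j 'X_[eta] : {mpoly F[n.+1]})@_mu = 0.
Proof.
move=> ij mij le; have ji : j != i by rewrite eq_sym.
rewrite mulX_dd_mnm // mcoeffB !(raddf_sum (mcoeff mu)) /= !big1 ?subrr // => t _.
  have [d1|d1] := ltnP t.+1 (eta j - eta i).
    by rewrite mcoeff_transfer0.
  rewrite mcoeffX; case: eqP => // e; move: mij; rewrite -e.
  rewrite !(mnmDE, mnmBE, mulmnE, mnm1E) !eqxx ?(negPf ij) ?(negPf ji) /=.
  by have := ltn_ord t; lia.
have [t0|tpos] := posnP t; last by rewrite mcoeff_transfer0 // tpos ltn_ord.
rewrite mcoeffX; case: eqP => // e; move: mij; rewrite -e t0.
rewrite !(mnmDE, mnmBE, mulmnE, mnm1E) !eqxx ?(negPf ij) ?(negPf ji) /=.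
by have := ltn_ord t; lia.
Qed.

(** As for [mcoeff_mulX_dd], but now the term [t = 0] survives. One unit for each [j > i] yields the
    summand [r (n - i)] of the weight. *)
Lemma mcoeff_dd_mulX i j eta mu : i != j -> (mu j <= mu i)%N -> dom_le eta mu ->
  (dd i j ('X_i * 'X_[eta]) : {mpoly F[n.+1]})@_mu = (eta == mu)%:R.
Proof.
move=> ij mij le; have ji : j != i by rewrite eq_sym.
rewrite dd_mulXl_mnm // mcoeffB !(raddf_sum (mcoeff mu)) /=.
rewrite [X in _ - X]big1 ?subr0 => [|t _]; last first.
  by rewrite mcoeff_transfer0 //; have := ltn_ord t; lia.
have X0 : (eta - U_(i) *+ 0 + U_(j) *+ 0 = eta)%MM by rewrite subm0 addm0.
case E : ((eta i).+1 - eta j)%N => [|d].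
  rewrite big_ord0; case: eqP => // e; move: E mij; rewrite e; lia.
rewrite big_ord_recl big1 ?addr0 /= => [|t _]; first by rewrite X0 mcoeffX.
rewrite /bump /= add1n; have [d1|d1] := ltnP t.+1 (eta i - eta j).
  by rewrite mcoeff_transfer0.
rewrite mcoeffX; case: eqP => // e; move: mij; rewrite -e.
rewrite !(mnmDE, mnmBE, mulmnE, mnm1E) !eqxx ?(negPf ij) ?(negPf ji) /=.
by have := ltn_ord t; lia.
Qed.

Lemma card_ord_gt i : #|[pred j : 'I_n.+1 | (i < j)%N]| = (n - i)%N.
Proof.
rewrite -sum1_card -(big_geq_mkord _ _ predT (fun=> 1%N)).
by rewrite sum_nat_const_nat muln1 subSS.
Qed.

Lemma mcoeff_cherX i eta mu : (forall a b : 'I_n.+1, (a <= b)%N -> (mu b <= mu a)%N) ->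
  dom_le eta mu -> (cher i 'X_[eta])@_mu = wt mu i * (eta == mu)%:R.
Proof.
move=> mono le; rewrite cherE_sum mulX_mderivX mcoeffD !mcoeffZ mcoeffD !raddf_sum /=.
rewrite [X in _ + r * (X + _)]big1 => [|j ji]; last first.
  have ij : i != j by rewrite -(inj_eq val_inj) neq_ltn ji orbT.
  by rewrite mcoeff_mulX_dd // mono // ltnW.
rewrite add0r (eq_bigr (fun=> (eta == mu)%:R)) => [|j ji]; last first.
  have ij : i != j by rewrite -(inj_eq val_inj) neq_ltn ji.
  by rewrite mcoeff_dd_mulX // mono // ltnW.
rewrite mcoeffX sumr_const card_ord_gt /wt /rho_wt.
by case: eqP => [->|_]; rewrite ?mulr1 // !mulr0 mul0rn mulr0 addr0.
Qed.

End LeadingTerm.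

(** * Leading exponents and uniqueness of joint eigenvectors *)

Lemma is_partP (n : nat) (m : 'X_{1..n}) :
  reflect (forall a b : 'I_n, (a <= b)%N -> (m b <= m a)%N) (is_part m).
Proof.
apply: (iffP forallP) => [H a b ab|H a].
  by have /forallP /(_ b) := H a; rewrite ab.
by apply/forallP => b; apply/implyP; apply: H.
Qed.

Lemma exists_part_perm (n : nat) (m : 'X_{1..n}) :
  exists s : 'S_n, is_part [multinom m (s i) | i < n].
Proof.
pose t := sort_tuple geq m.
have /tuple_permP [s st] : perm_eq t m by rewrite /= perm_sort.
exists s; apply/is_partP => a b ab; rewrite !mnmE.
have E i : m (s i) = nth 0%N t i.
  have -> : nth 0%N t i = nth 0%N [tuple tnth m (s i0) | i0 < n] i by rewrite st.
  by rewrite -tnth_nth tnth_mktuple.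
rewrite !E; have geq_tr : transitive geq by move=> x y z xy yz; exact: leq_trans yz xy.
apply: (@sorted_leq_nth _ geq geq_tr leqnn 0%N t); rewrite ?inE ?size_tuple //.
by apply: sort_sorted => x y; exact: leq_total.
Qed.

Lemma prod_filter_enum (T : finType) (R : comNzRingType) (P : pred T) (f : T -> R) :
  \prod_(j <- [seq j <- enum T | P j]) f j = \prod_(j | P j) f j.
Proof. by rewrite big_filter big_enum_cond. Qed.

Section Leading.
Variables (n : nat) (F : fieldType) (r : F).
Implicit Types (i j k : 'I_n.+1) (p f g h : {mpoly F[n.+1]}).
Implicit Types (lam m eta nu mu : 'X_{1..n.+1}) (u : F).

Local Notation cher := (cher r).
Local Notation cprod := (cprod r).
Local Notation cdelta := (cdelta r).
Local Notation joint := (joint r).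
Local Notation wt := (wt r).

(** Maximality up to equivalence: other rearrangements of [mu] may occur in [h]. *)
Definition leads mu h := forall eta, h@_eta != 0 -> dom_le mu eta -> dom_le eta mu.

Lemma mcoeff_cher_expand i h nu :
  (cher i h)@_nu = \sum_(eta <- msupp h) h@_eta * (cher i 'X_[eta])@_nu.
Proof.
rewrite {1}(mpolyE h) cher_sum raddf_sum /=.
by apply: eq_bigr => eta _; rewrite cherZ mcoeffZ.
Qed.

Lemma leads_cher i mu h : leads mu h -> leads mu (cher i h).
Proof.
move=> lh nu; rewrite mcoeff_cher_expand => nz le.
suff [eta he ne] : exists2 eta, h@_eta != 0 & dom_le nu eta.
  apply: (dom_trans ne); apply: lh => //; exact: dom_trans le ne.
apply: NNPP => none; case/eqP: nz; apply: big1_seq => eta /= eh.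
have [->|z] := eqVneq (cher i 'X_[eta])@_nu 0; first by rewrite mulr0.
case: none; exists eta; first by rewrite -mcoeff_msupp.
exact: (cher_supp_below z).
Qed.

(** An exponent of [h] that contributes to [mu] lies above [mu], hence in its class by maximality;
    within the class [mcoeff_cherX] leaves only [mu], because [mu] is sorted. *)
Lemma mcoeff_cher_lead i mu h : is_part mu -> leads mu h ->
  (cher i h)@_mu = wt mu i * h@_mu.
Proof.
move=> /is_partP pm lh; rewrite mcoeff_cher_expand.
transitivity (\sum_(eta <- msupp h) wt mu i * (h@_eta * (eta == mu)%:R)).
  apply: eq_big_seq => eta; rewrite mcoeff_msupp => eh.
  have [le|nle] := classic (dom_le mu eta).
    by rewrite mcoeff_cherX //; [rewrite mulrCA | apply: lh].
  have [e|ne] := eqVneq eta mu; first by case: nle; rewrite e; exact: dom_refl.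
  rewrite !mulr0; have [->|z] := eqVneq (cher i 'X_[eta])@_mu 0; first by rewrite mulr0.
  by case: nle; exact: (cher_supp_below z).
rewrite -mulr_sumr; congr (_ * _); rewrite [in RHS](mpolyE h) raddf_sum /=.
by apply: eq_bigr => eta _; rewrite mcoeffZ mcoeffX.
Qed.

Lemma leadsD mu c f g : leads mu f -> leads mu g -> leads mu (c *: f + g).
Proof.
move=> lf lg eta; rewrite mcoeffD mcoeffZ.
by case: (eqVneq f@_eta 0) => [->|/lf //]; rewrite mulr0 add0r => /lg.
Qed.

Lemma leads_cfactor mu (a : 'I_n.+1 -> F) j h : leads mu h -> leads mu (cfactor r a j h).
Proof.
move=> lh; rewrite /cfactor -scaleN1r; apply: leadsD => //.
rewrite -[_ *: cher j h]addr0; apply: leadsD; first exact: leads_cher.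
by move=> e; rewrite mcoeff0 eqxx.
Qed.

Lemma mcoeff_cprod_lead mu P a h : is_part mu -> leads mu h ->
  (cprod P a h)@_mu = \prod_(j | P j) (a j - wt mu j) * h@_mu.
Proof.
move=> pm lh; rewrite /cprod -prod_filter_enum.
suff [] : leads mu (foldr (cfactor r a) h [seq j <- enum 'I_n.+1 | P j]) /\
  (foldr (cfactor r a) h [seq j <- enum 'I_n.+1 | P j])@_mu
    = \prod_(j <- [seq j <- enum 'I_n.+1 | P j]) (a j - wt mu j) * h@_mu by [].
elim: (filter _ _) => [|j s [ls cs]] /=; first by rewrite big_nil mul1r.
split; first exact: leads_cfactor.
rewrite big_cons /cfactor mcoeffB mcoeffZ mcoeff_cher_lead // cs; ring.
Qed.

Lemma cprod_eigen (c : 'I_n.+1 -> F) P a p : (forall j, cher j p = c j *: p) ->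
  cprod P a p = \prod_(j | P j) (a j - c j) *: p.
Proof.
move=> e; rewrite /cprod -prod_filter_enum.
elim: (filter _ _) => [|j s IH] /=; first by rewrite big_nil scale1r.
by rewrite IH /cfactor cherZ e big_cons -!mul_mpolyC !rmorphM /= rmorphB /=; ring.
Qed.

(* The sum of all the excesses is strictly monotone along [dom_le]. *)
Lemma leadsW h : exists N : 'X_{1..n.+1} -> nat, forall mu nu, h@_mu != 0 -> h@_nu != 0 ->
  dom_le mu nu -> dom_le nu mu \/ (N mu < N nu)%N.
Proof.
pose B := msize h; exists (fun m => \sum_(c < B) excess c m)%N => mu nu hm hn [dmn le].
have [leN|] := leqP (\sum_(c < B) excess c nu) (\sum_(c < B) excess c mu); [left | by right].
have deg_lt m : h@_m != 0 -> (mdeg m < B)%N.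
  by rewrite -mcoeff_msupp; exact: msize_mdeg_lt.
split=> // c; have [Bc|cB] := leqP B c.
  rewrite /excess big1 // => l _; apply/eqP; rewrite subn_eq0.
  apply: (leq_trans _ Bc); apply: ltnW; apply: leq_ltn_trans (deg_lt _ hn).
  by rewrite mdegE (bigD1 l) //= leq_addr.
move: leN; rewrite (bigD1 (Ordinal cB)) //= [in leqRHS](bigD1 (Ordinal cB)) //=.
move=> leN; rewrite -(leq_add2r (\sum_(k < B | k != Ordinal cB) excess k mu)).
by apply: leq_trans leN; rewrite leq_add2l; apply: leq_sum.
Qed.

(** Climb from [eta] until the exponent is maximal, with [N] bounding the climb, then sort it;
    symmetry keeps the coefficient. *)
Lemma exists_leads h eta : h \is symmetric -> h@_eta != 0 ->
  exists mu, [/\ is_part mu, h@_mu != 0, leads mu h & dom_le eta mu].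
Proof.
move=> sh he; have [N NP] := leadsW h; pose K := (\sum_(m <- msupp h) N m)%N.
have NK m : h@_m != 0 -> (N m <= K)%N.
  by rewrite -mcoeff_msupp => mh; rewrite /K (bigD1_seq m) ?msupp_uniq //= leq_addr.
have [d] := ubnP (K - N eta); elim: d eta he => // d IH eta he Kd.
have [[nu [hn le nle]]|no] := classic (exists nu, [/\ h@_nu != 0, dom_le eta nu & ~ dom_le nu eta]).
  have lt : (N eta < N nu)%N by case: (NP _ _ he hn le).
  have [|mu [pm hm lm nm]] := IH nu hn; first by have := NK _ hn; lia.
  by exists mu; split=> //; exact: dom_trans le nm.
have [s ps] := exists_part_perm eta; set mu := [multinom _ | _ < _] in ps.
have [lme lem] := dom_perm s eta.
have hm : h@_mu != 0 by rewrite msym_coeff.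
exists mu; split=> // nu hn le; apply: NNPP => nle; case: no; exists nu; split=> //.
  exact: dom_trans lem le.
by move=> le'; apply: nle; exact: dom_trans le' lem.
Qed.

(** Independence of 1 and [r] over the integers; it yields characteristic zero, [r != 0] and the
    separation of weights. *)
Hypothesis generic : forall a b : int, a%:~R + r * b%:~R = 0 -> a = 0 /\ b = 0.

Lemma generic_char0 (k : nat) : k.+1%:R != 0 :> F.
Proof.
apply/eqP => k0; have [] := generic (a := k.+1) (b := 0); last by [].
by rewrite mulr0z mulr0 addr0.
Qed.

Lemma generic_neq0 : r != 0.
Proof.
apply/eqP => r0; have [] := generic (a := 0) (b := 1); last by [].
by rewrite r0 mul0r addr0.
Qed.

Lemma rho_wt_eq (z z' : 'I_n.+1 -> int) i j :
  rho_wt r z i = rho_wt r z' j -> i = j /\ z i = z' j.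
Proof.
move=> e; have [] := generic (a := z i - z' j) (b := (n - i)%N%:Z - (n - j)%N%:Z).
  rewrite !rmorphB /= mulrBr addrACA -opprD.
  by apply/eqP; rewrite subr_eq0; apply/eqP; exact: e.
move/subr0_eq => -> /subr0_eq [] ij; split=> //; apply/val_inj => /=.
by have := ltn_ord i; have := ltn_ord j; lia.
Qed.

Lemma rho_wt_inj (z : 'I_n.+1 -> int) : injective (rho_wt r z).
Proof. by move=> i j /rho_wt_eq []. Qed.

Lemma charpoly_rho_wt_inj (z z' : 'I_n.+1 -> int) :
  charpoly (rho_wt r z) = charpoly (rho_wt r z') -> z =1 z'.
Proof.
move=> e i; have := horner_charpoly_root (rho_wt r z) i.
rewrite e horner_charpoly => /eqP; rewrite prodf_seq_eq0 => /hasP[j _ /=].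
by rewrite subr_eq0 => /eqP /rho_wt_eq [-> ->].
Qed.

(** On a leading exponent [mu] the operator acts by the weights of [mu], so the two spectra, hence
    [z] and [mu], agree. If [z] is not a partition, [h] must therefore be 0. *)
Lemma joint_lead z h eta : h \is symmetric -> h@_eta != 0 -> joint (charpoly (rho_wt r z)) h ->
  exists mu, [/\ is_part mu, h@_mu != 0, dom_le eta mu & forall i, z i = mu i].
Proof.
move=> sh he jh; have [mu [pm hm lm em]] := exists_leads sh he.
exists mu; split=> //; apply: charpoly_rho_wt_inj; apply: (horner_inj generic_char0) => u.
apply: (mulIf hm); rewrite -mcoeffZ -jh /cdelta mcoeff_cprod_lead //.
by rewrite horner_charpoly.
Qed.

Lemma joint_dom lam h eta : h \is symmetric -> joint (charpoly (wt lam)) h -> h@_eta != 0 ->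
  [/\ is_part lam, h@_lam != 0 & dom_le eta lam].
Proof.
move=> sh jh he; have [mu [pm hm em e]] := joint_lead sh he jh.
by have -> : lam = mu by apply/mnmP => i; have := e i; case.
Qed.

Lemma exists_mcoeff_neq0 h : h != 0 -> exists eta, h@_eta != 0.
Proof.
move=> h0; apply: NNPP => no; case/eqP: h0; apply/mpolyP => m; rewrite mcoeff0.
by apply/eqP/negPn/negP => hm; apply: no; exists m.
Qed.

(** A nonzero difference would have a nonzero coefficient at [lam] by [joint_dom]. *)
Lemma joint_unique lam f g : joint (charpoly (wt lam)) f -> joint (charpoly (wt lam)) g ->
  f \is symmetric -> g \is symmetric -> f@_lam = g@_lam -> f = g.
Proof.
move=> jf jg sf sg fg; apply/eqP; rewrite -subr_eq0; apply/negPn/negP => h0.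
have jh : joint (charpoly (wt lam)) (f - g).
  by rewrite addrC -scaleN1r; apply: jointD.
have [eta he] := exists_mcoeff_neq0 h0.
have [_ hl _] := joint_dom (rpredB sf sg) jh he.
by move: hl; rewrite mcoeffB fg subrr eqxx.
Qed.

Lemma joint_ev1 lam f g : joint (charpoly (wt lam)) f -> joint (charpoly (wt lam)) g ->
  f \is symmetric -> g \is symmetric -> ev1 g = 1 -> f = ev1 f *: g.
Proof.
move=> jf jg sf sg eg.
have g0 : g != 0 by apply: contra_eq_neq eg => ->; rewrite /ev1 meval0 eq_sym oner_eq0.
have [eta he] := exists_mcoeff_neq0 g0.
have [_ hm _] := joint_dom sg jg he.
have {2}-> : f = (f@_lam / g@_lam) *: g.
  apply: (@joint_unique lam) => //; first exact: jointZ.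
    exact: rpredZ.
  by rewrite mcoeffZ divfK.
rewrite ev1Z eg mulr1.
apply: (@joint_unique lam) => //; first exact: jointZ.
  exact: rpredZ.
by rewrite mcoeffZ divfK.
Qed.

Lemma joint_one : joint (charpoly (wt (0%MM : 'X_{1..n.+1}))) (1 : {mpoly F[n.+1]}).
Proof.
move=> u; rewrite /cdelta (@cprod_eigen (wt 0%MM)) ?horner_charpoly // => j.
rewrite cherE dunkl1 mulr0 add0r (eq_bigr (fun=> 1)) => [|k _]; last exact: msym1.
rewrite sumr_const card_ord_gt /wt /rho_wt mnm0E add0r.
by rewrite -scalerA scaler_nat.
Qed.

Lemma wt_addU lam i :
  wt (lam + U_(i))%MM =1 (fun j => wt lam j + 1 *+ (j == i)).
Proof.
move=> j; rewrite /wt /rho_wt mnmDE mnm1E PoszD rmorphD /= eq_sym.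
by rewrite addrAC; case: (j == i).
Qed.

Lemma eq_charpoly (y y' : 'I_n.+1 -> F) : y =1 y' -> charpoly y = charpoly y'.
Proof. by move=> e; apply: eq_bigr => j _; rewrite e. Qed.

(** Induction on the number of boxes, the last nonzero row being raised from one box less. *)
Lemma exists_joint lam : is_part lam ->
  exists g : {mpoly F[n.+1]}, [/\ g \is symmetric, joint (charpoly (wt lam)) g & ev1 g = 1].
Proof.
have [d] := ubnP (mdeg lam); elim: d lam => // d IH lam ld pl.
have [->|nz] := eqVneq lam 0%MM.
  exists 1; split; [exact: rpred1 | exact: joint_one | exact: meval1].
have [i li imax] : exists2 i, lam i != 0%N & forall j, (i < j)%N -> lam j = 0%N.
  have [i0 li0] := mnm_neq0P nz.
  case: (arg_maxnP (P := fun i => lam i != 0%N) (fun i => i : nat) li0) => i li imax.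
  exists i => // j ij; apply/eqP; apply: contraTT ij => /imax; by rewrite -leqNgt.
have le : (U_(i) <= lam)%MM by rewrite lep1mP.
pose mu := (lam - U_(i))%MM; have lE : lam = (mu + U_(i))%MM by rewrite submK.
have muE j : mu j = (lam j - (i == j))%N by rewrite mnmBE mnm1E.
have pm : is_part mu.
  apply/is_partP => a b ab; rewrite !muE; have := is_partP _ pl _ _ ab.
  case: (eqVneq i a) => [ia|_]; last by lia.
  case: (eqVneq i b) => [ib|ib]; first by rewrite -ia -ib.
  by rewrite (imax b) ?sub0n // ltn_neqAle ia ab -ia (inj_eq val_inj) ib.
have [f [sf jf ef]] : exists g : {mpoly F[n.+1]},
    [/\ g \is symmetric, joint (charpoly (wt mu)) g & ev1 g = 1].
  by apply: IH => //; move: ld; rewrite lE mdegD mdeg1 addn1.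
have [g [sg jg eg]] := exists_raised generic_char0 generic_neq0 i sf jf.
have eg0 : ev1 g != 0.
  apply: contra_eq_neq eg => ->; rewrite mulr0 eq_sym !mulf_neq0 ?fact_neq0 //.
  - exact: generic_char0.
  (* A vanishing factor would force [mu i = mu j] with [i = j + 1], that is, row [i] of [lam] would
     be one box longer than the row above it. *)
  - apply/prodf_neq0 => j ji; apply/eqP.
    rewrite /wt /rho_wt => e.
    have [] := generic (a := (mu i)%:Z - (mu j)%:Z) (b := (n - i)%N%:Z - (n - j)%N%:Z + 1).
      rewrite -[RHS]e !(rmorphD, rmorphB, rmorphN) /=; ring.
    move/subr0_eq => [] mij bij.
    have ij : i = j.+1 :> nat by have := ltn_ord i; have := ltn_ord j; lia.
    have := is_partP _ pl j i; rewrite ij leqnSn => /(_ isT).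
    move: mij li; rewrite !muE eqxx eq_sym (negPf ji); lia.
  by rewrite ef oner_neq0.
exists ((ev1 g)^-1 *: g); split; [exact: rpredZ | apply: jointZ | by rewrite ev1Z mulVf].
by rewrite lE (eq_charpoly (wt_addU mu i)).
Qed.

End Leading.

(** * The dominance order on partitions and a statistic strictly monotone for it *)

Section DominatedPartitions.
Variable n : nat.
Implicit Types (i j k : 'I_n.+1) (m lam mu nu : 'X_{1..n.+1}).

Definition psum m k := (\sum_(i < n.+1 | (i <= k)%N) m i)%N.

Lemma dominatedP mu lam :
  reflect (mdeg mu = mdeg lam /\ forall k, (psum mu k <= psum lam k)%N) (dominated mu lam).
Proof. by apply: (iffP andP) => [[/eqP e /forallP h]|[/eqP e h]]; split=> //; apply/forallP. Qed.

(* Truncate at the value of [lam] in row [k]. *)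
Lemma dom_le_dominated mu lam : is_part lam -> dom_le mu lam -> dominated mu lam.
Proof.
move=> /is_partP pl [dm le]; apply/dominatedP; split=> // k.
pose c := lam k; have split_excess m : excess c m =
    (\sum_(i < n.+1 | (i <= k)%N) (m i - c) + \sum_(i < n.+1 | ~~ (i <= k)%N) (m i - c))%N.
  by rewrite /excess (bigID (fun i : 'I_n.+1 => (i <= k)%N)).
have lamc : excess c lam = (\sum_(i < n.+1 | (i <= k)%N) (lam i - c))%N.
  rewrite split_excess [X in (_ + X)%N]big1 ?addn0 // => i; rewrite -ltnNge => /ltnW /pl.
  by rewrite -subn_eq0 => /eqP.
have C : (\sum_(i < n.+1 | (i <= k)%N) (lam i - c) + \sum_(i < n.+1 | (i <= k)%N) c
  = psum lam k)%N.
  by rewrite -big_split; apply: eq_bigr => i /pl /subnK.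
rewrite -C -lamc; apply: leq_trans (leq_add (le c) (leqnn _)).
rewrite split_excess addnAC; apply: leq_trans (leq_addr _ _).
by rewrite -big_split /psum; apply: leq_sum => i _ /=; lia.
Qed.

Lemma psum_inj mu lam : (forall k, psum mu k = psum lam k) -> mu = lam.
Proof.
move=> e; apply/mnmP => i.
have S m : psum m i = (m i + \sum_(j < n.+1 | (j < i)%N) m j)%N.
  rewrite /psum (bigD1 i) //=; congr addn; apply: eq_bigl => j.
  by rewrite andbC -(inj_eq val_inj) /= ltn_neqAle.
suff : (\sum_(j < n.+1 | (j < i)%N) mu j = \sum_(j < n.+1 | (j < i)%N) lam j)%N.
  by move=> e'; have := e i; rewrite !S e' => /addIn.
case: (posnP i) => [i0|ipos].
  by rewrite !big_pred0 // => j; rewrite i0.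
have hi : (i.-1 < n.+1)%N by have := ltn_ord i; lia.
have E m : (\sum_(j < n.+1 | (j < i)%N) m j = psum m (Ordinal hi))%N.
  by apply: eq_bigl => j /=; rewrite -[in RHS]ltnS prednK.
by rewrite !E.
Qed.

Lemma dominated_anti mu lam : dominated mu lam -> dominated lam mu -> mu = lam.
Proof.
move=> /dominatedP [_ h] /dominatedP [_ h']; apply: psum_inj => k.
by apply/eqP; rewrite eqn_leq h h'.
Qed.

(** Up to [mdeg], the sum of all partial sums, by [sum_psum]; its double is also the coefficient of
    [r] in the eigenvalue [wt_sq]. *)
Definition colweight m := (\sum_(i < n.+1) (n - i) * m i)%N.

Lemma sum_psum m : (\sum_k psum m k = colweight m + mdeg m)%N.
Proof.
rewrite /psum (exchange_big_dep predT) //= mdegE /colweight -big_split /=.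
apply: eq_bigr => i _; rewrite sum_nat_const addnC -mulSn -card_ord_gt; congr muln.
rewrite (@cardD1x _ [pred j : 'I_n.+1 | (i <= j)%N] i (leqnn i)) add1n; congr S.
apply: eq_card => j.
by rewrite !inE ltn_neqAle -(inj_eq val_inj) /= andbC eq_sym.
Qed.

Lemma colweight_inj mu lam : dominated mu lam -> colweight mu = colweight lam -> mu = lam.
Proof.
move=> /dominatedP [dm h] cw; apply: psum_inj => k; apply/eqP; rewrite eqn_leq h /=.
have e : (\sum_k psum lam k = \sum_k psum mu k)%N by rewrite !sum_psum cw dm.
move: e; rewrite (bigD1 k) //= [in RHS](bigD1 k) //= => e.
have : (\sum_(j | j != k) psum mu j <= \sum_(j | j != k) psum lam j)%N.
  by apply: leq_sum => j _.
by rewrite -(leq_add2l (psum lam k)) e leq_add2r.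
Qed.

Lemma perm_mnm m nu : perm_eq m nu -> exists s : 'S_n.+1, m = [multinom nu (s i) | i < n.+1].
Proof.
move=> /tuple_permP [s e]; exists s; apply/mnmP => i; rewrite mnmE.
by rewrite (mnm_nth 0%N) e -tnth_nth tnth_mktuple.
Qed.

Lemma mnm_perm m (s : 'S_n.+1) : perm_eq [multinom m (s i) | i < n.+1] m.
Proof.
apply/tuple_permP; exists s; congr val.
Qed.

Lemma perm_dom m nu : perm_eq m nu -> dom_le m nu.
Proof. by case/perm_mnm => s ->; case: (dom_perm s nu). Qed.

Lemma perm_part mu nu : is_part mu -> is_part nu -> perm_eq mu nu -> mu = nu.
Proof.
move=> pm pn mn; apply: dominated_anti; apply: dom_le_dominated => //.
  exact: perm_dom.
by apply: perm_dom; rewrite perm_sym.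
Qed.

End DominatedPartitions.

(** * The sum of the squares of the Cherednik operators *)

Section LaplaceOperator.
Variables (n : nat) (F : fieldType) (r : F).
Implicit Types (i j k : 'I_n.+1) (p q f g h : {mpoly F[n.+1]}).
Implicit Types (lam m eta nu mu : 'X_{1..n.+1}) (u : F).

Local Notation cher := (cher r).
Local Notation joint := (joint r).
Local Notation wt := (wt r).
Local Notation tr i j := (msym (tperm i j)).

Definition cher_sq p := \sum_i cher i (cher i p).

Lemma cher_sq_linear : linear cher_sq.
Proof.
move=> c p q; rewrite /cher_sq scaler_sumr -big_split; apply: eq_bigr => i _ /=.
by rewrite !(cherD, cherZ).
Qed.

HB.instance Definition _ :=
  GRing.isLinear.Build F {mpoly F[n.+1]} {mpoly F[n.+1]} _ cher_sq cher_sq_linear.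

Lemma joint_cher_sq (Q : {poly F}) f : joint Q f -> joint Q (cher_sq f).
Proof.
move=> jf u; rewrite /cdelta -(cprod_comm (r := r) (f := cher_sq)) => [|j q _]; last first.
  rewrite /= /cher_sq cher_sum; apply: eq_bigr => i _.
  by rewrite (cher_comm r i j q) (cher_comm r i j (cher i q)).
by rewrite -/(cdelta r u f) jf linearZ.
Qed.

Lemma msym_cher_sq (s : 'S_n.+1) p : msym s (cher_sq p) = cher_sq (msym s p).
Proof.
elim/adjacent_tperm_ind: s p => [|s t IHs IHt|i j ij] p; first by rewrite !msym1m.
  by rewrite !msymMm IHs IHt.
have ji : j != i by apply/eqP => e; move: ij; rewrite e; lia.
rewrite /cher_sq raddf_sum (bigD1 i) //= (bigD1 j) //= [RHS](bigD1 i) //= [in RHS](bigD1 j) //=.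
rewrite !addrA; congr (_ + _); last first.
  by apply: eq_bigr => k /andP[ki kj]; rewrite !(cher_tr r _ ij).
rewrite !(cher_trl _ _ ij) !(cher_trr _ _ ij) !cherB !cherD !cherZ.
by rewrite -!mul_mpolyC; ring.
Qed.

Definition wt_sq mu := \sum_i wt mu i ^+ 2.

Lemma mcoeff_cher_sq_lead mu h : is_part mu -> leads mu h ->
  (cher_sq h)@_mu = wt_sq mu * h@_mu.
Proof.
move=> pm lh; rewrite /cher_sq raddf_sum mulr_suml; apply: eq_bigr => i _ /=.
by rewrite !mcoeff_cher_lead ?mulrA //; exact: leads_cher.
Qed.

Definition euler p := \sum_i 'X_i * p^`M(i).

Lemma sum_tr_symmetric i p : p \is symmetric ->
  \sum_(k < n.+1 | (i < k)%N) tr i k p = (n - i)%:R *: p.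
Proof.
move=> /issymP sp; rewrite (eq_bigr (fun=> p)) => [|k _]; last exact: sp.
by rewrite sumr_const card_ord_gt scaler_nat.
Qed.

Lemma cher_symmetric i p : p \is symmetric ->
  cher i p = 'X_i * p^`M(i) + (r * (n - i)%:R) *: p.
Proof. by move=> sp; rewrite cherE dunkl_sym // sum_tr_symmetric // scalerA. Qed.

(** The first order terms with coefficient [r] cancel: the reflections in the Dunkl operators give
    [- r n] times the Euler operator, and those in the definition of [Y_i] give [+ r n] times it. *)
Lemma cher_sq_symmetric p : p \is symmetric -> cher_sq p =
  \sum_i 'X_i ^+ 2 * p^`M(i)^`M(i) + euler p
  + r *: (\sum_i \sum_j dd i j ('X_i ^+ 2 * p^`M(i)))
  + (r ^+ 2 * \sum_(i < n.+1) (n - i)%:R ^+ 2) *: p.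
Proof.
move=> sp; pose g i := 'X_i * p^`M(i).
have trg i j : tr i j (g i) = g j.
  by rewrite /g rmorphM /= msymXU msym_mderiv tpermL (issymP _ sp).
have E i : cher i (cher i p) = 'X_i ^+ 2 * p^`M(i)^`M(i) + g i
    + r *: (\sum_j dd i j ('X_i ^+ 2 * p^`M(i))) - r *: (\sum_(j | j != i) g j)
    + r *: (\sum_(k < n.+1 | (i < k)%N) g k)
    + (r * (n - i)%:R) *: g i + (r ^+ 2 * (n - i)%:R ^+ 2) *: p.
  rewrite (cher_symmetric i sp) cherD cherZ (cher_symmetric i sp) -/(g i) cherE dunklE.
  have -> : 'X_i * ((g i)^`M(i) + r *: \sum_j dd i j (g i))
      = 'X_i ^+ 2 * p^`M(i)^`M(i) + g i
        + r *: (\sum_j dd i j ('X_i ^+ 2 * p^`M(i))) - r *: (\sum_(j | j != i) g j).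
    rewrite mulrDr -scalerAr -addrA -scalerBr; congr (_ + _ *: _).
      by rewrite /g mderivM mderivXU eqxx mul1r; ring.
    rewrite (bigD1 i) //= [in RHS](bigD1 i) //= !dd_id !add0r mulr_sumr -sumrB.
    apply: eq_bigr => j ji; rewrite expr2 -mulrA -/(g i) dd_mulXl 1?eq_sym //.
    by rewrite trg addrK.
  have -> : \sum_(k < n.+1 | (i < k)%N) tr i k (g i) = \sum_(k < n.+1 | (i < k)%N) g k.
    by apply: eq_bigr => k _; exact: trg.
  by rewrite !expr2 -!mul_mpolyC !mpolyCM; ring.
have A : \sum_i \sum_(j | j != i) g j = n%:R *: euler p.
  rewrite (exchange_big_dep predT) //= scaler_sumr; apply: eq_bigr => j _.
  under eq_bigl do rewrite eq_sym.
  by rewrite sumr_const cardC1 card_ord scaler_nat.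
(* [g k] occurs once for each of the [k] indices [i < k], and [n - k] more times in the second
   sum. *)
have B : \sum_(i < n.+1) \sum_(k < n.+1 | (i < k)%N) g k + \sum_(i < n.+1) (n - i)%:R *: g i
    = n%:R *: euler p.
  rewrite (exchange_big_dep predT) //= scaler_sumr -big_split; apply: eq_bigr => k _ /=.
  rewrite sumr_const -scaler_nat -scalerDl -natrD; congr (_%:R *: _).
  have := cardC [pred j : 'I_n.+1 | (k < j)%N]; rewrite card_ord_gt card_ord.
  set A' := [predC _]; have -> : #|A'| = #|[pred j : 'I_n.+1 | (j < k)%N]|.+1.
    have kA : A' k by rewrite /A' /= inE ltnn.
    rewrite (cardD1x kA) add1n; congr S; apply: eq_card => j.
    by rewrite !inE -leqNgt [RHS]ltn_neqAle -(inj_eq val_inj) andbC.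
  by rewrite addnS addnC => - [].
have C : \sum_(i < n.+1) (r * (n - i)%:R) *: g i = r *: \sum_(i < n.+1) (n - i)%:R *: g i.
  by rewrite scaler_sumr; apply: eq_bigr => i _; rewrite scalerA.
rewrite /cher_sq (eq_bigr _ (fun i _ => E i)) !big_split /= sumrN -/(euler p).
rewrite -!scaler_sumr -scaler_suml -mulr_sumr C A.
have -> : r *: \sum_(i < n.+1) \sum_(k < n.+1 | (i < k)%N) g k
    = r *: (n%:R *: euler p) - r *: \sum_(i < n.+1) (n - i)%:R *: g i.
  by rewrite -B scalerDr addrK.
by rewrite -!mul_mpolyC; ring.
Qed.

Lemma mulX_mderiv_coeff i p m : ('X_i * p^`M(i))@_m = (m i)%:R * p@_m.
Proof.
elim/mpolyind: p => [|c eta p _ _ IH]; first by rewrite raddf0 mulr0 !mcoeff0 mulr0.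
rewrite mderivD mderivZ mulrDr !mcoeffD IH -scalerAr mulX_mderivX !mcoeffZ mcoeffX mulrDr.
by congr (_ + _); rewrite mulrCA; case: (eqVneq eta m) => [->//|_]; rewrite !mulr0.
Qed.

Lemma euler_coeff p m : (euler p)@_m = (mdeg m)%:R * p@_m.
Proof.
rewrite /euler raddf_sum /= (eq_bigr _ (fun i _ => mulX_mderiv_coeff i p m)).
by rewrite -mulr_suml mdegE natr_sum.
Qed.

Lemma euler_homog d p : (forall m, p@_m != 0 -> mdeg m = d) -> euler p = d%:R *: p.
Proof.
move=> H; apply/mpolyP => m; rewrite euler_coeff mcoeffZ.
by have [->|/H ->] := eqVneq p@_m 0; rewrite ?mulr0.
Qed.

Hypothesis generic : forall a b : int, a%:~R + r * b%:~R = 0 -> a = 0 /\ b = 0.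

(** Newton's identities are bypassed: [cher_sq f] is again a symmetric joint eigenvector with the
    same spectrum, so it is a multiple of [f], and the coefficient at [lam] tells which. *)
Lemma cher_sq_joint lam f : f \is symmetric -> joint (charpoly (wt lam)) f ->
  cher_sq f = wt_sq lam *: f.
Proof.
move=> sf jf; have [->|f0] := eqVneq f 0; first by rewrite linear0 scaler0.
have [eta he] := exists_mcoeff_neq0 f0.
have [pl hl _] := joint_dom generic sf jf he.
apply: (joint_unique generic (joint_cher_sq jf) (jointZ _ jf)).
- by apply/issymP => s; rewrite msym_cher_sq (issymP _ sf).
- exact: rpredZ.
rewrite mcoeffZ mcoeff_cher_sq_lead // => nu hn _.
by have [] := joint_dom generic sf jf hn.
Qed.

Lemma wt_sqE mu : wt_sq mu = (\sum_i (mu i)%:Z ^+ 2)%:~R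
  + r * ((2 * colweight mu)%N%:Z)%:~R + r ^+ 2 * \sum_(i < n.+1) (n - i)%:R ^+ 2.
Proof.
have cw : ((colweight mu)%:Z)%:~R = \sum_(i < n.+1) (n - i)%:R * (mu i)%:R :> F.
  transitivity ((\sum_(i < n.+1) (n - i) * mu i)%N%:R : F) => //.
  by rewrite natr_sum; apply: eq_bigr => i _; rewrite natrM.
rewrite /wt_sq rmorph_sum /= PoszM rmorphM /= cw.
rewrite mulrA !mulr_sumr -!big_split; apply: eq_bigr => i _ /=.
by rewrite /wt /rho_wt rmorphXn /=; ring.
Qed.

(** The term in [r^2] is the same for all partitions; by independence the terms in [r] agree, and
    equal [colweight] decides between comparable partitions. *)
Lemma wt_sq_inj mu lam : dominated mu lam -> wt_sq mu = wt_sq lam -> mu = lam.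
Proof.
move=> dom; rewrite !wt_sqE => /addIr /eqP e.
apply: colweight_inj => //.
have [] := generic (a := \sum_i (mu i)%:Z ^+ 2 - \sum_i (lam i)%:Z ^+ 2)
  (b := (2 * colweight mu)%N%:Z - (2 * colweight lam)%N%:Z).
  rewrite !rmorphB mulrBr addrACA -opprD; apply/eqP; rewrite subr_eq0; exact: e.
by move=> _ /subr0_eq [] /eqP; rewrite eqn_pmul2l // => /eqP.
Qed.

End LaplaceOperator.

(** * Jack polynomials as joint eigenvectors *)

Section JackParameter.

Lemma alpha_neq0 : alpha != 0.
Proof. by rewrite /alpha tofrac_eq0 polyX_eq0. Qed.

Lemma rr_generic (a b : int) : a%:~R + rr * b%:~R = 0 -> a = 0 /\ b = 0.
Proof.
move=> /(congr1 (fun x => alpha * x)); rewrite mulr0 mulrDr mulrA divff ?alpha_neq0 // mul1r.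
have -> : alpha * a%:~R + b%:~R = tofrac ('X * a%:~R + b%:~R : {poly rat}).
  by rewrite /alpha rmorphD rmorphM /= !rmorph_int.
move/eqP; rewrite tofrac_eq0 -!(rmorph_int (@polyC rat)) => /eqP e.
(* After multiplication by [alpha] the relation reads [a X + b = 0] in [{poly rat}]. *)
have := congr1 (coefp 0) e; have := congr1 (coefp 1) e.
rewrite /coefp /= !coefD !coefXM !coefC /= ?coef0 add0r addr0.
by move=> /eqP; rewrite intr_eq0 => /eqP -> /eqP; rewrite intr_eq0 => /eqP ->.
Qed.

End JackParameter.

Lemma sub_eq_mul_div (K : fieldType) (a b x : K) : x != 0 -> a - b = x * (a / x + b / - x).
Proof. by move=> x0; rewrite invrN mulrN -mulrBl mulrC divfK. Qed.

Lemma half_add (K : fieldType) (x : K) : 2%:R != 0 :> K -> x / 2%:R + x / 2%:R = x.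
Proof. by move=> two; rewrite -mulrDl -mulr2n -(mulr_natr x) mulfK. Qed.

HB.lock Definition njack (n : nat) (lam : 'X_{1..n}) := (at_ones (jack lam))^-1 *: jack lam.

Section JackPolynomials.
Variable n : nat.
Implicit Types (i j : 'I_n.+1) (lam mu eta : 'X_{1..n.+1}) (p q : {mpoly FF[n.+1]}).

Local Notation char0 := (generic_char0 rr_generic).
Local Notation wt := (wt rr).
Local Notation joint := (joint rr).

Lemma tofrac_sum (I : Type) (s : seq I) (P : pred I) (f : I -> {mpoly FF[n.+1]}) :
  tofrac (\sum_(a <- s | P a) f a) = \sum_(a <- s | P a) tofrac (f a).
Proof. exact: raddf_sum. Qed.

(** For symmetric [p], [dd i j] applied to [x_i^2 p_i] combines the fractions of index [(i, j)] and
    [(j, i)]. Summing over all pairs counts each fraction twice, which the factor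
    [alpha / 2 * r = 1 / 2] compensates. *)
Lemma D_op_symmetric p : p \is symmetric ->
  D_op p = tofrac ((alpha / 2%:R) *: (cher_sq rr p - euler p
    - (rr ^+ 2 * \sum_(i < n.+1) (n - i)%:R ^+ 2) *: p)).
Proof.
move=> sp; pose h i := 'X_i ^+ 2 * p^`M(i); pose W := \sum_i \sum_j dd i j (h i).
rewrite (cher_sq_symmetric rr sp) addrAC addrK addrAC addrK.
have two0 : 2%:R != 0 :> FF := char0 1.
rewrite scalerDr [X in _ + X]scalerA tofracD.
congr (_ + _); first by rewrite scaler_sumr tofrac_sum.
have trh i j : msym (tperm i j) (h i) = h j.
  by rewrite /h rmorphM rmorphXn /= msymXU msym_mderiv tpermL (issymP _ sp).
pose T i j := tofrac (h i) / tofrac ('X_i - 'X_j).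
set S := \sum_(i < n.+1) _.
have SE : S = \sum_i \sum_(j | i != j) T i j.
  apply: eq_bigr => i _; apply: eq_bigr => j _.
  by rewrite mulrAC -tofracM.
have WE : tofrac W = S + S.
  rewrite {2}SE (exchange_big_dep predT) //= SE -big_split /W tofrac_sum.
  apply: eq_bigr => i _ /=; rewrite tofrac_sum (bigD1 i) //= dd_id raddf0 add0r.
  rewrite (eq_bigl (fun j => i != j)) => [|j]; last by rewrite eq_sym.
  rewrite [X in _ + X](eq_bigl (fun j => i != j)) => [|j]; last by rewrite eq_sym.
  rewrite -big_split; apply: eq_bigr => j ij /=.
  have X0 : tofrac ('X_i - 'X_j : {mpoly FF[n.+1]}) != 0 by rewrite tofrac_eq0 subX_neq0.
  apply: (mulfI X0); rewrite -tofracM dd_eq trh /T.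
  have -> : tofrac ('X_j - 'X_i) = - tofrac ('X_i - 'X_j : {mpoly FF[n.+1]}).
    by rewrite -tofracN opprB.
  by rewrite tofracB; exact: sub_eq_mul_div.
pose V := (alpha / 2%:R * rr) *: W.
have WV : W = V + V.
  rewrite /V -scalerDl -mulrDl half_add //.
  by rewrite /rr divff ?alpha_neq0 // scale1r.
have two0' : 2%:R != 0 :> {fraction {mpoly FF[n.+1]}}.
  by rewrite -(rmorph_nat (@tofrac _)) tofrac_eq0 -mpolyC_nat mpolyC_eq0.
apply: (mulfI two0'); by rewrite !mulr_natl !mulr2n -WE {1}WV tofracD.
Qed.

Lemma mcoeff_msymm mu eta : (msymm mu)@_eta = (perm_eq eta mu)%:R.
Proof.
rewrite /msymm raddf_sum /=; have [e|ne] := boolP (perm_eq eta mu).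
  have dm : (mdeg eta < (mdeg mu).+1)%N by have -> : mdeg eta = mdeg mu by case: (perm_dom e).
  rewrite (bigD1 (BMultinom dm)) //= mcoeffX eqxx big1 ?addr0 // => m /andP[_ mn].
  by rewrite mcoeffX -(inj_eq val_inj) /= in mn *; rewrite (negPf mn).
rewrite big1 // => m pm; rewrite mcoeffX; case: (eqVneq (val m) eta) => // e.
by rewrite -e pm in ne.
Qed.

Lemma msymm_symmetric mu : msymm mu \is symmetric.
Proof.
apply/issymP => s; apply/mpolyP => m; rewrite mcoeff_sym !mcoeff_msymm.
by rewrite (permPl (mnm_perm m s)).
Qed.

Lemma is_jack_symmetric lam p : is_jack lam p -> p \is symmetric.
Proof.
case=> _ [v ->]; apply: rpredD; first exact: msymm_symmetric.
by apply: rpred_sum => mu _; apply: rpredZ; exact: msymm_symmetric.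
Qed.

Lemma is_jack_supp lam p eta : is_part lam -> is_jack lam p -> p@_eta != 0 ->
  exists mu, [/\ is_part mu, dominated mu lam & perm_eq eta mu].
Proof.
move=> pl [_ [v ->]]; rewrite mcoeffD mcoeff_msymm raddf_sum /=.
have [e _|ne] := boolP (perm_eq eta lam).
  by exists lam; split=> //; apply/dominatedP.
rewrite add0r => nz; apply: NNPP => no; case/eqP: nz; apply: big1 => mu /and3P[pm dm _].
rewrite mcoeffZ mcoeff_msymm; have [e|_] := boolP (perm_eq eta mu); last by rewrite mulr0.
by case: no; exists mu.
Qed.

Lemma is_jack_lead lam p : is_part lam -> is_jack lam p -> p@_lam = 1.
Proof.
move=> pl [_ [v ->]]; rewrite mcoeffD mcoeff_msymm perm_refl raddf_sum /=.
rewrite big1 ?addr0 // => mu /and3P[pm _ ne]; rewrite mcoeffZ mcoeff_msymm.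
have [e|_] := boolP (perm_eq lam mu); last by rewrite mulr0.
by case/eqP: ne; apply/esym/perm_part.
Qed.

Lemma is_jack_leads lam p : is_part lam -> is_jack lam p -> leads lam p.
Proof.
move=> pl jp eta he le; have [mu [pm dm em]] := is_jack_supp pl jp he.
have dl : dominated lam mu by apply: dom_le_dominated => //; exact: dom_trans le (perm_dom em).
by rewrite (dominated_anti dl dm); exact: perm_dom.
Qed.

Lemma is_jack_euler lam p : is_part lam -> is_jack lam p -> euler p = (mdeg lam)%:R *: p.
Proof.
move=> pl jp; apply: euler_homog => m /(is_jack_supp pl jp) [mu [_ /dominatedP [<- _]]].
by case/perm_dom.
Qed.

(** The Euler operator acts on [p] as a scalar by homogeneity, so an eigenvector of [D_op] is one of
    [cher_sq]; the coefficient at [lam] identifies the eigenvalue. *)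
Lemma is_jack_cher_sq lam p : is_part lam -> is_jack lam p ->
  cher_sq rr p = wt_sq rr lam *: p.
Proof.
move=> pl jp; have sp := is_jack_symmetric jp; have [[e De] _] := jp.
have two0 : 2%:R != 0 :> FF := char0 1.
have c0 : alpha / 2%:R != 0 :> FF := mulf_neq0 alpha_neq0 (invr_neq0 two0).
have [d dE] : exists d, cher_sq rr p = d *: p.
  move: De; rewrite D_op_symmetric // (is_jack_euler pl jp) => /eqP; rewrite tofrac_eq.
  move=> /eqP /(congr1 (fun q => (alpha / 2%:R)^-1 *: q)).
  rewrite !scalerA mulVf // scale1r => /eqP; rewrite !subr_eq -!scalerDl => /eqP ->.
  by eexists; reflexivity.
rewrite dE; congr (_ *: _); have /(congr1 (mcoeff lam)) := dE.
rewrite mcoeff_cher_sq_lead //; last exact: is_jack_leads.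
by rewrite mcoeffZ (is_jack_lead pl jp) !mulr1.
Qed.

(** A leading partition of [p - q] is dominated by [lam] and has the eigenvalue of [lam], so it is
    [lam]; but there the coefficients 1 cancel. *)
Lemma is_jack_unique lam p q : is_part lam -> is_jack lam p -> is_jack lam q -> p = q.
Proof.
move=> pl jp jq; apply/eqP; rewrite -subr_eq0; apply/negPn/negP => h0.
have [eta he] := exists_mcoeff_neq0 h0.
have sh : p - q \is symmetric by rewrite rpredB // (is_jack_symmetric (lam := lam)).
have [mu [pm hm lm _]] := exists_leads sh he.
have dm : dominated mu lam.
  suff [nu [pn dn en]] : exists nu, [/\ is_part nu, dominated nu lam & perm_eq mu nu].
    by rewrite (perm_part pm pn en).
  have [p0|] := eqVneq p@_mu 0; last exact: is_jack_supp.
  by apply: (is_jack_supp pl jq); move: hm; rewrite mcoeffB p0 sub0r oppr_eq0.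
have ml : mu = lam.
  apply: (wt_sq_inj rr_generic dm); apply: (mulIf hm).
  rewrite -mcoeff_cher_sq_lead // linearB /= (is_jack_cher_sq pl jp) (is_jack_cher_sq pl jq).
  by rewrite -scalerBr mcoeffZ.
by move: hm; rewrite ml mcoeffB (is_jack_lead pl jp) (is_jack_lead pl jq) subrr eqxx.
Qed.

Lemma is_jack_joint lam g : is_part lam -> g \is symmetric ->
  joint (charpoly (wt lam)) g -> g@_lam != 0 -> is_jack lam ((g@_lam)^-1 *: g).
Proof.
move=> pl sg jg gl; set f := _ *: g.
have sf : f \is symmetric by exact: rpredZ.
have jf : joint (charpoly (wt lam)) f by exact: jointZ.
have fl : f@_lam = 1 by rewrite mcoeffZ mulVf.
have dom eta : f@_eta != 0 -> dom_le eta lam.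
  by move=> /(joint_dom rr_generic sf jf) [].
split.
  exists (alpha / 2%:R * (wt_sq rr lam - (mdeg lam)%:R
    - rr ^+ 2 * \sum_(i < n.+1) (n - i)%:R ^+ 2)).
  rewrite D_op_symmetric // (cher_sq_joint rr_generic sf jf).
  rewrite (@euler_homog _ _ (mdeg lam)) => [|m /dom [] //].
  by rewrite -!scalerBl scalerA.
exists (fun mu => f@_mu); apply/mpolyP => eta.
rewrite mcoeffD mcoeff_msymm raddf_sum /=.
have [s ps] := exists_part_perm eta; set mu := [multinom _ | _ < _] in ps.
have emu : perm_eq eta mu by rewrite perm_sym mnm_perm.
have f_eta : f@_eta = f@_mu by rewrite msym_coeff.
have perm_iff nu : is_part nu -> perm_eq eta nu = (nu == mu).
  move=> pn; rewrite (permPl emu); apply/idP/eqP => [e|->]; last exact: perm_refl.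
  exact/esym/perm_part.
rewrite perm_iff // f_eta.
have termE (nu : 'X_{1..n.+1}) : is_part nu -> (f@_nu *: msymm nu)@_eta = f@_nu * (nu == mu)%:R.
  by move=> pn; rewrite mcoeffZ mcoeff_msymm perm_iff.
have [e|ne] := eqVneq lam mu.
  rewrite -e fl big1 ?addr0 // => nu /and3P[pn _ nl].
  by rewrite mcoeffZ mcoeff_msymm perm_iff // -e (negPf nl) mulr0.
rewrite add0r; have [dm|ndm] := boolP (dominated mu lam).
  have dmu : (mdeg mu < (mdeg lam).+1)%N by case/dominatedP: dm => ->.
  rewrite (bigD1 (BMultinom dmu)) /=; last by rewrite ps dm eq_sym.
  rewrite termE // eqxx mulr1 big1 ?addr0 // => nu /andP[/and3P[pn _ _] nm].
  by rewrite termE // -(inj_eq val_inj) /= in nm *; rewrite (negPf nm) mulr0.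
rewrite big1 => [|nu /and3P[pn dn _]].
  apply/eqP; apply: contraNT ndm => fmu; exact: dom_le_dominated (dom _ fmu).
rewrite termE //; case: eqP => [e|_]; last by rewrite mulr0.
by rewrite -e dn in ndm.
Qed.

(** A rescaled joint eigenvector satisfies [is_jack]; uniqueness transfers its properties to the
    polynomial chosen by [epsilon]. *)
Lemma jackP lam : is_part lam -> [/\ jack lam \is symmetric,
  joint (charpoly (wt lam)) (jack lam), (jack lam)@_lam = 1 & ev1 (jack lam) != 0].
Proof.
move=> pl; have [g [sg jg eg]] := exists_joint rr_generic pl.
have g0 : g != 0 by apply: contra_eq_neq eg => ->; rewrite /ev1 meval0 eq_sym oner_eq0.
have [eta he] := exists_mcoeff_neq0 g0.
have [_ gl _] := joint_dom rr_generic sg jg he.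
have jk := is_jack_joint pl sg jg gl.
have jj : is_jack lam (jack lam) by apply: epsilon_spec; exists ((g@_lam)^-1 *: g).
rewrite (is_jack_unique pl jj jk); split.
- exact: rpredZ.
- exact: jointZ.
- by rewrite mcoeffZ mulVf.
by rewrite ev1Z eg mulr1 invr_neq0.
Qed.

Lemma njackE lam : njack lam = (at_ones (jack lam))^-1 *: jack lam.
Proof. by rewrite unlock. Qed.

Lemma njackP lam : is_part lam -> [/\ njack lam \is symmetric,
  joint (charpoly (wt lam)) (njack lam) & ev1 (njack lam) = 1].
Proof.
move=> /jackP [sj jj _ ej]; rewrite njackE; split; [exact: rpredZ | exact: jointZ |].
by rewrite ev1Z mulVf.
Qed.

End JackPolynomials.

(** * Jack binomial coefficients *)

HB.lock Definition translate (n : nat) (p : {mpoly FF[n]}) := shift1 p.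

Section Shift.
Variable n : nat.
Implicit Types (i k : 'I_n.+1) (m : 'X_{1..n.+1}) (p q : {mpoly FF[n.+1]}).

Lemma translateE p : translate p = shift1 p.
Proof. by rewrite unlock. Qed.

Lemma translate_linear : linear (@translate n.+1).
Proof. by move=> c p q; rewrite !translateE /shift1 comp_mpolyD comp_mpolyZ. Qed.

HB.instance Definition _ := GRing.isLinear.Build FF {mpoly FF[n.+1]} {mpoly FF[n.+1]} _
  (@translate n.+1) translate_linear.

Lemma translateD : {morph @translate n.+1 : p q / p + q}.
Proof. exact: linearD. Qed.

Lemma translate_sum (I : Type) (s : seq I) (P : pred I) (f : I -> {mpoly FF[n.+1]}) :
  translate (\sum_(a <- s | P a) f a) = \sum_(a <- s | P a) translate (f a).
Proof. exact: raddf_sum. Qed.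

Lemma translateZ c p : translate (c *: p) = c *: translate p.
Proof. exact: linearZ. Qed.

Lemma translate1 : translate (1 : {mpoly FF[n.+1]}) = 1.
Proof. by rewrite translateE /shift1 comp_mpoly1. Qed.

Lemma translate_mulX i p : translate ('X_i * p) = (1 + 'X_i) * translate p.
Proof. by rewrite !translateE /shift1 rmorphM /= comp_mpolyXU -tnth_nth tnth_mktuple. Qed.

Lemma mderiv_translate i p : (translate p)^`M(i) = translate p^`M(i).
Proof.
elim/mpoly_ind_vars: p => [|c p q IHp IHq|k p IH].
- by rewrite translate1 -mpolyC1 mderivC linear0.
- by rewrite translateD translateZ !mderivD !mderivZ IHp IHq translateD translateZ.
rewrite translate_mulX !mderivM mderivD !mderivXU -mpolyC1 mderivC add0r mpolyC1 IH.
rewrite translateD translate_mulX; case: (i == k); first by rewrite !mul1r.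
by rewrite !mul0r linear0.
Qed.

Definition grad_sum p := \sum_i p^`M(i).

(** The commutation rule behind the factor [|lam| - |mu|]: the Euler operator acts by [|lam|] before
    translation and by [|mu|] on each term after it. *)
Lemma euler_translate p : translate (euler p) = translate (grad_sum p) + euler (translate p).
Proof.
rewrite /euler /grad_sum !translate_sum -big_split; apply: eq_bigr => i _ /=.
by rewrite translate_mulX mderiv_translate mulrDl mul1r.
Qed.

Lemma msize_mulX i p : (msize ('X_i * p) <= (msize p).+1)%N.
Proof.
have [->|p0] := eqVneq p 0; first by rewrite mulr0 msize0.
have X0 : 'X_i != 0 :> {mpoly FF[n.+1]} by rewrite -msize_poly_eq0 msizeX.
by rewrite msizeM // msizeX mdeg1.
Qed.

Lemma translate_low p d : (msize p <= d.+1)%N -> (msize (translate p - p) <= d)%N.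
Proof.
have XP m : (msize (translate 'X_[m] - 'X_[m] : {mpoly FF[n.+1]}) <= mdeg m)%N.
  have [e] := ubnP (mdeg m); elim: e m => // e IH m me.
  have [->|nz] := eqVneq m 0%MM.
    by rewrite mpolyX0 translate1 subrr msize0.
  have [i mi] := mnm_neq0P nz.
  have le : (U_(i) <= m)%MM by rewrite lep1mP.
  move: me; rewrite -(submK le) addmC; set m' := (m - _)%MM.
  rewrite mdegD mdeg1 add1n => /IH le'; rewrite mpolyXD translate_mulX.
  set D := translate _ - _ in le'.
  have -> : (1 + 'X_i) * translate 'X_[m'] - 'X_i * 'X_[m'] = 'X_i * D + (D + 'X_[m']).
    by rewrite /D; ring.
  apply: leq_trans (msizeD_le _ _) _; rewrite geq_max.
  rewrite (leq_trans (msize_mulX _ _)) //=.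
  apply: leq_trans (msizeD_le _ _) _; rewrite geq_max msizeX leqnn andbT.
  exact: leqW.
move=> pd; rewrite {2}(mpolyE p) {1}(mpolyE p) translate_sum -sumrB.
apply: leq_trans (msize_sum _ _ _) _; apply/bigmax_leqP_seq => m mp _.
rewrite translateZ -scalerBr; apply: leq_trans (msizeZ_le _ _) _; apply: leq_trans (XP m) _.
by rewrite -ltnS; apply: leq_trans (msize_mdeg_lt mp) pd.
Qed.

Lemma mcoeff_translate_top p m : (msize p <= (mdeg m).+1)%N -> (translate p)@_m = p@_m.
Proof.
move=> /translate_low low; apply/eqP; rewrite -subr_eq0 -mcoeffB.
by rewrite mcoeff_eq0; apply: msize_mdeg_ge.
Qed.

Lemma big_bmnm_widen (V : nmodType) (d D : nat) (P : pred 'X_{1..n.+1}) (f : 'X_{1..n.+1} -> V) :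
  (d <= D)%N -> (forall m, P m -> (d <= mdeg m)%N -> f m = 0) ->
  \sum_(m : 'X_{1..n.+1 < D} | P m) f m = \sum_(m : 'X_{1..n.+1 < d} | P m) f m.
Proof.
move=> dD f0; rewrite (bigID (fun m : 'X_{1..n.+1 < D} => (mdeg m < d)%N)) /=.
rewrite [X in _ + X]big1 ?addr0 => [|m /andP[Pm]]; last by rewrite -leqNgt; apply: f0.
pose h (m : 'X_{1..n.+1 < d}) : 'X_{1..n.+1 < D} := BMultinom (leq_trans (bmdeg m) dD).
rewrite (reindex_omap h (fun m : 'X_{1..n.+1 < D} => insub (bmnm m))) /= => [|m /andP[_ md]].
  apply: eq_bigl => m; rewrite bmdeg andbT; case: (P m) => //=.
  have -> : insub (bmnm m) = Some m; last exact: eqxx.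
  by rewrite insubT ?bmdeg // => lt; congr Some; apply: val_inj.
by rewrite insubT /=; congr Some; apply: val_inj.
Qed.

End Shift.

(** * The recurrence for the binomial coefficients *)

Section Expansion.
Variable n : nat.
Implicit Types (i j k : 'I_n.+1) (lam mu nu : 'X_{1..n.+1}) (p q : {mpoly FF[n.+1]}).

Local Notation wt := (wt rr).

(** Subtraction truncates: on an empty row [lam - U_(i)] is [lam] itself, which the first test
    excludes. *)
Definition removable lam i := (lam i != 0%N) && is_part (lam - U_(i))%MM.

Definition pieri lam i : FF :=
  wt lam i * \prod_(j | j != i) ((wt lam i - wt lam j - rr) / (wt lam i - wt lam j)).

Lemma wt_subU lam i :
  charpoly (fun j => wt lam j + (-1) *+ (j == i)) =
  charpoly (rho_wt rr (fun j => (lam j)%:Z - (j == i)%:Z)).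
Proof.
apply: eq_charpoly => j; rewrite /wt /rho_wt rmorphB /= addrAC; congr (_ + _ + _).
by rewrite -mulNrn; case: (j == i).
Qed.

Lemma grad_sum_njack lam : is_part lam ->
  grad_sum (njack lam) = \sum_(i | removable lam i) pieri lam i *: njack (lam - U_(i))%MM.
Proof.
move=> pl; have [sj jj ej] := njackP pl.
have [g [gE gP]] := sum_mderiv_joint (generic_char0 rr_generic) (generic_neq0 rr_generic)
  (rho_wt_inj rr_generic (z := fun i => (lam i)%:Z)) sj jj.
rewrite /grad_sum gE [RHS]big_mkcond; apply: eq_bigr => i _ /=.
have [sg jg eg] := gP i; rewrite -/(wt lam) in jg eg.
rewrite wt_subU in jg.
(* The spectrum of [g i] is that of [lam] with row [i] lowered; by [joint_lead] it belongs to a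
   partition as soon as [g i] is nonzero. *)
have keyP : g i != 0 -> removable lam i.
  move=> g0; have [eta he] := exists_mcoeff_neq0 g0.
  have [mu [pm _ _ e]] := joint_lead rr_generic sg he jg.
  have li : lam i != 0%N by have := e i; rewrite eqxx; case: (lam i).
  rewrite /removable li (_ : (lam - U_(i))%MM = mu) //.
  apply/mnmP => j; rewrite mnmBE mnm1E; have := e j; rewrite eq_sym.
  by case: (eqVneq i j) li => [<-|_] /=; lia.
case: ifPn => [rem|nrem]; last first.
  by apply/eqP; apply: contraNT nrem => /keyP.
have /andP[li pm] := rem; have [sn jn en] := njackP pm.
rewrite (joint_ev1 rr_generic (lam := (lam - U_(i))%MM) _ jn sg sn en).
  by rewrite eg ej mulr1 /pieri.
suff -> : charpoly (wt (lam - U_(i))%MM) = charpoly (rho_wt rr (fun j => (lam j)%:Z - (j == i)%:Z)).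
  by [].
apply: eq_charpoly => j; rewrite /wt /rho_wt mnmBE mnm1E; congr (_%:~R + _).
by rewrite eq_sym; case: (eqVneq i j) li => [<-|_] /=; lia.
Qed.

Lemma njack_dom lam eta : is_part lam -> (njack lam)@_eta != 0 -> dom_le eta lam.
Proof.
move=> pl he; have [sn jn _] := njackP pl.
by have [] := joint_dom rr_generic sn jn he.
Qed.

Lemma njack_lead_neq0 lam : is_part lam -> (njack lam)@_lam != 0.
Proof.
move=> pl; have [_ _ jl ej] := jackP pl.
by rewrite njackE mcoeffZ jl mulr1 invr_neq0.
Qed.

(** Among the partitions with nonzero coefficient take one of largest [colweight]: no other term
    contains its monomial. *)
Lemma njack_free d (c : 'X_{1..n.+1} -> FF) :
  \sum_(mu : 'X_{1..n.+1 < d} | is_part mu) c mu *: njack mu = 0 ->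
  forall mu, is_part mu -> (mdeg mu < d)%N -> c mu = 0.
Proof.
move=> sum0 mu0 pm0 d0; apply/eqP/negPn/negP => c0.
pose P (m : 'X_{1..n.+1 < d}) := is_part m && (c m != 0).
have P0 : P (BMultinom d0) by rewrite /P pm0 c0.
case: (arg_maxnP (fun m : 'X_{1..n.+1 < d} => colweight m) P0) => mu /andP[pm cm] max_mu.
have /(congr1 (mcoeff mu)) := sum0; rewrite mcoeff0 raddf_sum /= (bigD1 mu) //= big1.
  rewrite addr0 mcoeffZ => /eqP; rewrite mulf_eq0 (negPf cm) /=.
  by rewrite (negPf (njack_lead_neq0 pm)).
move=> nu /andP[pn nm]; rewrite mcoeffZ.
have [->|cn] := eqVneq (c nu) 0; first by rewrite mul0r.
have [->|jn] := eqVneq (njack nu)@_mu 0; first by rewrite mulr0.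
case/eqP: nm; apply: val_inj => /=.
have dom : dominated mu nu by apply: dom_le_dominated => //; exact: njack_dom jn.
have cw : (colweight mu <= colweight nu)%N.
  rewrite -(leq_add2r (mdeg mu)) {2}(_ : mdeg mu = mdeg nu); last by case/dominatedP: dom.
  by rewrite -!sum_psum; apply: leq_sum => k _; case/dominatedP: dom.
apply/esym/colweight_inj => //; apply/eqP; rewrite eqn_leq cw /=.
by apply: max_mu; rewrite /P pn cn.
Qed.

Definition is_expansion lam d (b : 'X_{1..n.+1} -> FF) :=
  (forall mu, is_part mu -> (d <= mdeg mu)%N -> b mu = 0) /\
  translate (njack lam) = \sum_(mu : 'X_{1..n.+1 < d} | is_part mu) b mu *: njack mu.

Lemma is_jack_binomialE lam b : is_jack_binomial lam b <-> exists d, is_expansion lam d b.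
Proof.
have E (mu : 'X_{1..n.+1}) : (at_ones (jack mu))^-1 *: jack mu = njack mu by rewrite njackE.
have S : (at_ones (jack lam))^-1 *: shift1 (jack lam) = translate (njack lam).
  by rewrite njackE translateZ translateE.
by split=> - [d [b0 e]]; exists d; split=> //; [rewrite -S e | rewrite S e];
  apply: eq_bigr => mu _; rewrite E.
Qed.

Lemma is_expansion_widen lam d D b : (d <= D)%N -> is_expansion lam d b -> is_expansion lam D b.
Proof.
move=> dD [b0 e]; split=> [mu pm Dm|]; first by apply: b0 => //; exact: leq_trans Dm.
rewrite e; apply: esym.
apply: (@big_bmnm_widen n _ d D (@is_part n.+1) (fun mu => b mu *: njack mu)) => // mu pm dm.
by rewrite b0 ?scale0r.
Qed.

Lemma is_expansion_unique lam b b' mu : is_jack_binomial lam b -> is_jack_binomial lam b' ->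
  is_part mu -> b mu = b' mu.
Proof.
move=> /is_jack_binomialE [d e] /is_jack_binomialE [d' e'] pm.
pose D := maxn (maxn d d') (mdeg mu).+1.
have [_ E] := is_expansion_widen (D := D) (leq_trans (leq_maxl _ _) (leq_maxl _ _)) e.
have [_ E'] := is_expansion_widen (D := D) (leq_trans (leq_maxr _ _) (leq_maxl _ _)) e'.
apply/eqP; rewrite -subr_eq0; apply/eqP.
apply: (@njack_free D (fun mu => b mu - b' mu)) => //; last exact: leq_maxr.
under eq_bigr do rewrite scalerBl.
by rewrite sumrB -E -E' subrr.
Qed.

(** In degree [|lam|] the recurrence would divide by 0. The values there come from translation
    preserving the component of top degree. *)
Definition binomial_step (jb : 'X_{1..n.+1} -> 'X_{1..n.+1} -> FF) lam mu : FF :=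
  if mdeg mu == mdeg lam then (mu == lam)%:R else
  ((mdeg lam)%:R - (mdeg mu)%:R)^-1
    * \sum_(i | removable lam i) pieri lam i * jb (lam - U_(i))%MM mu.

Lemma mdeg_subU lam i : lam i != 0%N -> mdeg lam = (mdeg (lam - U_(i))%MM).+1.
Proof. by move=> li; rewrite -{1}(@submK _ U_(i)%MM lam) ?lep1mP // mdegD mdeg1 addn1. Qed.

Lemma natr_sub_neq0 (a b : nat) : a != b -> a%:R - b%:R != 0 :> FF.
Proof.
move=> ab; apply/eqP => e; have [] := rr_generic (a := a%:Z - b%:Z) (b := 0).
  by rewrite mulr0 addr0 rmorphB.
by move=> /subr0_eq [] /eqP; rewrite (negPf ab).
Qed.

(** The recurrence defines a candidate, and the candidate is verified. The error [Z] is an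
    eigenvector of the Euler operator for [|lam|], hence homogeneous of that degree, and in top
    degree translation changes nothing, so [Z] vanishes there too. *)
Lemma binomial_step_expansion lam jb : is_part lam ->
  (forall i, removable lam i -> is_expansion (lam - U_(i))%MM (mdeg lam) (jb (lam - U_(i))%MM)) ->
  is_expansion lam (mdeg lam).+1 (binomial_step jb lam).
Proof.
move=> pl IH; set b := binomial_step jb lam; split=> [mu pm dm|].
  rewrite /b /binomial_step gtn_eqF // big1 ?mulr0 // => i /IH [b0 _].
  by rewrite b0 ?mulr0 // ltnW.
set T := \sum_(mu | _) _.
pose Z := translate (njack lam) - T; suff Z0 : Z = 0 by apply/eqP; rewrite -subr_eq0; apply/eqP.
have hom nu : is_part nu -> euler (njack nu) = (mdeg nu)%:R *: njack nu.
  by move=> pn; apply: euler_homog => m /(njack_dom pn) [].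
have eulerS : euler (translate (njack lam)) = (mdeg lam)%:R *: translate (njack lam)
    - \sum_(mu : 'X_{1..n.+1 < (mdeg lam).+1} | is_part mu)
        (\sum_(i | removable lam i) pieri lam i * jb (lam - U_(i))%MM mu) *: njack mu.
  have := euler_translate (njack lam); rewrite hom // translateZ grad_sum_njack // addrC => ->.
  rewrite -[LHS](addrK
    (\sum_(i | removable lam i) pieri lam i *: translate (njack (lam - U_(i))%MM))).
  rewrite translate_sum; congr (_ + _ - _); last first.
    transitivity (\sum_(i | removable lam i) \sum_(mu : 'X_{1..n.+1 < (mdeg lam).+1} | is_part mu)
        (pieri lam i * jb (lam - U_(i))%MM mu) *: njack mu); last first.
      by rewrite exchange_big /=; apply: eq_bigr => mu _; rewrite scaler_suml.
    apply: eq_bigr => i /IH /(is_expansion_widen (leqnSn _)) [_ ->].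
    by rewrite scaler_sumr; apply: eq_bigr => mu _; rewrite scalerA.
  by apply: eq_bigr => i _; rewrite translateZ.
have eulerB p q : euler (p - q) = euler p - euler q.
  rewrite /euler -sumrB; apply: eq_bigr => i _. by rewrite mderivB mulrBr.
have eulerT : euler T = (mdeg lam)%:R *: T
    - \sum_(mu : 'X_{1..n.+1 < (mdeg lam).+1} | is_part mu)
        (\sum_(i | removable lam i) pieri lam i * jb (lam - U_(i))%MM mu) *: njack mu.
  have -> : euler T = \sum_(mu : 'X_{1..n.+1 < (mdeg lam).+1} | is_part mu)
      ((mdeg mu)%:R * b mu) *: njack mu.
    rewrite /euler; under eq_bigr do rewrite /T raddf_sum mulr_sumr.
    rewrite exchange_big /=; apply: eq_bigr => mu pm.
    rewrite mulrC -scalerA -hom // scaler_sumr.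
    by apply: eq_bigr => i _; rewrite mderivZ scalerAr.
  rewrite scaler_sumr -sumrB; apply: eq_bigr => mu pm.
  rewrite scalerA -scalerBl; congr (_ *: _); rewrite /b /binomial_step.
  have [e|ne] := eqVneq (mdeg mu) (mdeg lam).
    rewrite e big1 ?subr0 // => i /IH [b0 _]; by rewrite b0 ?mulr0 // e.
  have nz : (mdeg lam)%:R - (mdeg mu)%:R != 0 :> FF by rewrite natr_sub_neq0 // eq_sym.
  by rewrite -[X in _ = _ - X](mulVKf nz) -mulrBl subKr.
have eulerZ : euler Z = (mdeg lam)%:R *: Z.
  by rewrite eulerB eulerS eulerT opprB addrA subrK scalerBr.
apply/mpolyP => m; rewrite mcoeff0.
have [e|ne] := eqVneq (mdeg m) (mdeg lam); last first.
  have /(congr1 (mcoeff m)) := eulerZ; rewrite euler_coeff mcoeffZ => /eqP.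
  rewrite -subr_eq0 -mulrBl mulf_eq0 => /orP[/eqP z|/eqP //].
  by have := natr_sub_neq0 ne; rewrite z eqxx.
have degle nu : is_part nu -> (mdeg nu <= mdeg m)%N -> (msize (njack nu) <= (mdeg m).+1)%N.
  move=> pn le; rewrite msizeE; apply/bigmax_leqP_seq => eta; rewrite mcoeff_msupp => he _.
  by have [-> _] := njack_dom pn he.
have dlam : (mdeg lam < (mdeg lam).+1)%N by [].
rewrite mcoeffB mcoeff_translate_top; last by rewrite degle // e.
rewrite /T raddf_sum (bigD1 (BMultinom dlam)) //= big1 => [|mu /andP[pm mnl]].
  by rewrite addr0 mcoeffZ /b /binomial_step !eqxx mul1r subrr.
rewrite mcoeffZ; have [em|nem] := eqVneq (mdeg mu) (mdeg lam).
  rewrite /b /binomial_step em eqxx.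
  by rewrite -(inj_eq val_inj) /= in mnl; rewrite (negPf mnl) mul0r.
have [->|jm] := eqVneq (njack mu)@_m 0; first by rewrite mulr0.
by have [d _] := njack_dom pm jm; rewrite -d e eqxx in nem.
Qed.

Lemma jack_binomialP lam : is_part lam ->
  is_expansion lam (mdeg lam).+1 (@jack_binomial n.+1 lam).
Proof.
have [d] := ubnP (mdeg lam); elim: d lam => // d IH lam ld pl.
have E : is_expansion lam (mdeg lam).+1 (binomial_step (@jack_binomial n.+1) lam).
  apply: binomial_step_expansion => // i /andP[li pm].
  by rewrite (mdeg_subU li); apply: IH => //; rewrite -ltnS -mdeg_subU.
have J' : is_jack_binomial lam (binomial_step (@jack_binomial n.+1) lam).
  apply/is_jack_binomialE; exists (mdeg lam).+1; exact: E.
have J : is_jack_binomial lam (jack_binomial lam).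
  exact: epsilon_spec (ex_intro _ _ J').
have eqb mu : is_part mu -> jack_binomial lam mu = binomial_step (@jack_binomial n.+1) lam mu.
  exact: is_expansion_unique J J'.
split=> [mu pm dm|]; first by rewrite eqb //; case: E => ->.
case: E => _ ->; apply: eq_bigr => mu pm; by rewrite eqb.
Qed.

Lemma jack_binomial_rec lam mu : is_part lam -> is_part mu ->
  jack_binomial lam mu = binomial_step (@jack_binomial n.+1) lam mu.
Proof.
move=> pl pm; have J : is_jack_binomial lam (jack_binomial lam).
  apply/is_jack_binomialE; exists (mdeg lam).+1; exact: jack_binomialP.
apply: (is_expansion_unique J _ pm); apply/is_jack_binomialE; exists (mdeg lam).+1.
apply: binomial_step_expansion => // i /andP[li pi].
by rewrite (mdeg_subU li); exact: jack_binomialP.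
Qed.

End Expansion.

(** * Hooks, stems and leaves *)

Section HookFactors.
Variables (F : fieldType) (r : F).
Hypothesis generic : forall a b : int, a%:~R + r * b%:~R = 0 -> a = 0 /\ b = 0.
Implicit Types (l m v lc mc vc i j : nat).

Lemma generic_neq0l (a b : int) : a != 0 -> a%:~R + r * b%:~R != 0.
Proof. by move=> a0; apply/eqP => /generic [a0' _]; rewrite a0' in a0. Qed.

Lemma generic_neq0r (a b : int) : b != 0 -> a%:~R + r * b%:~R != 0.
Proof. by move=> b0; apply/eqP => /generic [_ b0']; rewrite b0' in b0. Qed.

Definition hook_val l lc i j : F := (l - j.+1)%:R + r * (lc - i.+1)%:R + r.
Definition hook'_val l lc i j : F := (l - j.+1)%:R + r * (lc - i.+1)%:R + 1.

Lemma hook_val_neq0 l lc i j : hook_val l lc i j != 0.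
Proof.
have := @generic_neq0r (l - j.+1)%N%:Z (lc - i.+1).+1%:Z isT.
rewrite /hook_val -addrA -[X in _ + (_ + X)]mulr1 -mulrDr -[1]/(1%:R) -natrD addn1.
exact.
Qed.

Lemma hook'_val_neq0 l lc i j : hook'_val l lc i j != 0.
Proof.
have := @generic_neq0l (l - j.+1).+1%:Z (lc - i.+1)%N%:Z isT.
by rewrite /hook'_val addrAC [_%:R + 1]natr1.
Qed.

(* The contribution to the stem of the box in row [i] and column [j], the rows of [lam]
   and [mu] having lengths [l] and [m], and their columns [lc] and [mc]. *)
Definition stem_factor l m lc mc i j : F :=
  if (j < m)%N then
    (if (m == l) && (mc < lc)%N then hook_val l lc i j / hook_val m mc i j else 1) *
    (if (m < l)%N && (mc == lc) then hook'_val l lc i j / hook'_val m mc i j else 1) *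
    (if (m < l)%N && (mc < lc)%N then (hook_val m mc i j * hook'_val m mc i j)^-1 else 1)
  else 1.

Lemma stem_factor_neq0 l m lc mc i j : stem_factor l m lc mc i j != 0.
Proof.
rewrite /stem_factor; case: ifP => _; last exact: oner_neq0.
by rewrite !mulf_neq0 //; case: ifP => _; rewrite ?oner_neq0 // ?invr_neq0 ?mulf_neq0
  ?invr_neq0 ?hook_val_neq0 ?hook'_val_neq0.
Qed.

Lemma stem_factor_row m lc mc i j : (mc <= lc)%N -> (j < m)%N ->
  stem_factor m m lc mc i j = hook_val m lc i j / hook_val m mc i j.
Proof.
move=> le jm; rewrite /stem_factor jm eqxx ltnn /= !mulr1; case: ltnP => // ge.
have -> : mc = lc by apply/eqP; rewrite eqn_leq le ge.
by rewrite divff // hook_val_neq0.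
Qed.

Lemma stem_factor_col l m mc i j : (m <= l)%N -> (j < m)%N ->
  stem_factor l m mc mc i j = hook'_val l mc i j / hook'_val m mc i j.
Proof.
move=> le jm; rewrite /stem_factor jm eqxx ltnn !andbF !andbT mulr1 mul1r; case: ltnP => // ge.
have -> : m = l by apply/eqP; rewrite eqn_leq le ge.
by rewrite divff // hook'_val_neq0.
Qed.

Lemma stem_factor_out l m lc mc i j : (m <= j)%N -> stem_factor l m lc mc i j = 1.
Proof. by rewrite leqNgt /stem_factor => /negPf ->. Qed.

(* Only the boxes whose row and column both meet the skew diagram contribute to
   [stem lam nu * stem nu mu / stem lam mu]. *)
Lemma stem_factor_unmodified l v m lc vc mc i j :
  (m <= v <= l)%N -> (mc <= vc <= lc)%N -> ((m <= j < v)%N -> (mc < vc)%N) ->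
  (l == m) || (lc == mc) ->
  stem_factor l v lc vc i j * stem_factor v m vc mc i j = stem_factor l m lc mc i j.
Proof.
move=> /andP[mv vl] /andP[mcv vlc] box /orP[/eqP lm|/eqP lcm].
  have vm : v = m by lia.
  rewrite lm vm in vl *; case: (ltnP j m) => jm; last by rewrite !stem_factor_out ?mulr1.
  rewrite !stem_factor_row //; last exact: leq_trans vlc.
  by rewrite mulrA divfK // hook_val_neq0.
have vcm : vc = mc by lia.
rewrite lcm vcm in vlc *; case: (ltnP j m) => jm.
  rewrite !stem_factor_col //; [|exact: leq_trans vl|exact: leq_trans mv].
  by rewrite mulrA divfK // hook'_val_neq0.
have vj : (v <= j)%N.
  by rewrite leqNgt; apply/negP => jv; have := box; rewrite jm jv vcm ltnn => /(_ isT).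
by rewrite !stem_factor_out ?mulr1.
Qed.

Lemma telescope_hooks (A x : nat) (z : int) : (x < A)%N ->
  \prod_(t < x) ((A%:R - t%:R + r * z%:~R) / (A%:R - 1 - t%:R + r * z%:~R))
  = (A%:R + r * z%:~R) / (A%:R - x%:R + r * z%:~R).
Proof.
have nz (y : nat) : (y < A)%N -> A%:R - y%:R + r * z%:~R != 0.
  move=> yA; have := @generic_neq0l (A%:Z - y%:Z) z; rewrite rmorphB /=; apply.
  by rewrite subr_eq0 eqz_nat gtn_eqF.
elim: x => [|x IH] xA.
  by have := nz 0%N xA; rewrite big_ord0 mulr0n subr0 => n0; rewrite divff.
rewrite big_ord_recr IH /=; last exact: ltnW.
rewrite mulrA divfK ?nz 1?ltnW //; congr (_ / _).
by rewrite -[x.+1%:R]natr1; ring.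
Qed.

(** With [A] the length of the row of the corner and [l q] the rows below, the left side is the
    product of the ratios of [hook'] along that row, and the right side gathers the weight of the
    row and its Pieri factors with the lower rows. Induction on the number of lower rows. *)
Lemma arm_product (A m : nat) (l : nat -> nat) :
  (forall p q, (p <= q)%N -> (l q <= l p)%N) -> (forall q, (q < m)%N -> (l q < A)%N) -> (0 < A)%N ->
  \prod_(t < A.-1) ((A%:R - t%:R + r * (\sum_(q < m) (t < l q))%N%:R)
                    / (A%:R - 1 - t%:R + r * (\sum_(q < m) (t < l q))%N%:R))
  = (A%:R + r * m%:R) *
    \prod_(q < m) ((A%:R - (l q)%:R + r * q%:R) / (A%:R - (l q)%:R + r * q.+1%:R)).
Proof.
move=> mono lA Apos; elim: m lA => [|m IH] lA.
  rewrite big_ord0 mulr1.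
  under eq_bigr do rewrite big_ord0.
  rewrite (telescope_hooks 0) ?prednK // mulr0 !addr0 -{2}(prednK Apos) -natr1.
  by rewrite addrAC subrr add0r divr1.
rewrite [in RHS]big_ord_recr /=.
have {}IH := IH (fun q qm => lA q (ltnW qm)).
set x := l m; have xA : (x < A)%N by exact: lA.
pose f (k : nat) (t : nat) : F := (A%:R - t%:R + r * k%:R) / (A%:R - 1 - t%:R + r * k%:R).
have nzA (y k : nat) : (y < A)%N -> A%:R - y%:R + r * k%:R != 0.
  move=> yA; have := @generic_neq0l (A%:Z - y%:Z) k; rewrite rmorphB /=; apply.
  by rewrite subr_eq0 eqz_nat gtn_eqF.
have fne (k t : nat) : (t < A.-1)%N -> f k t != 0.
  move=> tA; rewrite /f mulf_neq0 ?invr_neq0 ?nzA //; first by lia.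
  have -> : A%:R - 1 - t%:R = A%:R - t.+1%:R :> F by rewrite -[t.+1%:R]natr1; ring.
  by apply: nzA; lia.
have cS (t : nat) : (\sum_(q < m.+1) (t < l q) = \sum_(q < m) (t < l q) + (t < x))%N.
  by rewrite big_ord_recr.
have full (t : nat) : (t < x)%N -> (\sum_(q < m) (t < l q) = m)%N.
  move=> tx; rewrite (eq_bigr (fun=> 1%N)) ?sum1_card ?card_ord // => q _.
  by rewrite (leq_trans tx) // mono // ltnW.
(* The new row is the shortest, so it raises the leg only in the columns [t < x], and there from [m]
   to [m + 1]; both resulting products telescope. *)
transitivity (\prod_(t < A.-1) f (\sum_(q < m) (t < l q))%N t
  * \prod_(t < A.-1 | (t < x)%N) (f m.+1 t / f m t)).
  rewrite [X in _ * X]big_mkcond -big_split; apply: eq_bigr => t _ /=.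
  rewrite -/(f _ t) cS; case: (boolP (t < x)%N) => [tx|_]; last by rewrite addn0 mulr1.
  by rewrite addn1 full // mulrCA divff ?mulr1 // fne.
rewrite IH -mulrA.
have -> : \prod_(t < A.-1 | (t < x)%N) (f m.+1 t / f m t) = \prod_(t < x) (f m.+1 t / f m t).
  by rewrite (big_ord_widen A.-1 (fun t => f m.+1 t / f m t)) //; lia.
have T (k : nat) : \prod_(t < x) f k t = (A%:R + r * k%:R) / (A%:R - x%:R + r * k%:R).
  exact: (telescope_hooks k xA).
have -> : \prod_(t < x) (f m.+1 t / f m t) = \prod_(t < x) f m.+1 t / \prod_(t < x) f m t.
  by rewrite big_split /= prodfV.
rewrite !T invf_div; set P := \prod_(q < m) _.
have n1 := nzA 0%N m Apos; rewrite mulr0n subr0 in n1.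
have n2 := nzA x m xA; have n3 := nzA x m.+1 xA.
move: (r * m%:R) (r * m.+1%:R) n1 n2 n3 => a b n1 n2 n3.
by field; rewrite n1 n3.
Qed.

End HookFactors.

Lemma big_nat_shift_ord (T : Type) (idx : T) (op : T -> T -> T) (a b : nat) (f : nat -> T) :
  \big[op/idx]_(a.+1 <= x < b.+1) f x = \big[op/idx]_(q < b - a) f (q + a.+1)%N.
Proof. by rewrite -{1}[a.+1]add0n big_addn subSS big_mkord. Qed.

Section Conjugate.
Variable n : nat.
Implicit Types (i k : 'I_n.+1) (lam mu : 'X_{1..n.+1}) (j : nat).

Lemma card_ord_lt (x : nat) : (x <= n.+1)%N -> #|[pred k : 'I_n.+1 | (k < x)%N]| = x.
Proof.
move=> xn; rewrite -sum1_card -(big_ord_widen n.+1 (fun=> 1%N)) //.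
by rewrite sum1_card card_ord.
Qed.

Lemma conj_part_unique lam j x : (x <= n.+1)%N ->
  (forall i, (j < lam i)%N = (i < x)%N) -> conj_part lam j = x.
Proof.
move=> xn H; rewrite /conj_part -[RHS](card_ord_lt xn); apply: eq_card => i.
by rewrite !inE H.
Qed.

Lemma conj_part_le lam j : (conj_part lam j <= n.+1)%N.
Proof. by rewrite -[X in (_ <= X)%N]card_ord; exact: max_card. Qed.

Lemma conj_partP lam i j : is_part lam -> (j < lam i)%N = (i < conj_part lam j)%N.
Proof.
move=> /is_partP pl; have card_i x := @card_ord_lt x.
case: (ltnP j (lam i)) => ji.
  rewrite -[i.+1](card_ord_lt (ltn_ord i)); apply/esym/subset_leq_card.
  by apply/subsetP => k; rewrite !inE ltnS => /pl; exact: leq_trans.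
apply/esym/negbTE; rewrite -leqNgt -[X in (_ <= X)%N](card_ord_lt (ltnW (ltn_ord i))).
apply: subset_leq_card; apply/subsetP => k; rewrite !inE => jk.
by rewrite ltnNge; apply/negP => /pl; rewrite leqNgt (leq_ltn_trans ji jk).
Qed.

Lemma conj_part_mono mu lam j : (mu <= lam)%MM -> (conj_part mu j <= conj_part lam j)%N.
Proof.
move=> /mnm_lepP le; apply: subset_leq_card; apply/subsetP => i; rewrite !inE => /leq_trans.
exact.
Qed.

Lemma conj_part_lt mu lam i j : (mu <= lam)%MM -> (mu i <= j < lam i)%N ->
  (conj_part mu j < conj_part lam j)%N.
Proof.
move=> /mnm_lepP le /andP[mj jl]; apply: proper_card; apply/properP; split.
  by apply/subsetP => k; rewrite !inE => /leq_trans; exact.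
by exists i; rewrite !inE // -leqNgt.
Qed.

End Conjugate.

(** * Pieri coefficients as stems of a single box *)

Section PieriCoefficient.
Variables (n : nat) (F : fieldType) (r : F).
Hypothesis generic : forall a b : int, a%:~R + r * b%:~R = 0 -> a = 0 /\ b = 0.
Implicit Types (i k : 'I_n.+1) (j : nat).

Variables (lam : 'X_{1..n.+1}) (i0 : 'I_n.+1).
Hypotheses (lam_part : is_part lam) (lam_pos : lam i0 != 0%N).
Let nu := (lam - U_(i0))%MM.
Hypothesis nu_part : is_part nu.
Let j0 := (lam i0).-1.

Lemma subU_val i : nu i = (lam i - (i0 == i))%N.
Proof. by rewrite mnmBE mnm1E. Qed.

Lemma conj_corner : conj_part lam j0 = i0.+1.
Proof.
apply: conj_part_unique => // i; rewrite ltnS /j0; case: (leqP i i0) => ii.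
  by have := is_partP _ lam_part _ _ ii; move: lam_pos; lia.
have := is_partP _ nu_part _ _ (ltnW ii); rewrite !subU_val eqxx.
rewrite -(inj_eq val_inj) /= ltn_eqF //= => le; move: lam_pos; lia.
Qed.

Lemma conj_subU_corner : conj_part nu j0 = i0.
Proof.
apply: conj_part_unique => [|i]; first exact: ltnW.
rewrite subU_val /j0 -(inj_eq val_inj) /=; case: (ltngtP i i0) => ii.
- by have := is_partP _ lam_part _ _ (ltnW ii); move: lam_pos; lia.
- have := is_partP _ nu_part _ _ (ltnW ii); rewrite !subU_val eqxx -(inj_eq val_inj) /= ltn_eqF //.
  by move: lam_pos; lia.
by have -> : i = i0 by [apply: val_inj]; move: lam_pos; lia.
Qed.

Lemma conj_subU_other j : j != j0 -> conj_part nu j = conj_part lam j.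
Proof.
move=> jj; apply: eq_card => i; rewrite !inE subU_val.
by move: jj lam_pos; rewrite /j0; case: (eqVneq i0 i) => [<-|_] /=; lia.
Qed.

Local Notation sf i j := (stem_factor r (lam i) (nu i) (conj_part lam j) (conj_part nu j) i j).

Lemma stem_factor_id l c i j : stem_factor r l l c c i j = 1.
Proof. by rewrite /stem_factor !ltnn /= !andbF !mulr1; case: ifP. Qed.

(** Removing the corner changes only the column [j0]; its boxes above the corner are those of type
    [C], and the rows below the corner do not reach it. *)
Lemma pieri_row_other N i : (j0 < N)%N -> i != i0 ->
  \prod_(j < N) sf i j =
  if (i < i0)%N then hook_val r (lam i) i0.+1 i j0 / hook_val r (lam i) i0 i j0 else 1.
Proof.
move=> jN ii; have nui : nu i = lam i by rewrite subU_val eq_sym (negPf ii) subn0.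
rewrite (bigD1 (Ordinal jN)) //= big1 ?mulr1 => [|j jj]; last first.
  by rewrite conj_subU_other ?nui ?stem_factor_id.
have e : (j0 < lam i)%N = (i < i0)%N.
  by rewrite conj_partP // conj_corner ltnS [RHS]ltn_neqAle (inj_eq (@ord_inj _)) ii.
rewrite conj_corner conj_subU_corner nui -e; case: ifP => jl.
  by rewrite stem_factor_row.
by rewrite stem_factor_out // leqNgt jl.
Qed.

Lemma pieri_row N : (j0 < N)%N ->
  \prod_(j < N) sf i0 j =
  \prod_(j < j0) (hook'_val r (lam i0) (conj_part lam j) i0 j
                  / hook'_val r j0 (conj_part lam j) i0 j).
Proof.
move=> jN; have nui : nu i0 = j0 by rewrite subU_val eqxx subn1.
rewrite (big_ord_widen N (fun j => hook'_val r (lam i0) (conj_part lam j) i0 j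
                  / hook'_val r j0 (conj_part lam j) i0 j) (ltnW jN)).
rewrite [RHS]big_mkcond; apply: eq_bigr => j _ /=; rewrite nui.
case: ltnP => jj; last by rewrite stem_factor_out.
rewrite conj_subU_other ?ltn_eqF // stem_factor_col //.
by rewrite /j0 leq_pred.
Qed.

Definition pieri_coef : F :=
  wt r lam i0 * \prod_(k | k != i0) ((wt r lam i0 - wt r lam k - r) / (wt r lam i0 - wt r lam k)).

Lemma natr_nN k k' : (k <= k')%N -> (n - k)%:R - (n - k')%:R = (k' - k)%:R :> F.
Proof.
move=> kk; have kn := ltn_ord k'; rewrite !natrB //; first by ring.
by apply: leq_trans kk _.
Qed.

(** Up to sign the differences of weights are the hooks of the box of row [k] in the column of the
    corner, and the signs cancel in the quotient. *)
Lemma pieri_above k : (k < i0)%N ->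
  (wt r lam i0 - wt r lam k - r) / (wt r lam i0 - wt r lam k)
  = hook_val r (lam k) i0.+1 k j0 / hook_val r (lam k) i0 k j0.
Proof.
move=> ki; have le := is_partP _ lam_part _ _ (ltnW ki).
have j0S : j0.+1 = lam i0 by rewrite /j0 prednK // lt0n.
have E : wt r lam i0 - wt r lam k = - ((lam k - lam i0)%:R + r * (i0 - k)%:R).
  rewrite /wt /rho_wt (natrB _ le) -(natr_nN (ltnW ki)).
  by rewrite -![(Posz _)%:~R]/(_%:R); ring.
rewrite E -opprD invrN mulrNN /hook_val j0S subSS; congr (_ / _).
by rewrite -addrA -[X in r * _ + X]mulr1 -mulrDr -[1]/(1%:R) -natrD; congr (_ + r * _%:R); lia.
Qed.

Lemma conj_tail t : (t < lam i0)%N -> (conj_part lam t - i0.+1)%N =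
  (\sum_(q < n - i0) (t < nth 0%N lam (q + i0.+1)))%N.
Proof.
move=> tl.
have -> : conj_part lam t = (\sum_(0 <= x < n.+1) (t < nth 0%N lam x))%N.
  rewrite big_mkord /conj_part -sum1_card big_mkcond; apply: eq_bigr => i _.
  by rewrite inE (mnm_nth 0%N); case: ltnP.
have le : (i0.+1 <= n.+1)%N := ltn_ord i0.
rewrite (big_cat_nat (leq0n i0.+1) le) /= [X in (_ + X - _)%N]big_nat_shift_ord.
rewrite [X in (X + _ - _)%N](_ : _ = i0.+1) ?addKn //.
rewrite big_nat_cond (eq_bigr (fun=> 1%N)) => [|x /andP[xi _]].
  by rewrite -big_nat_cond sum_nat_const_nat subn0 muln1.
have {}xi : (x < i0.+1)%N by case/andP: xi.
have xn : (x < n.+1)%N by apply: leq_trans le.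
have le' := is_partP _ lam_part (Ordinal xn) i0 xi.
by rewrite -[nth _ _ _]/(nth 0%N lam (Ordinal xn)) -mnm_nth (leq_trans tl le').
Qed.

(** Rows above the corner match the boxes of type [C], one by one. The lower rows match the boxes of
    type [R] only as a whole, together with the weight of the row, through [arm_product]. *)
Lemma pieri_coefE N : (j0 < N)%N -> pieri_coef = \prod_i \prod_(j < N) sf i j.
Proof.
move=> jN; rewrite (bigD1 i0) //= pieri_row // /pieri_coef.
rewrite (bigID (fun k : 'I_n.+1 => (k < i0)%N)) /= mulrCA mulrC; congr (_ * _).
  (* The rows below the corner, continued by 0 past the last one so that [l] is defined and
     nonincreasing on all of [nat]. *)
  pose A := lam i0; pose l q := nth 0%N lam (q + i0.+1).
  have Apos : (0 < A)%N by rewrite lt0n.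
  have lE q (qn : (q + i0.+1 < n.+1)%N) : l q = lam (Ordinal qn) by rewrite (mnm_nth 0%N).
  have lmono p q : (p <= q)%N -> (l q <= l p)%N.
    move=> pq; case: (ltnP (q + i0.+1) n.+1) => qn; last first.
      by rewrite /l nth_default // size_tuple.
    have pn : (p + i0.+1 < n.+1)%N by apply: leq_ltn_trans qn; rewrite leq_add2r.
    by rewrite !lE (is_partP _ lam_part) //= leq_add2r.
  have lA q : (q < n - i0)%N -> (l q < A)%N.
    move=> qn; have qn' : (q + i0.+1 < n.+1)%N by lia.
    have := is_partP _ nu_part i0 (Ordinal qn'); rewrite lE !subU_val eqxx.
    rewrite -(inj_eq val_inj) /= ltn_eqF; last by lia.
    by move=> /(_ _) H; have := H ltac:(lia); rewrite /A; lia.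
  transitivity ((A%:R + r * (n - i0)%:R) * \prod_(q < n - i0)
      ((A%:R - (l q)%:R + r * q%:R) / (A%:R - (l q)%:R + r * q.+1%:R))).
    congr (_ * _).
    pose G k := (wt r lam i0 - wt r lam k - r) / (wt r lam i0 - wt r lam k).
    transitivity (\prod_(i0.+1 <= x < n.+1) G (inord x)).
      rewrite big_geq_mkord; apply: eq_big => k; last by rewrite inord_val.
      by rewrite -leqNgt ltn_neqAle (inj_eq (@ord_inj _)) eq_sym.
    rewrite big_nat_shift_ord; apply: eq_bigr => q _.
    have qn : (q + i0.+1 < n.+1)%N by have := ltn_ord q; lia.
    have -> : inord (q + i0.+1) = Ordinal qn by apply: val_inj; rewrite /= inordK.
    have E : wt r lam i0 - wt r lam (Ordinal qn) = A%:R - (l q)%:R + r * q.+1%:R.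
      have -> : q.+1%:R = (n - i0)%:R - (n - Ordinal qn)%:R :> F.
        by rewrite natr_nN /=; [congr _%:R; lia | lia].
      by rewrite /wt /rho_wt lE -![(Posz _)%:~R]/(_%:R); ring.
    by rewrite /G E; congr (_ / _); rewrite -[q.+1%:R]natr1; ring.
  rewrite -(arm_product generic lmono lA Apos); apply: eq_bigr => t _.
  have tA : (t.+1 < A)%N by have := ltn_ord t; lia.
  rewrite /hook'_val conj_tail -/A; last exact: ltnW.
  have A1 : (A - t.+1)%:R + 1 = A%:R - t%:R :> F.
    by rewrite natrB ?(ltnW tA) // -[t.+1%:R]natr1; ring.
  have A2 : (j0 - t.+1)%:R + 1 = A%:R - 1 - t%:R :> F.
    rewrite natrB; last by rewrite /j0 -/A; lia.
    have -> : A%:R = j0%:R + 1 :> F by rewrite natr1 /j0 -/A prednK.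
    by rewrite -[t.+1%:R]natr1; ring.
  by rewrite -A1 -A2; congr (_ / _); ring.
rewrite [RHS](bigID (fun k : 'I_n.+1 => (k < i0)%N)) /= [X in _ = _ * X]big1 => [|k /andP[ki nk]].
  rewrite mulr1; apply: eq_bigr => k /andP[ki lt].
  by rewrite pieri_above // pieri_row_other // lt.
by rewrite pieri_row_other // (negPf nk).
Qed.

End PieriCoefficient.

(** The bound [B] is there for columns, whose membership can be tested only on the finitely many
    rows. *)
Lemma interval_inj (B m l m' l' : nat) : (l <= B)%N -> (l' <= B)%N ->
  (forall x, (x < B)%N -> (m <= x < l)%N = (m' <= x < l')%N) ->
  (m < l)%N -> m = m' /\ l = l'.
Proof.
move=> lB l'B H ml; have e := H m; have e' := H m'; have f := H l.-1; have f' := H l'.-1.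
have mB : (m < B)%N by exact: leq_trans lB.
have {}e : (m' <= m < l')%N by rewrite -e // leqnn ml.
have m'B : (m' < B)%N by lia.
have {}e' : (m <= m' < l)%N by rewrite e' //; lia.
have lB' : (l.-1 < B)%N by lia.
have l'B' : (l'.-1 < B)%N by lia.
have {}f : (m' <= l.-1 < l')%N by rewrite -f //; lia.
have {}f' : (m <= l'.-1 < l)%N by rewrite f' //; lia.
by lia.
Qed.

Lemma mul_div_cancel (K : fieldType) (a b c d : K) : c != 0 -> d != 0 ->
  a * b / d = a * c / d * (b / c).
Proof. by move=> c0 d0; field; rewrite c0 d0. Qed.

(** * Stem ratios, the recurrence for leaves and the induction *)

Section Leaf.
Variable n : nat.
Implicit Types (i : 'I_n.+1) (lam mu nu : 'X_{1..n.+1}) (j : nat).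

Lemma in_skew_row lam mu i j : in_skew lam mu i j = (mu i <= j < lam i)%N.
Proof. by rewrite /in_skew -leqNgt andbC. Qed.

Lemma in_skew_col lam mu i j : is_part lam -> is_part mu ->
  in_skew lam mu i j = (conj_part mu j <= i < conj_part lam j)%N.
Proof. by move=> pl pm; rewrite /in_skew !conj_partP // -leqNgt andbC. Qed.

Local Notation box_factor lam mu i j :=
  (stem_factor rr (lam i) (mu i) (conj_part lam j) (conj_part mu j) i j).

(** A common rectangle, with factor 1 outside [mu], lets stems of different pairs be combined box by
    box. *)
Lemma stemE N lam mu : (forall i, (mu i <= N)%N) ->
  stem lam mu = \prod_(i < n.+1) \prod_(j < N) box_factor lam mu i j.
Proof.
move=> muN; rewrite /stem -!big_split; apply: eq_bigr => i _ /=.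
pose f j := box_factor lam mu i j.
transitivity (\prod_(j < mu i) f j); last first.
  rewrite (big_ord_widen N f) // big_mkcond; apply: eq_bigr => j _ /=.
  by case: ltnP => // mj; rewrite stem_factor_out.
rewrite [X in X * _ * _]big_mkcond [X in _ * X * _]big_mkcond [X in _ * _ * X]big_mkcond.
rewrite -!big_split; apply: eq_bigr => j _ /=.
by rewrite /f /stem_factor /in_C /in_R /in_J ltn_ord.
Qed.

Lemma stem_neq0 lam mu : stem lam mu != 0.
Proof.
rewrite (@stemE (mdeg mu)) => [|i]; last by rewrite mdegE (bigD1 i) //= leq_addr.
by apply/prodf_neq0 => i _; apply/prodf_neq0 => j _; exact: (stem_factor_neq0 rr_generic).
Qed.

Lemma leq_mdeg lam i : (lam i <= mdeg lam)%N.
Proof. by rewrite mdegE (bigD1 i) //= leq_addr. Qed.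

Lemma pieri_stem lam i : is_part lam -> removable lam i ->
  pieri lam i = stem lam (lam - U_(i))%MM.
Proof.
move=> pl /andP[li pn]; rewrite (@stemE (mdeg lam)) => [|k]; last first.
  by apply: leq_trans (leq_mdeg lam k); rewrite mnmBE leq_subr.
apply: (pieri_coefE rr_generic pl li pn).
by apply: leq_trans (leq_mdeg lam i); rewrite prednK // lt0n.
Qed.

Lemma skew_row lam mu lam' mu' i :
  (forall i j, in_skew lam mu i j = in_skew lam' mu' i j) ->
  (mu i < lam i)%N -> mu i = mu' i /\ lam i = lam' i.
Proof.
move=> sk; apply: (@interval_inj (maxn (lam i) (lam' i))); rewrite ?leq_maxl ?leq_maxr //.
by move=> x _; rewrite -!in_skew_row.
Qed.

Lemma skew_col lam mu lam' mu' j : is_part lam -> is_part mu -> is_part lam' -> is_part mu' ->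
  (forall i j, in_skew lam mu i j = in_skew lam' mu' i j) ->
  (conj_part mu j < conj_part lam j)%N ->
  conj_part mu j = conj_part mu' j /\ conj_part lam j = conj_part lam' j.
Proof.
move=> pl pm pl' pm' sk; apply: (@interval_inj n.+1); rewrite ?conj_part_le //.
move=> x xn; have := sk (Ordinal xn) j; by rewrite !in_skew_col.
Qed.

Lemma stem_ratio lam nu mu lam' nu' mu' :
  is_part lam -> is_part nu -> is_part mu -> is_part lam' -> is_part nu' -> is_part mu' ->
  (mu <= nu)%MM -> (nu <= lam)%MM -> (mu' <= nu')%MM -> (nu' <= lam')%MM ->
  (forall i j, in_skew lam mu i j = in_skew lam' mu' i j) ->
  (forall i j, in_skew nu mu i j = in_skew nu' mu' i j) ->
  stem lam nu * stem nu mu / stem lam mu = stem lam' nu' * stem nu' mu' / stem lam' mu'.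
Proof.
move=> pl pn pm pl' pn' pm' mn nl mn' nl' sk skn.
pose N := (mdeg lam + mdeg lam')%N.
have bl i : (lam i <= N)%N by apply: leq_trans (leq_mdeg _ _) (leq_addr _ _).
have bl' i : (lam' i <= N)%N by apply: leq_trans (leq_mdeg _ _) (leq_addl _ _).
have bn i : (nu i <= N)%N by apply: leq_trans (bl i); exact: (mnm_lepP nl).
have bn' i : (nu' i <= N)%N by apply: leq_trans (bl' i); exact: (mnm_lepP nl').
have bm i : (mu i <= N)%N by apply: leq_trans (bn i); exact: (mnm_lepP mn).
have bm' i : (mu' i <= N)%N by apply: leq_trans (bn' i); exact: (mnm_lepP mn').
have prodE (a b c : 'X_{1..n.+1}) : (forall i, (b i <= N)%N) -> (forall i, (c i <= N)%N) ->
    stem a b * stem b c / stem a c = \prod_(i < n.+1) \prod_(j < N)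
      (box_factor a b i j * box_factor b c i j / box_factor a c i j).
  move=> bb bc; rewrite !(@stemE N) // -prodfV -!big_split; apply: eq_bigr => i _ /=.
  by rewrite -prodfV -!big_split.
rewrite !prodE //; apply: eq_bigr => i _; apply: eq_bigr => j _.
have unmod (a b c : 'X_{1..n.+1}) :
    is_part a -> is_part b -> is_part c -> (c <= b)%MM -> (b <= a)%MM ->
    (a i == c i) || (conj_part a j == conj_part c j) ->
    box_factor a b i j * box_factor b c i j / box_factor a c i j = 1.
  move=> pa pb pc cb ba un; rewrite (stem_factor_unmodified rr_generic).
  - by rewrite divff // (stem_factor_neq0 rr_generic).
  - by rewrite (mnm_lepP cb) (mnm_lepP ba).
  - by rewrite !conj_part_mono.
  - exact: conj_part_lt.
  exact: un.
have sk' i' j' : in_skew lam' mu' i' j' = in_skew lam mu i' j' by rewrite sk.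
have skn' i' j' : in_skew nu' mu' i' j' = in_skew nu mu i' j' by rewrite skn.
have ml i' : (mu i' <= lam i')%N := leq_trans (mnm_lepP mn i') (mnm_lepP nl i').
have ml' i' : (mu' i' <= lam' i')%N := leq_trans (mnm_lepP mn' i') (mnm_lepP nl' i').
have cml : (conj_part mu j <= conj_part lam j)%N by apply/conj_part_mono/mnm_lepP.
have cml' : (conj_part mu' j <= conj_part lam' j)%N by apply/conj_part_mono/mnm_lepP.
(* A box whose row or column misses [lam / mu] contributes 1, and the same then holds for the other
   pair. *)
have [un|] := boolP ((lam i == mu i) || (conj_part lam j == conj_part mu j)).
  rewrite !unmod //; apply: contraLR un; rewrite !negb_or => /andP[rl cl].
  have rl' : (mu' i < lam' i)%N by rewrite ltn_neqAle eq_sym rl ml'.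
  have cl' : (conj_part mu' j < conj_part lam' j)%N by rewrite ltn_neqAle eq_sym cl cml'.
  have [e1 e2] := skew_row sk' rl'; have [e3 e4] := skew_col pl' pm' pl pm sk' cl'.
  by rewrite -e1 -e2 -e3 -e4 rl cl.
rewrite negb_or => /andP[rl cl].
have {}rl : (mu i < lam i)%N by rewrite ltn_neqAle eq_sym rl ml.
have {}cl : (conj_part mu j < conj_part lam j)%N by rewrite ltn_neqAle eq_sym cl cml.
have [e1 e2] := skew_row sk rl; have [e3 e4] := skew_col pl pm pl' pm' sk cl.
(* If row [i] meets [nu / mu], that skew diagram determines [nu i]; otherwise [nu i = mu i], which
   is already known. Columns are treated alike. *)
have e5 : nu i = nu' i.
  case: (ltnP (mu i) (nu i)) => [/(skew_row skn) [] //|le].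
  case: (ltnP (mu' i) (nu' i)) => [/(skew_row skn') [] //|le'].
  by have := mnm_lepP mn i; have := mnm_lepP mn' i; lia.
have e6 : conj_part nu j = conj_part nu' j.
  case: (ltnP (conj_part mu j) (conj_part nu j)) => [/(skew_col pn pm pn' pm' skn) [] //|le].
  case: (ltnP (conj_part mu' j) (conj_part nu' j)) => [/(skew_col pn' pm' pn pm skn') [] //|le'].
  by have := conj_part_mono j mn; have := conj_part_mono j mn'; lia.
by rewrite e1 e2 e3 e4 e5 e6.
Qed.

Lemma jack_binomial_notin lam mu : is_part lam -> is_part mu -> ~~ (mu <= lam)%MM ->
  jack_binomial lam mu = 0.
Proof.
have [d] := ubnP (mdeg lam); elim: d lam => // d IH lam ld pl pm nle.
rewrite jack_binomial_rec // /binomial_step; case: ifP => _.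
  by case: eqP => // e; rewrite e lepm_refl in nle.
rewrite big1 ?mulr0 // => i /andP[li pi]; rewrite IH ?mulr0 //.
  by rewrite -ltnS -mdeg_subU.
by apply: contra nle => /lepm_trans; apply; exact: lem_subr.
Qed.

Lemma jack_binomial_id lam : is_part lam -> jack_binomial lam lam = 1.
Proof. by move=> pl; rewrite jack_binomial_rec // /binomial_step !eqxx. Qed.

Lemma stem_id lam : stem lam lam = 1.
Proof.
rewrite (@stemE (mdeg lam)); last exact: leq_mdeg.
by rewrite big1 // => i _; rewrite big1 // => j _; exact: stem_factor_id.
Qed.

Lemma lepm_mdeg_eq mu lam : (mu <= lam)%MM -> mdeg mu = mdeg lam -> mu = lam.
Proof.
move=> le; rewrite -{1}(submK le) mdegD => /esym/eqP.
rewrite -{2}[mdeg mu]add0n eqn_add2r mdeg_eq0 => /eqP e.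
by rewrite -(submK le) e add0m.
Qed.

Definition inner_corner lam mu i := removable lam i && (mu <= lam - U_(i))%MM.

(** Corners whose removal leaves a diagram not containing [mu] drop out, since their binomial
    coefficients vanish. *)
Lemma leaf_rec lam mu : is_part lam -> is_part mu -> mdeg mu != mdeg lam ->
  leaf lam mu = ((mdeg lam)%:R - (mdeg mu)%:R)^-1 *
    \sum_(i | inner_corner lam mu i)
      (stem lam (lam - U_(i))%MM * stem (lam - U_(i))%MM mu / stem lam mu)
        * leaf (lam - U_(i))%MM mu.
Proof.
move=> pl pm ne; rewrite /leaf jack_binomial_rec // /binomial_step (negPf ne) -mulrA.
congr (_ * _); rewrite mulr_suml /inner_corner [RHS]big_mkcondr; apply: eq_bigr => i ri.
have [_ pi] := andP ri; case: ifPn => [le|nle]; last first.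
  by rewrite jack_binomial_notin // mulr0 mul0r.
by rewrite pieri_stem //; apply: mul_div_cancel; exact: stem_neq0.
Qed.

(** Inner corners can be read off the skew diagram, although [removable] also involves rows outside
    it. *)
Lemma inner_corner_skew lam mu lam' mu' i :
  is_part lam -> is_part mu -> is_part lam' -> is_part mu' ->
  (mu <= lam)%MM -> (mu' <= lam')%MM ->
  (forall i j, in_skew lam mu i j = in_skew lam' mu' i j) ->
  inner_corner lam mu i -> inner_corner lam' mu' i.
Proof.
move=> pl pm pl' pm' ml ml' sk /andP[/andP[li pi] le].
have rl : (mu i < lam i)%N.
  by have := mnm_lepP le i; rewrite mnmBE mnm1E eqxx; move: li; lia.
have [e1 e2] := skew_row sk rl.
rewrite /inner_corner /removable -e2 li /=; apply/andP; split; last first.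
  apply/mnm_lepP => k; rewrite mnmBE mnm1E; have := mnm_lepP ml' k.
  by case: (eqVneq i k) => [<-|_] /=; lia.
apply/is_partP => a b ab; rewrite !mnmBE !mnm1E.
have lab := is_partP _ pl' _ _ ab.
case: (eqVneq i a) ab lab => [<-|_] ab lab /=; last by lia.
case: (eqVneq i b) => [<- //|ib] /=.
rewrite subn0 leqNgt; apply/negP => lt.
have mb := is_partP _ pm' _ _ ab.
(* If a lower row [b] of [lam'] were as long as row [i], its last box would lie in the skew diagram
   because [mu' b <= mu' i]; then row [b] of [lam] would also reach that column, against the
   removability of [i]. *)
have : in_skew lam' mu' b (lam i).-1.
  by rewrite in_skew_row -e2 in lt *; move: li lt mb rl; rewrite -e1; lia.
rewrite -sk in_skew_row => /andP[_ lb].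
have := is_partP _ pi _ _ ab; rewrite !mnmBE !mnm1E eqxx (negPf ib).
by move: li lb; lia.
Qed.

Lemma skew_subU lam mu lam' mu' i :
  (forall i j, in_skew lam mu i j = in_skew lam' mu' i j) -> (mu i < lam i)%N ->
  forall k j, in_skew (lam - U_(i))%MM mu k j = in_skew (lam' - U_(i))%MM mu' k j.
Proof.
move=> sk rl k j; have [e1 e2] := skew_row sk rl; have := sk k j.
rewrite !in_skew_row !mnmBE !mnm1E; case: (eqVneq i k) => [<-|_]; rewrite ?subn0 //.
by rewrite e1 e2.
Qed.

Lemma skew_mdeg lam mu lam' mu' : (mu <= lam)%MM -> (mu' <= lam')%MM ->
  (forall i j, in_skew lam mu i j = in_skew lam' mu' i j) ->
  (mdeg lam + mdeg mu' = mdeg lam' + mdeg mu)%N.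
Proof.
move=> ml ml' sk; rewrite !mdegE -!big_split; apply: eq_bigr => i _ /=.
have sk' i' j' : in_skew lam' mu' i' j' = in_skew lam mu i' j' by rewrite sk.
case: (ltnP (mu i) (lam i)) => [/(skew_row sk) [-> ->] //|le].
case: (ltnP (mu' i) (lam' i)) => [/(skew_row sk') [-> ->] //|le'].
by have := mnm_lepP ml i; have := mnm_lepP ml' i; lia.
Qed.

Lemma leaf_id lam : is_part lam -> leaf lam lam = 1.
Proof. by move=> pl; rewrite /leaf jack_binomial_id // stem_id divr1. Qed.

Lemma leaf_skew lam mu lam' mu' :
  is_part lam -> is_part mu -> is_part lam' -> is_part mu' ->
  (mu <= lam)%MM -> (mu' <= lam')%MM ->
  (forall i j, in_skew lam mu i j = in_skew lam' mu' i j) ->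
  leaf lam mu = leaf lam' mu'.
Proof.
have [d] := ubnP (mdeg lam); elim: d lam lam' => // d IH lam lam' ld pl pm pl' pm' ml ml' sk.
have deg := skew_mdeg ml ml' sk.
have sk' i j : in_skew lam' mu' i j = in_skew lam mu i j by rewrite sk.
have [e|ne] := eqVneq (mdeg mu) (mdeg lam).
  have e' : mdeg mu' = mdeg lam' by lia.
  by rewrite -(lepm_mdeg_eq ml e) -(lepm_mdeg_eq ml' e') !leaf_id.
have ne' : mdeg mu' != mdeg lam' by apply: contra_neq ne; lia.
rewrite !leaf_rec //; congr (_^-1 * _).
  by apply/eqP; rewrite subr_eq addrAC eq_sym subr_eq -!natrD; apply/eqP; congr (_%:R); lia.
have corner i : inner_corner lam mu i = inner_corner lam' mu' i.
  apply/idP/idP.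
    exact: (inner_corner_skew pl pm pl' pm' ml ml' sk).
  exact: (inner_corner_skew pl' pm' pl pm ml' ml sk').
rewrite (eq_bigl _ _ corner); apply: eq_bigr => i ci'.
have ci : inner_corner lam mu i by rewrite corner.
have /andP[/andP[li pi] le] := ci; have /andP[/andP[li' pi'] le'] := ci'.
have rl : (mu i < lam i)%N.
  by have := mnm_lepP le i; rewrite mnmBE mnm1E eqxx; move: li; lia.
have skn := skew_subU sk rl.
congr (_ * _); first exact: (stem_ratio pl pi pm pl' pi' pm' le (lem_subr _ _) le' (lem_subr _ _)).
by apply: IH => //; rewrite -ltnS -mdeg_subU.
Qed.

End Leaf.

Theorem theorem0p1 (M : nat) (hM : (0 < M)%N)
    (lam mu lam' mu' : 'X_{1..M})
    (hlam : is_part lam) (hmu : is_part mu)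
    (hlam' : is_part lam') (hmu' : is_part mu')
    (hsub : (mu <= lam)%MM) (hsub' : (mu' <= lam')%MM)
    (hskew : forall (i : 'I_M) (j : nat),
        in_skew lam mu i j = in_skew lam' mu' i j) :
  leaf lam mu = leaf lam' mu'.
Proof.
case: M hM lam mu lam' mu' hlam hmu hlam' hmu' hsub hsub' hskew => // n _ lam mu lam' mu'.
exact: leaf_skew.
Qed.
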